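(* Suppose $\Omega\subset\mathbb{C}^n$ is a visibility domain with respect to the Kobayashi distance that is taut, and that $F:\Omega\to\Omega$ is a holomorphic map. Then exactly one of the following holds: 1. for each $z\in\Omega$, the orbit $\{F^\nu(z) : \nu\in\mathbb{Z}_+\}$ is relatively compact in $\Omega$; or 2. there exists a $\xi\in\partial\Omega$ such that $\lim_{\nu\to\infty}F^\nu(z)=\xi$ for every $z\in\Omega$, this convergence being uniform on compact subsets of $\Omega$.
   Context: Notation. $\mathbb{Z}_+$ is the set of positive integers and $F^\nu$ is the $\nu$-fold iterate of $F$. $\mathbb{D}\subset\mathbb{C}$ is the open unit disk. For a bounded domain $\Omega\subset\mathbb{C}^n$, the Kobayashi(--Royden) metric is $\kappa_\Omega(z;v)=\inf\{|\xi| : \xi\in\mathbb{C},\ \exists\,\varphi:\mathbb{D}\to\Omega \text{ holomorphic with } \varphi(0)=z,\ \varphi'(0)\xi=v\}$ for $z\in\Omega$, $v\in\mathbb{C}^n$. The Kobayashi distance is $\mathsf{k}_\Omega(z,w)=\inf_\gamma\int_0^1\kappa_\Omega(\gamma(t);\gamma'(t))\,dt$, the infimum being over piecewise $\mathcal{C}^1$ paths $\gamma:[0,1]\to\Omega$ from $z$ to $w$. Almost-geodesics. For $\lambda\geq 1$, $\kappa\geq 0$ and an interval $I\subset\mathbb{R}$, a curve $\sigma:I\to\Omega$ is a $(\lambda,\kappa)$-almost-geodesic if (i) $\lambda^{-1}|t-s|-\kappa\leq \mathsf{k}_\Omega(\sigma(s),\sigma(t))\leq\lambda|t-s|+\kappa$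 for all $s,t\in I$; and (ii) $\sigma$ is absolutely continuous and $\kappa_\Omega(\sigma(t);\sigma'(t))\leq\lambda$ for almost every $t\in I$. Visibility domain. A bounded domain $\Omega\subset\mathbb{C}^n$ is a visibility domain with respect to the Kobayashi distance if, given any $\lambda\geq1$ and $\kappa\geq0$, for each pair of distinct points $\xi,\eta\in\partial\Omega$ and each pair of $\overline\Omega$-open neighbourhoods $V$ of $\xi$ and $W$ of $\eta$ with $\overline V\cap\overline W=\varnothing$, there is a compact set $K\subset\Omega$ such that the image of each $(\lambda,\kappa)$-almost-geodesic $\sigma:[0,L]\to\Omega$ with $\sigma(0)\in V$, $\sigma(L)\in W$ intersects $K$. Taut. $\Omega$ is taut if every sequence of holomorphic maps $\mathbb{D}\to\Omega$ has a subsequence that either converges uniformly on compact subsets to a holomorphic map $\mathbb{D}\to\Omega$ or is compactly divergent (i.e. for all compact $L\subset\mathbb{D}$, $K\subset\Omega$, the image of $L$ is eventually disjoint from $K$). *)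

(* Defs.v *)
(* Everything below is stated over R[i] for an arbitrary realType R, using    *)
(* MathComp-Analysis. C^n is 'rV[R[i]]_n with its sup norm. Maps whose domain *)
(* is a subset are represented by total functions, and only their values on   *)
(* that subset matter.                                                        *)
From HB Require Import structures.
From mathcomp Require Import all_boot all_order all_algebra.
From mathcomp Require Import all_classical all_reals all_analysis.
From mathcomp Require Import complex.
Set Implicit Arguments.
Unset Strict Implicit.
Unset Printing Implicit Defensive.
Import Order.TTheory GRing.Theory Num.Theory numFieldNormedType.Exports.
Local Open Scope classical_set_scope.
Local Open Scope ring_scope.

(* numFieldNormedType.Exports equips abstract numFieldTypes only; these give  *)
(* R[i] the same (definitionally equal) structures.                           *)
HB.instance Definition _ (R : realType) := GRing.ComAlgebra.copy R[i] R[i]^o.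
HB.instance Definition _ (R : realType) := Vector.copy R[i] R[i]^o.
HB.instance Definition _ (R : realType) := NormedModule.copy R[i] R[i]^o.

(* [differentiable] over the scalar field R[i] is complex differentiability.  *)
(* This is the usual notion of holomorphy when A is open, as it is in every   *)
(* use below.                                                                 *)
Definition holomorphic_map (R : realType) (V W : normedModType R[i])
    (A : set V) (B : set W) (f : V -> W) : Prop :=
  forall z, A z -> B (f z) /\ differentiable f z.

Definition unit_disk (R : realType) : set R[i] := [set z | `|z| < 1].
Arguments unit_disk : clear implicits.

Definition compactly_cvg (U : topologicalType) (V : uniformType) (A : set U)
    (f_ : nat -> U -> V) (f : U -> V) : Prop :=
  forall K : set U, compact K -> K `<=` A -> {uniform K, f_ @ \oo --> f}.

Definition bdry (T : topologicalType) (A : set T) : set T :=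
  closure A `\` interior A.

Definition relatively_compact_in (T : topologicalType) (A B : set T) : Prop :=
  compact (closure A) /\ closure A `<=` B.

Section Kobayashi.
Context {R : realType} {n : nat}.
Local Notation C := R[i].
Local Notation Cn := 'rV[C]_n.
Local Notation mu := (@lebesgue_measure R).

Definition bounded_domain (Omega : set Cn) : Prop :=
  [/\ Omega !=set0, open Omega, connected Omega & bounded_set Omega].

(* The library's derivative of a function from R needs a codomain normed over *)
(* R, whereas Cn is normed over C; hence the explicit difference quotients.   *)
Definition diff_quot (g : R -> Cn) (t s : R) : Cn :=
  ((s - t)^-1)%:C%C *: (g s - g t).

Definition real_derivable (g : R -> Cn) (t : R) : Prop :=
  cvg (diff_quot g t @ t^').

Definition real_derive (g : R -> Cn) (t : R) : Cn :=
  lim (diff_quot g t @ t^').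

(* The norm of C takes its values in C, and complex.Re reads it as a real.    *)
Definition kobayashi_metric (Omega : set Cn) (z v : Cn) : R :=
  inf [set complex.Re `|xi| | xi in
        [set xi : C | exists phi : C -> Cn,
          [/\ holomorphic_map (unit_disk R) Omega phi,
              phi 0 = z & xi *: derive1 phi 0 = v]]].

(* C^1 on the closed interval, with one-sided derivatives at its end points.  *)
Definition C1_on (a b : R) (g : R -> Cn) : Prop :=
  exists2 dg : R -> Cn, {within `[a, b], continuous dg} &
    forall t, `[a, b]%classic t ->
      diff_quot g t @ within `[a, b]%classic t^' --> dg t.

Definition piecewise_C1 (a b : R) (g : R -> Cn) : Prop :=
  {within `[a, b], continuous g} /\
  exists2 s : seq R, itv_partition a b s &
    forall i, (i < size s)%N -> C1_on (nth b (a :: s) i) (nth b s i) g.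

(* At the finitely many break points real_derive may be meaningless, which    *)
(* does not affect the integral.                                              *)
Definition kobayashi_dist (Omega : set Cn) (z w : Cn) : \bar R :=
  ereal_inf
    [set (\int[mu]_(t in `[0%R, 1%R])
            (kobayashi_metric Omega (g t) (real_derive g t))%:E)%E | g in
      [set g : R -> Cn |
        [/\ piecewise_C1 0 1 g, (forall t, `[0, 1]%classic t -> Omega (g t)),
            g 0 = z & g 1 = w]]].

Definition absolutely_continuous_on (I : set R) (g : R -> Cn) : Prop :=
  forall eps : R, 0 < eps -> exists2 delta : R, 0 < delta &
    forall (m : nat) (a b : 'I_m -> R),
      (forall i, a i <= b i /\ `[a i, b i] `<=` I) ->
      trivIset setT (fun i => `]a i, b i[%classic) ->
      \sum_i (b i - a i) < delta ->
      \sum_i complex.Re `|g (b i) - g (a i)| < eps.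

Definition almost_geodesic (Omega : set Cn) (lambda kappa : R)
    (I : interval R) (sigma : R -> Cn) : Prop :=
  [/\ forall t, t \in I -> Omega (sigma t),
      forall s t, s \in I -> t \in I ->
        ((lambda^-1 * `|t - s| - kappa)%:E
           <= kobayashi_dist Omega (sigma s) (sigma t)
           <= (lambda * `|t - s| + kappa)%:E)%E,
      absolutely_continuous_on [set` I] sigma &
      {ae mu, forall t, t \in I -> real_derivable sigma t /\
        kobayashi_metric Omega (sigma t) (real_derive sigma t) <= lambda}].

Definition open_nbhs_in_closure (Omega : set Cn) (xi : Cn) (V : set Cn) :=
  V xi /\ exists2 U : set Cn, open U & V = closure Omega `&` U.

Definition visibility_domain (Omega : set Cn) : Prop :=
  bounded_domain Omega /\
  forall lambda kappa : R, 1 <= lambda -> 0 <= kappa ->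
  forall xi eta : Cn, bdry Omega xi -> bdry Omega eta -> xi <> eta ->
  forall V W : set Cn,
    open_nbhs_in_closure Omega xi V -> open_nbhs_in_closure Omega eta W ->
    closure V `&` closure W = set0 ->
  exists K : set Cn, [/\ compact K, K `<=` Omega &
    forall (L : R) (sigma : R -> Cn), 0 <= L ->
      almost_geodesic Omega lambda kappa `[0, L] sigma ->
      V (sigma 0) -> W (sigma L) ->
      (sigma @` `[0, L]) `&` K !=set0].

Definition compactly_divergent (Omega : set Cn) (phi_ : nat -> C -> Cn) :=
  forall (L : set C) (K : set Cn),
    compact L -> L `<=` unit_disk R -> compact K -> K `<=` Omega ->
    \forall k \near \oo, (phi_ k @` L) `&` K = set0.

Definition taut (Omega : set Cn) : Prop :=
  forall phi_ : nat -> C -> Cn,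
    (forall k, holomorphic_map (unit_disk R) Omega (phi_ k)) ->
  exists2 j : nat -> nat, {homo j : k l / (k < l)%N} &
    (exists2 psi : C -> Cn, holomorphic_map (unit_disk R) Omega psi &
       compactly_cvg (unit_disk R) (phi_ \o j) psi) \/
    compactly_divergent Omega (phi_ \o j).

End Kobayashi.

(* Main.v *)
(* Let d be the distance defined by polygonal paths whose velocities have
   Kobayashi length at most 1. It is dominated by the Kobayashi distance (the
   metric is upper semicontinuous) and, conversely, a polygon of length L gives
   kobayashi_dist <= L. So polygons that are nearly shortest are almost
   geodesics, and for distinct boundary points xi, eta visibility yields a
   compact K with inf over p in K of d(x, p) + d(p, y) <= d(x, y) for x near xi
   and y near eta. Moreover F contracts d, and |x - y| <= C d(x, y) by Cauchy's
   estimate.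

   If the iterates F^m do not leave every compact set uniformly on compact sets,
   some orbit has a limit point w in Omega. Then w is recurrent and its orbit is
   relatively compact, and tautness propagates this to all orbits. If they do
   leave, |F^m x - F^m y| -> 0 by visibility, so all orbits have the same limit
   points, all on the boundary. Such a limit point xi is unique: if
   d(o, F^m o) -> oo by Karlsson's record times, and otherwise because the
   infimum of the numbers a for which d(p, F^m q) <= a infinitely often near the
   boundary point could be decreased by a fixed amount. *)
From HB Require Import structures.
Require Import Defs.
From mathcomp Require Import all_boot all_order all_algebra.
From mathcomp Require Import all_classical all_reals all_analysis measurable_realfun.
From mathcomp Require Import complex ring lra.
Import Order.TTheory GRing.Theory Num.Theory numFieldNormedType.Exports.
Local Open Scope classical_set_scope.
Local Open Scope ring_scope.
Set Implicit Arguments.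
Unset Strict Implicit.
Unset Printing Implicit Defensive.

(** * Norms and compactness over the complex numbers *)

(** [holomorphic_map] gives differentiability point by point, and continuity of the derivative of F
    is not at hand. The image under F of a piecewise C^1 path is thus not known to be piecewise C^1,
    so [kobayashi_dist] is not visibly contracted by F. Polygons avoid this: the image of a segment
    is replaced by short chords, each controlled by upper semicontinuity of the metric at a single
    point. Run at Kobayashi speed at most 1, polygons are Lipschitz and differentiable off finitely
    many times, so a nearly shortest one is an almost-geodesic without reparametrisation.

    A visibility domain need not be complete for its Kobayashi distance. An orbit may approach the
    boundary while d(o, F^m o) stays bounded along a subsequence, and then Karlsson's argument
    breaks down; this forces the second argument for uniqueness of the limit point. There the gain
    at each round comes from the positive distance between K and the boundary point, compared in
    norm.

    Cauchy's estimate enters only as a Lipschitz bound of the norm by d, so a crude constant such as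
    16 is enough. *)

Definition nr {R : realType} {V : normedModType R[i]} (x : V) : R :=
  complex.Re `|x|.

Section NormRe.
Context {R : realType}.
Local Notation C := R[i].
Implicit Types V W : normedModType C.

Lemma nrE V (x : V) : `|x| = (nr x)%:C%C.
Proof. by rewrite /nr RRe_real// normr_real. Qed.

Lemma nr_ge0 V (x : V) : 0 <= nr x.
Proof. by rewrite -ler0c -nrE. Qed.

Lemma nrD V (x y : V) : nr (x + y) <= nr x + nr y.
Proof. by rewrite -lecR rmorphD /= -!nrE ler_normD. Qed.

Lemma nrN V (x : V) : nr (- x) = nr x.
Proof. by rewrite /nr normrN. Qed.

Lemma nr_distC V (x y : V) : nr (x - y) = nr (y - x).
Proof. by rewrite -nrN opprB. Qed.

Lemma nr_distD V (x y z : V) : nr (x - z) <= nr (x - y) + nr (y - z).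
Proof. by rewrite (le_trans _ (nrD _ _))// addrA subrK. Qed.

Lemma nrB V (x y : V) : nr (x - y) <= nr x + nr y.
Proof. by rewrite (le_trans (nrD _ _))// nrN. Qed.

Lemma nr0 V : nr (0 : V) = 0.
Proof. by rewrite /nr normr0. Qed.

Lemma nr_gt0 V (x : V) : (0 < nr x) = (x != 0).
Proof. by rewrite -normr_gt0 nrE -ltcR. Qed.

Lemma nrZ V (a : C) (x : V) : nr (a *: x) = nr a * nr x.
Proof. by apply: complexI; rewrite rmorphM /= -!nrE normrZ. Qed.

Lemma nrM (a b : C) : nr (a * b) = nr a * nr b.
Proof. by rewrite -nrZ. Qed.

Lemma nrV (a : C) : nr a^-1 = (nr a)^-1.
Proof. by apply: complexI; rewrite fmorphV /= -!nrE normfV. Qed.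

Lemma nr_real (r : R) : nr (r%:C%C : C) = `|r|.
Proof.
by rewrite /nr normc_def /= expr0n/= addr0 sqrtr_sqr.
Qed.

Lemma nrZr V (r : R) (x : V) : nr (r%:C%C *: x) = `|r| * nr x.
Proof. by rewrite nrZ nr_real. Qed.

Lemma Re_le_nr (z : C) : `|complex.Re z| <= nr z.
Proof. by rewrite -lecR -nrE normc_ge_Re. Qed.

Lemma Im_le_nr (z : C) : `|complex.Im z| <= nr z.
Proof.
rewrite -lecR -nrE -(normrN (complex.Im z)) -ReiNIm.
by rewrite (le_trans (normc_ge_Re _))// normrM !normc_def/= expr0n/= add0r expr1n sqrtr1 mulr1.
Qed.

Lemma nr_le_ReIm (z : C) : nr z <= `|complex.Re z| + `|complex.Im z|.
Proof.
rewrite {1}(complexE z) (le_trans (nrD _ _))// lerD ?nr_real// nrM nr_real.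
by rewrite /nr normc_def/= expr0n/= add0r expr1n sqrtr1 mul1r.
Qed.

Lemma nbhs_nrP V (x : V) (A : set V) :
  nbhs x A <-> exists2 e : R, 0 < e & forall y, nr (x - y) < e -> A y.
Proof.
split=> [/nbhs_normP[e /= e0 eA]|[e e0 eA]].
  have eE : e = (complex.Re e)%:C%C by rewrite RRe_real// gtr0_real.
  exists (complex.Re e); first by rewrite -ltcR -eE.
  by move=> y xy; apply: eA => /=; rewrite nrE eE ltcR.
apply/nbhs_normP; exists (e%:C%C); rewrite /= ?ltcR// => y /=.
by rewrite nrE ltcR; exact: eA.
Qed.

Lemma open_nrP V (A : set V) :
  open A <-> forall x, A x -> exists2 e : R, 0 < e & forall y, nr (x - y) < e -> A y.
Proof.
rewrite openE; split=> [oA x /oA /nbhs_nrP//|h x /h /nbhs_nrP//].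
Qed.

Lemma cvg_nrP V (T : Type) (F : set_system T) (FF : Filter F) (f : T -> V) (l : V) :
  f @ F --> l <-> forall e : R, 0 < e -> \forall x \near F, nr (l - f x) < e.
Proof.
split=> [fl e e0|h A /nbhs_nrP[e e0 eA]].
  by apply: (fl [set y | nr (l - y) < e]); apply/nbhs_nrP; exists e.
apply: filterS (h e e0) => x; exact: eA.
Qed.

Lemma cvg_real_nrP (T : Type) (F : set_system T) (FF : Filter F) (f : T -> R) (l : R) :
  f @ F --> l <-> forall e : R, 0 < e -> \forall x \near F, `|l - f x| < e.
Proof. exact: cvgrPdist_lt. Qed.

Lemma nbhs_realP (x : R) (A : set R) :
  nbhs x A <-> exists2 e : R, 0 < e & forall y, `|x - y| < e -> A y.
Proof.
by split=> [/nbhs_normP[e /= e0 eA]|[e e0 eA]]; [exists e|apply/nbhs_normP; exists e].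
Qed.

Lemma closure_nrP V (A : set V) (x : V) :
  closure A x <-> forall e : R, 0 < e -> exists2 y, A y & nr (x - y) < e.
Proof.
split=> [Ax e e0|h B /nbhs_nrP[e e0 eB]].
  have /Ax [y [Ay xy]] : nbhs x [set y | nr (x - y) < e] by apply/nbhs_nrP; exists e.
  by exists y.
by have [y Ay xy] := h e e0; exists y; split=> //; exact: eB.
Qed.

Lemma closed_nrP V (A : set V) :
  closed A <-> forall x, (forall e : R, 0 < e -> exists2 y, A y & nr (x - y) < e) -> A x.
Proof.
split=> [cA x /closure_nrP|h x /closure_nrP]; [exact: cA|exact: h].
Qed.

Lemma complex_pair_continuous : continuous (fun p : R * R => (p.1 +i* p.2)%C : C).
Proof.
move=> [a b]; apply/cvg_nrP => e e0 /=.
have e20 : 0 < e / 2 by lra.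
have h1 : nbhs a [set y : R | `|a - y| < e / 2].
  by apply/nbhs_realP; exists (e / 2).
have h2 : nbhs b [set y : R | `|b - y| < e / 2].
  by apply/nbhs_realP; exists (e / 2).
exists ([set y | `|a - y| < e / 2], [set y | `|b - y| < e / 2]) => //= -[c d] /= [ac bd].
by rewrite (le_lt_trans (nr_le_ReIm _))//=; lra.
Qed.

Lemma compact_disk (r : R) : compact [set z : C | nr z <= r].
Proof.
have K : compact ((fun p : R * R => (p.1 +i* p.2)%C : C) @` (`[-r, r] `*` `[-r, r])).
  apply: continuous_compact; first by apply: continuous_subspaceT; exact: complex_pair_continuous.
  by apply: compact_setX; exact: segment_compact.
apply: subclosed_compact K _.
  apply/closed_nrP => x h /=; apply/ler_addgt0Pr => e e0.
  have [y /= yr xy] := h e e0.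
  have := nr_distD x y 0; rewrite !subr0; lra.
move=> [a b] /= h; exists (a, b) => //=; split; rewrite /= in_itv/= -ler_norml.
  exact: le_trans (Re_le_nr (a +i* b)%C) h.
exact: le_trans (Im_le_nr (a +i* b)%C) h.
Qed.

Lemma nr_coord n (x : 'rV[C]_n) i : nr (x 0 i) <= nr x.
Proof.
rewrite -lecR -!nrE [leRHS]mx_normE.
exact: (@le_bigmax_cond _ _ _ _ (0 : 'I_1, i) xpredT (fun p => `|x p.1 p.2|%:nng)%R).
Qed.

Lemma nr_rV_lt n (x : 'rV[C]_n) (e : R) : 0 < e ->
  (forall i, nr (x 0 i) < e) -> nr x < e.
Proof.
move=> e0 h; have [x0|/mx_norm_neq0 [[i j] /= xij]] := eqVneq (mx_norm x) 0.
  by rewrite -ltcR -nrE [ltLHS]x0 ltcR.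
rewrite -ltcR -nrE [ltLHS]xij (ord1 i) nrE ltcR; exact: h.
Qed.

End NormRe.

Section Compactness.
Context {R : realType}.
Local Notation C := R[i].
Implicit Types V W : normedModType C.

Lemma invS_small (e : R) : 0 < e ->
  exists k : nat, forall m, (k <= m)%N -> m.+1%:R^-1 < e.
Proof.
move=> e0; exists (Num.truncn e^-1) => m km.
rewrite invf_plt ?posrE ?ltr0n// (lt_le_trans (truncnS_gt _))// ler_nat ltnS.
exact: km.
Qed.

Lemma invS_gt0 (k : nat) : 0 < k.+1%:R^-1 :> R.
Proof. by rewrite invr_gt0 ltr0n. Qed.

(** The cluster point is that of the filter of the sequence restricted to the indices satisfying
    [Q]. Hence no subsequence is extracted: every neighbourhood is visited at arbitrarily late
    indices in [Q]. *)
Lemma compact_seq_cluster (T : topologicalType) (K : set T) (Q : nat -> Prop)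
    (x : nat -> T) : compact K ->
    (forall N : nat, exists2 n, (N <= n)%N & Q n) -> (forall n, Q n -> K (x n)) ->
  exists2 p, K p & forall B, nbhs p B -> forall N, exists n, [/\ (N <= n)%N, Q n & B (x n)].
Proof.
move=> cK infQ xK.
pose F := x @ within Q \oo.
have FF : ProperFilter F.
  apply: fmap_proper_filter; split; last exact: within_filter.
  by move=> [N _ hN]; have [n Nn Qn] := infQ N; exact: (hN n Nn Qn).
have FK : F K by exists 0%N => // n _; exact: xK.
have [p [Kp clp]] := cK F FF FK.
exists p => // B nB N.
have FN : F (x @` [set n | (N <= n)%N /\ Q n]).
  by exists N => // n /= Nn Qn; exists n.
by have [_ [[n [Nn Qn] <-] Bn]] := clp _ _ FN nB; exists n.
Qed.

Lemma closed_bounded_rV_compact n (A : set 'rV[C]_n) (M : R) :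
  closed A -> (forall x, A x -> nr x <= M) -> compact A.
Proof.
move=> cA AM.
have K := @rV_compact C n (fun=> [set z : C | nr z <= M]) (fun=> @compact_disk R M).
apply: (subclosed_compact cA K) => x Ax i /=.
exact: le_trans (nr_coord x i) (AM _ Ax).
Qed.

Lemma bounded_set_nr V (A : set V) :
  bounded_set A -> exists2 M : R, 0 < M & forall x, A x -> nr x <= M.
Proof.
move=> [M [Mr h]]; exists (Num.max 1 (complex.Re M + 1)); first by rewrite lt_max ltr01.
move=> x Ax; have ME : M = (complex.Re M)%:C%C by rewrite RRe_real.
have := h (complex.Re M + 1)%:C%C _ x Ax; rewrite /= nrE lecR => hx.
by rewrite le_max hx ?orbT// ME ltcR ltrDl.
Qed.

Lemma compact_nr_bounded V (K : set V) :
  compact K -> exists M : R, forall x, K x -> nr x <= M.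
Proof.
move=> cK; apply: contrapT => /forallNP h.
have {h} hx (k : nat) : exists x, K x /\ k%:R < nr x.
  apply: contrapT => /forallNP h'; apply: (h k%:R) => x Kx.
  by rewrite leNgt; apply/negP => kx; exact: (h' x).
have [x xP] := choice hx.
have [p Kp clp] := @compact_seq_cluster _ K (fun=> True) x cK
  (fun N => ex_intro2 _ _ N (leqnn N) I) (fun n _ => (xP n).1).
have [k hk] : exists k : nat, nr p + 1 <= k%:R.
  by exists (Num.truncn (nr p + 1)).+1; rewrite ltW// truncnS_gt.
have [n [kn _ /= pn]] := clp [set y | nr (p - y) < 1]
  (proj2 (nbhs_nrP _ _) (ex_intro2 _ _ 1 ltr01 (fun y => id))) k.
have := (xP n).2; have : k%:R <= n%:R :> R by rewrite ler_nat.
have := nr_distD (x n) p 0; rewrite !subr0 nr_distC; lra.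
Qed.

Lemma nbhs_nr_ball V (p : V) (e : R) : 0 < e -> nbhs p [set y | nr (p - y) < e].
Proof. by move=> e0; apply/nbhs_nrP; exists e. Qed.

Lemma compact_open_margin V (K U : set V) : compact K -> open U -> K `<=` U ->
  exists2 e : R, 0 < e & forall x y, K x -> nr (x - y) < e -> U y.
Proof.
move=> cK /open_nrP oU KU; apply: contrapT => /forall2NP h.
have hx (k : nat) : exists xy : V * V, [/\ K xy.1, nr (xy.1 - xy.2) < k.+1%:R^-1 & ~ U xy.2].
  have [|/existsNP[x /existsNP[y]]] := h k.+1%:R^-1; first by move=> /(_ (invS_gt0 k)).
  by move=> /not_implyP[Kx /not_implyP[xy Uy]]; exists (x, y).
have [xy xyP] := choice hx.
have [p Kp clp] := @compact_seq_cluster _ K (fun=> True) (fun n => (xy n).1) cK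
  (fun N => ex_intro2 _ _ N (leqnn N) I) (fun n _ => let: And3 a _ _ := xyP n in a).
have [e e0 eU] := oU p (KU p Kp).
have e20 : 0 < e / 2 by lra.
have [k hk] := invS_small e20.
have [n [kn _ /= pn]] := clp _ (nbhs_nr_ball p e20) k.
have [_ xyn nU] := xyP n; apply: nU; apply: eU.
have := lt_trans xyn (hk n kn); have := nr_distD p (xy n).1 (xy n).2; lra.
Qed.

Definition thicken V (K : set V) (e : R) : set V :=
  [set y | exists2 x, K x & nr (x - y) <= e].

Lemma thicken_compact n (K : set 'rV[C]_n) e : compact K -> compact (thicken K e).
Proof.
move=> cK; have [M KM] := compact_nr_bounded cK.
apply: (@closed_bounded_rV_compact _ _ (M + e)); last first.
  move=> y [x Kx xy]; have := KM _ Kx; have := nr_distD y x 0.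
  rewrite !subr0 nr_distC; lra.
apply/closed_nrP => y h.
have hx (k : nat) : exists x, K x /\ nr (x - y) <= e + k.+1%:R^-1.
  have := h _ (invS_gt0 k); move: (k.+1%:R^-1) => d [z [x Kx xz] yz].
  exists x; split=> //; have := nr_distD x z y; have := nr_distC y z. lra.
have [x xP] := choice hx.
have [p Kp clp] := @compact_seq_cluster _ K (fun=> True) x cK
  (fun N => ex_intro2 _ _ N (leqnn N) I) (fun n _ => (xP n).1).
exists p => //; apply/ler_addgt0Pr => d d0.
have d20 : 0 < d / 2 by lra.
have [k hk] := invS_small d20.
have [m [km _ /= pm]] := clp _ (nbhs_nr_ball p d20) k.
have := le_trans (xP m).2 (ltW (ler_ltD (lexx e) (hk m km))).
have := nr_distD p (x m) y; lra.
Qed.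

Lemma compact_open_thicken n (K U : set 'rV[C]_n) : compact K -> open U -> K `<=` U ->
  exists2 e : R, 0 < e & compact (thicken K e) /\ thicken K e `<=` U.
Proof.
move=> cK oU KU; have [e e0 eU] := compact_open_margin cK oU KU.
exists (e / 2); [lra|split; first exact: thicken_compact].
move=> y [x Kx xy]; apply: (eU x) => //; lra.
Qed.

Lemma closed_nr_ball_compact n (p : 'rV[C]_n) (e : R) : compact [set y | nr (p - y) <= e].
Proof.
have -> : [set y | nr (p - y) <= e] = thicken [set p] e.
  by apply/seteqP; split=> y /= => [py|[_ -> //]]; exists p.
by apply: thicken_compact; exact: compact_set1.
Qed.

(** The local hypothesis makes [P] locally constant on [A], so [A] meets [P] in a set that is both
    relatively open and relatively closed. It serves for joining points by polygons and for
    spreading bounded orbits. *)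
Lemma connected_local_transfer V (A P : set V) : connected A -> open A ->
  (exists2 x, A x & P x) ->
  (forall x, A x -> exists2 e : R, 0 < e &
     forall y z, nr (x - y) < e -> nr (x - z) < e -> P y -> P z) ->
  forall x, A x -> P x.
Proof.
move=> cA oA [x0 Ax0 Px0] h.
have hb y : A y -> P y -> nbhs y (A `&` P).
  move=> Ay Py; have [e e0 eh] := h y Ay.
  apply: filterI; first by move: oA; rewrite openE; apply.
  apply/nbhs_nrP; exists e => // z yz; apply: (eh y) => //.
  by rewrite subrr nr0.
suff <- : A `&` P = A by move=> x [].
apply: cA; first by exists x0.
  exists (A `&` P); last by rewrite setIA setIid.
  by rewrite openE => y [Ay Py]; exact: hb.
exists (closure (A `&` P)); first exact: closed_closure.
apply/seteqP; split=> y [Ay]; first by move=> Py; split=> //; exact: subset_closure.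
move=> /closure_nrP cy; split=> //; have [e e0 eh] := h y Ay.
have [z [Az Pz] yz] := cy e e0; apply: (eh z) => //.
by rewrite subrr nr0.
Qed.

Lemma differentiable_nr V W (f : V -> W) (x : V) : differentiable f x ->
  forall e : R, 0 < e -> exists2 d : R, 0 < d &
    forall y, nr (x - y) < d -> nr (f y - f x - 'd f x (y - x)) <= e * nr (y - x).
Proof.
move=> df e e0.
have := diff_locally df => /eqaddoP/(_ e%:C%C); rewrite ltcR => /(_ e0).
move=> /nbhs_nrP[d d0 h]; exists d => // y xy.
have := h (y - x); rewrite sub0r opprB => /(_ xy).
rewrite /= !nrE -rmorphM lecR => hy.
have {hy} : nr (f (y - x + x) - (f x + 'd f x (y - x))) <= e * nr (y - x) := hy.
by rewrite subrK opprD addrA.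
Qed.

End Compactness.

(** * Goursat's theorem and a Cauchy estimate *)

Section IntervalIntegral.
Context {R : realType}.
Local Notation mu := (@lebesgue_measure R).

Definition itv_int (a b : R) (f : R -> R) : R := \int[mu]_(x in `[a, b]) f x.

Implicit Types (a b c : R) (f g : R -> R).

Lemma itv_integrable a b f : {within `[a, b], continuous f} ->
  mu.-integrable `[a, b] (EFin \o f).
Proof.
by move=> cf; apply: continuous_compact_integrable => //; exact: segment_compact.
Qed.

Lemma itv_int_split a b c f : a <= c -> c <= b -> {within `[a, b], continuous f} ->
  itv_int a b f = itv_int a c f + itv_int c b f.
Proof.
move=> ac cb cf; have intf := itv_integrable cf.
rewrite /itv_int -(@Rintegral_itv_obnd_cbnd _ c); last first.
  by apply: integrableS intf => //; apply: subset_itv; rewrite bnd_simp.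
by rewrite -(@Rintegral_itvB _ f (BLeft a) (BRight b) c)// ?bnd_simp//; lra.
Qed.

Lemma itv_int_cst a b (M : R) : a <= b -> itv_int a b (fun=> M) = M * (b - a).
Proof.
move=> ab; rewrite /itv_int Rintegral_cst//= lebesgue_measure_itv/= lte_fin.
have [_//|ba] := ltP a b; have -> : a = b by apply/eqP; rewrite eq_le ab ba.
by rewrite subrr.
Qed.

Lemma itv_int_le a b f g : {within `[a, b], continuous f} -> {within `[a, b], continuous g} ->
  (forall x, a <= x <= b -> f x <= g x) -> itv_int a b f <= itv_int a b g.
Proof.
move=> cf cg fg; apply: le_Rintegral => //; exact: itv_integrable.
Qed.

Lemma within_cst a b (M : R) : {within `[a, b], continuous (fun=> M)}.
Proof. by apply: continuous_subspaceT => x; exact: cvg_cst. Qed.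

Lemma itv_int_ge a b f (m : R) : a <= b -> {within `[a, b], continuous f} ->
  (forall x, a <= x <= b -> m <= f x) -> m * (b - a) <= itv_int a b f.
Proof. by move=> ab cf fm; rewrite -itv_int_cst//; apply: itv_int_le => //; exact: within_cst. Qed.

Lemma itv_int_le_cst a b f (m : R) : a <= b -> {within `[a, b], continuous f} ->
  (forall x, a <= x <= b -> f x <= m) -> itv_int a b f <= m * (b - a).
Proof. by move=> ab cf fm; rewrite -itv_int_cst//; apply: itv_int_le => //; exact: within_cst. Qed.

Lemma itv_int_norm_le a b f (M : R) : a <= b -> {within `[a, b], continuous f} ->
  (forall x, a <= x <= b -> `|f x| <= M) -> `|itv_int a b f| <= M * (b - a).
Proof.
move=> ab cf fM; rewrite ler_norml -mulNr itv_int_ge ?itv_int_le_cst//.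
  by move=> x /fM; rewrite ler_norml => /andP[].
by move=> x /fM; rewrite ler_norml => /andP[].
Qed.

Lemma itv_intB a b f g : {within `[a, b], continuous f} -> {within `[a, b], continuous g} ->
  itv_int a b (fun x => f x - g x) = itv_int a b f - itv_int a b g.
Proof. by move=> cf cg; rewrite /itv_int RintegralB//; exact: itv_integrable. Qed.

Lemma within_continuousB a b f g : {within `[a, b], continuous f} ->
  {within `[a, b], continuous g} -> {within `[a, b], continuous (fun x => f x - g x)}.
Proof. by move=> cf cg x; apply: cvgB; [exact: cf|exact: cg]. Qed.

End IntervalIntegral.

(** Here (a, b) is the lower left corner of a rectangle with sides l / 2^k and m / 2^k. Lower
    corners increase and upper corners decrease along the chosen sequence, so the suprema of the
    lower coordinates lie in every rectangle. Degenerate rectangles, with l = 0 or m = 0, are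
    allowed. *)
Lemma bisection_nest (R : realType) (l m : R) (bad : nat -> R -> R -> Prop) a0 b0 :
    0 <= l -> 0 <= m -> bad 0%N a0 b0 ->
    (forall k a b, bad k a b -> exists a' b', [/\ bad k.+1 a' b',
        a <= a', a' + l * 2^-1 ^+ k.+1 <= a + l * 2^-1 ^+ k,
        b <= b' & b' + m * 2^-1 ^+ k.+1 <= b + m * 2^-1 ^+ k]) ->
  exists A B, forall k, exists a b, [/\ bad k a b,
    a <= A <= a + l * 2^-1 ^+ k & b <= B <= b + m * 2^-1 ^+ k].
Proof.
move=> l0 m0 bad0 step.
have [f fP] : exists f : nat * (R * R) -> R * R, forall p, bad p.1 p.2.1 p.2.2 ->
    [/\ bad p.1.+1 (f p).1 (f p).2,
        p.2.1 <= (f p).1, (f p).1 + l * 2^-1 ^+ p.1.+1 <= p.2.1 + l * 2^-1 ^+ p.1,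
        p.2.2 <= (f p).2 & (f p).2 + m * 2^-1 ^+ p.1.+1 <= p.2.2 + m * 2^-1 ^+ p.1].
  pose Q (p : nat * (R * R)) (q : R * R) := bad p.1 p.2.1 p.2.2 ->
    [/\ bad p.1.+1 q.1 q.2,
        p.2.1 <= q.1, q.1 + l * 2^-1 ^+ p.1.+1 <= p.2.1 + l * 2^-1 ^+ p.1,
        p.2.2 <= q.2 & q.2 + m * 2^-1 ^+ p.1.+1 <= p.2.2 + m * 2^-1 ^+ p.1].
  suff /choice[f fP] : forall p, exists q, Q p q by exists f.
  move=> [k [a b]]; have [h|h] := pselect (bad k a b); last by exists (0, 0).
  by have [a' [b' ?]] := step k a b h; exists (a', b').
pose s := fix s k := if k is k'.+1 then f (k', s k') else (a0, b0).
have sbad k : bad k (s k).1 (s k).2 by elim: k => //= k /(fP (k, s k))[].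
have nested (w : R) (t : nat -> R) : 0 <= w ->
    (forall k, t k <= t k.+1 /\ t k.+1 + w * 2^-1 ^+ k.+1 <= t k + w * 2^-1 ^+ k) ->
    exists T, forall k, t k <= T <= t k + w * 2^-1 ^+ k.
  move=> w0 ht.
  have wk k : 0 <= w * 2^-1 ^+ k by rewrite mulr_ge0// exprn_ge0.
  have inc i j : t i <= t (i + j)%N.
    by elim: j => [|j ih]; rewrite ?addn0// addnS (le_trans ih)// (ht _).1.
  have dec i j : t (i + j)%N + w * 2^-1 ^+ (i + j) <= t i + w * 2^-1 ^+ i.
    by elim: j => [|j ih]; rewrite ?addn0// addnS (le_trans (ht _).2).
  have tub k j : t j <= t k + w * 2^-1 ^+ k.
    have [jk|/ltnW jk] := leqP j k.
      by rewrite (le_trans (inc j (k - j)%N))// subnKC// lerDl.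
    rewrite (le_trans _ (dec k (j - k)%N))// subnKC// lerDl//.
  exists (sup (range t)) => k; apply/andP; split.
    apply: ub_le_sup; last by exists k.
    by exists (t k + w * 2^-1 ^+ k) => _ [j _ <-].
  by apply: ge_sup; [exists (t 0%N), 0%N|move=> _ [j _ <-]].
have [A hA] := nested l (fun k => (s k).1) l0 (fun k =>
  let: And5 _ h1 h2 _ _ := fP (k, s k) (sbad k) in conj h1 h2).
have [B hB] := nested m (fun k => (s k).2) m0 (fun k =>
  let: And5 _ _ _ h1 h2 := fP (k, s k) (sbad k) in conj h1 h2).
by exists A, B => k; exists (s k).1, (s k).2; split.
Qed.

(** * Goursat's theorem by bisection of rectangles *)

Section Goursat.
Context {R : realType}.
Local Notation C := R[i].
Implicit Types (h : C -> C).

Lemma ReD (a b : C) : complex.Re (a + b) = complex.Re a + complex.Re b.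
Proof. by case: a; case: b. Qed.

Lemma ImD (a b : C) : complex.Im (a + b) = complex.Im a + complex.Im b.
Proof. by case: a; case: b. Qed.

Lemma ReB (a b : C) : complex.Re (a - b) = complex.Re a - complex.Re b.
Proof. by case: a; case: b. Qed.

Lemma ImB (a b : C) : complex.Im (a - b) = complex.Im a - complex.Im b.
Proof. by case: a; case: b. Qed.

(* The imaginary part of the integral of h over the boundary of the rectangle
   [x1, x2] x [y1, y2]. *)
Definition rect_int h (x1 x2 y1 y2 : R) : R :=
  itv_int x1 x2 (fun x => complex.Im (h (x +i* y1)%C)) -
  itv_int x1 x2 (fun x => complex.Im (h (x +i* y2)%C)) +
  (itv_int y1 y2 (fun y => complex.Re (h (x2 +i* y)%C)) -
   itv_int y1 y2 (fun y => complex.Re (h (x1 +i* y)%C))).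

Definition cont_hline h (x1 x2 y : R) :=
  forall x, x1 <= x <= x2 -> {for (x +i* y)%C, continuous h}.
Definition cont_vline h (y1 y2 x : R) :=
  forall y, y1 <= y <= y2 -> {for (x +i* y)%C, continuous h}.

Lemma cont_hline_within h x1 x2 y : cont_hline h x1 x2 y ->
  {within `[x1, x2], continuous (fun x => complex.Im (h (x +i* y)%C))}.
Proof.
move=> hc; apply: continuous_in_subspaceT => x; rewrite inE/= in_itv/= => /hc hx.
apply/cvg_real_nrP => e e0.
have /cvg_nrP /(_ e e0) /nbhs_nrP [d d0 hd] := hx.
apply/nbhs_realP; exists d => // t xt.
rewrite -ImB (le_lt_trans (Im_le_nr _))//; apply: hd.
by rewrite (le_lt_trans (nr_le_ReIm _))//= subrr normr0 addr0.
Qed.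

Lemma cont_vline_within h y1 y2 x : cont_vline h y1 y2 x ->
  {within `[y1, y2], continuous (fun y => complex.Re (h (x +i* y)%C))}.
Proof.
move=> hc; apply: continuous_in_subspaceT => y; rewrite inE/= in_itv/= => /hc hx.
apply/cvg_real_nrP => e e0.
have /cvg_nrP /(_ e e0) /nbhs_nrP [d d0 hd] := hx.
apply/nbhs_realP; exists d => // t xt.
rewrite -ReB (le_lt_trans (Re_le_nr _))//; apply: hd.
by rewrite (le_lt_trans (nr_le_ReIm _))//= subrr normr0 add0r.
Qed.

Lemma rect_int_cutx h x1 x2 y1 y2 c : x1 <= c -> c <= x2 ->
  cont_hline h x1 x2 y1 -> cont_hline h x1 x2 y2 ->
  rect_int h x1 x2 y1 y2 = rect_int h x1 c y1 y2 + rect_int h c x2 y1 y2.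
Proof.
move=> xc cx h1 h2; rewrite /rect_int.
rewrite (itv_int_split xc cx (cont_hline_within h1)).
by rewrite (itv_int_split xc cx (cont_hline_within h2)); ring.
Qed.

Lemma rect_int_cuty h x1 x2 y1 y2 c : y1 <= c -> c <= y2 ->
  cont_vline h y1 y2 x1 -> cont_vline h y1 y2 x2 ->
  rect_int h x1 x2 y1 y2 = rect_int h x1 x2 y1 c + rect_int h x1 x2 c y2.
Proof.
move=> yc cy h1 h2; rewrite /rect_int.
rewrite (itv_int_split yc cy (cont_vline_within h1)).
by rewrite (itv_int_split yc cy (cont_vline_within h2)); ring.
Qed.

(** The boundary integral of an affine function vanishes: the horizontal sides contribute p1 (y1 -
    y2) (x2 - x1) and the vertical sides its opposite, p1 being the real part of [p]. What remains
    is an error of at most 2 [eta] in each difference of values on opposite sides. *)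
Lemma rect_int_affine_approx h x1 x2 y1 y2 (p c : C) (eta : R) :
  x1 <= x2 -> y1 <= y2 ->
  (forall x y, x1 <= x <= x2 -> y1 <= y <= y2 -> {for (x +i* y)%C, continuous h}) ->
  (forall x y, x1 <= x <= x2 -> y1 <= y <= y2 ->
     nr (h (x +i* y)%C - (c + p * (x +i* y)%C)) <= eta) ->
  `|rect_int h x1 x2 y1 y2| <= 2 * eta * ((x2 - x1) + (y2 - y1)).
Proof.
move=> x12 y12 hc happ.
have y1y : y1 <= y1 <= y2 by rewrite lexx.
have y2y : y1 <= y2 <= y2 by rewrite lexx andbT.
have x1x : x1 <= x1 <= x2 by rewrite lexx.
have x2x : x1 <= x2 <= x2 by rewrite lexx andbT.
have ch1 := @cont_hline_within h x1 x2 y1 (fun x xx => hc x y1 xx y1y).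
have ch2 := @cont_hline_within h x1 x2 y2 (fun x xx => hc x y2 xx y2y).
have cv1 := @cont_vline_within h y1 y2 x1 (fun y yy => hc x1 y x1x yy).
have cv2 := @cont_vline_within h y1 y2 x2 (fun y yy => hc x2 y x2x yy).
case: p happ => p1 p2 happ.
have bI x y : x1 <= x <= x2 -> y1 <= y <= y2 ->
    `|complex.Im (h (x +i* y)%C) - (complex.Im c + (p1 * y + p2 * x))| <= eta.
  move=> xx yy; apply: le_trans (happ x y xx yy).
  by rewrite (le_trans _ (Im_le_nr _))// ImB ImD.
have bR x y : x1 <= x <= x2 -> y1 <= y <= y2 ->
    `|complex.Re (h (x +i* y)%C) - (complex.Re c + (p1 * x - p2 * y))| <= eta.
  move=> xx yy; apply: le_trans (happ x y xx yy).
  by rewrite (le_trans _ (Re_le_nr _))// ReB ReD.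
have H : `|itv_int x1 x2 (fun x => complex.Im (h (x +i* y1)%C) -
    complex.Im (h (x +i* y2)%C) - p1 * (y1 - y2))| <= 2 * eta * (x2 - x1).
  apply: itv_int_norm_le => //.
    by apply: within_continuousB; [exact: within_continuousB|exact: within_cst].
  move=> x xx; have := bI x y1 xx y1y; have := bI x y2 xx y2y.
  rewrite !ler_norml => /andP[? ?] /andP[? ?]; apply/andP; split; lra.
have V : `|itv_int y1 y2 (fun y => complex.Re (h (x2 +i* y)%C) -
    complex.Re (h (x1 +i* y)%C) - p1 * (x2 - x1))| <= 2 * eta * (y2 - y1).
  apply: itv_int_norm_le => //.
    by apply: within_continuousB; [exact: within_continuousB|exact: within_cst].
  move=> y yy; have := bR x1 y x1x yy; have := bR x2 y x2x yy.
  rewrite !ler_norml => /andP[? ?] /andP[? ?]; apply/andP; split; lra.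
move: H V; rewrite !itv_intB ?itv_int_cst//; do ?[exact: within_cst|exact: within_continuousB].
rewrite /rect_int !ler_norml => /andP[? ?] /andP[? ?]; apply/andP; split; nra.
Qed.

Lemma differentiable_continuous_for h z : differentiable h z -> {for z, continuous h}.
Proof. exact: differentiable_continuous. Qed.

(** If the integral exceeded e, one of the four quarters would carry more than e / 4, and so on. The
    nested rectangles of sizes 2^-k shrink to a point where h is differentiable, hence affine up to
    an error small compared with 2^-k. With a perimeter of order 2^-k, this makes the integral small
    compared with 4^-k. *)
Lemma goursat h x1 x2 y1 y2 : x1 <= x2 -> y1 <= y2 ->
  (forall x y, x1 <= x <= x2 -> y1 <= y <= y2 -> differentiable h (x +i* y)%C) ->
  rect_int h x1 x2 y1 y2 = 0.
Proof.
move=> x12 y12 hd; apply/eqP; rewrite -normr_eq0 eq_le normr_ge0 andbT.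
apply/ler_addgt0Pr => e e0; rewrite add0r leNgt; apply/negP => ebad.
pose l := x2 - x1; pose m := y2 - y1.
have l0 : 0 <= l by rewrite subr_ge0.
have m0 : 0 <= m by rewrite subr_ge0.
pose w k : R := 2^-1 ^+ k.
have w0 k : 0 < w k by rewrite exprn_gt0.
have wS k : w k.+1 = w k / 2 by rewrite /w exprSr.
pose bad k a b := [/\ x1 <= a, a + l * w k <= x2, y1 <= b, b + m * w k <= y2 &
  e * w k ^+ 2 < `|rect_int h a (a + l * w k) b (b + m * w k)|].
have bad0 : bad 0%N x1 y1.
  rewrite /bad /w expr0 expr1n !mulr1 (_ : x1 + l = x2); last by rewrite /l; ring.
  by rewrite (_ : y1 + m = y2)//; rewrite /m; ring.
have hcont x y : x1 <= x <= x2 -> y1 <= y <= y2 -> {for (x +i* y)%C, continuous h}.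
  by move=> xx yy; apply: differentiable_continuous_for; exact: hd.
have step k a b : bad k a b -> exists a' b', [/\ bad k.+1 a' b',
        a <= a', a' + l * 2^-1 ^+ k.+1 <= a + l * 2^-1 ^+ k,
        b <= b' & b' + m * 2^-1 ^+ k.+1 <= b + m * 2^-1 ^+ k].
  rewrite -/(w k) -/(w k.+1) wS => -[xa ax yb by_ hbad].
  have := w0 k; move: (w k) (wS k) xa ax yb by_ hbad => v vS xa ax yb by_ hbad v0.
  set a1 := a + l * (v / 2); set b1 := b + m * (v / 2).
  have lv : 0 <= l * v by rewrite mulr_ge0// ltW.
  have mv : 0 <= m * v by rewrite mulr_ge0// ltW.
  have l2 : 0 <= l * (v / 2) by rewrite mulrA divr_ge0.
  have m2 : 0 <= m * (v / 2) by rewrite mulrA divr_ge0.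
  have aa1 : a <= a1 by rewrite lerDl.
  have bb1 : b <= b1 by rewrite lerDl.
  have a1E : a1 + l * (v / 2) = a + l * v by rewrite /a1; field.
  have b1E : b1 + m * (v / 2) = b + m * v by rewrite /b1; field.
  have a1a : a1 <= a + l * v by rewrite -a1E lerDl.
  have b1b : b1 <= b + m * v by rewrite -b1E lerDl.
  have bbv : b <= b + m * v by rewrite lerDl.
  have hin x y : a <= x -> x <= a + l * v -> b <= y -> y <= b + m * v ->
      {for (x +i* y)%C, continuous h}.
    move=> ax' xa' b_y yb'; apply: hcont.
      by rewrite (le_trans xa ax') (le_trans xa' ax).
    by rewrite (le_trans yb b_y) (le_trans yb' by_).
  have split4 : rect_int h a (a + l * v) b (b + m * v) =
      rect_int h a a1 b b1 + rect_int h a a1 b1 (b + m * v) +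
      (rect_int h a1 (a + l * v) b b1 + rect_int h a1 (a + l * v) b1 (b + m * v)).
    rewrite (@rect_int_cutx h _ _ _ _ a1 aa1 a1a); last 2 first.
      by move=> x /andP[? ?]; exact: hin.
      by move=> x /andP[? ?]; exact: hin.
    have av : a <= a + l * v by rewrite lerDl.
    by congr (_ + _); apply: rect_int_cuty => // y /andP[? ?]; exact: hin.
  have eE : e * v ^+ 2 = e * (v / 2) ^+ 2 + e * (v / 2) ^+ 2 +
      (e * (v / 2) ^+ 2 + e * (v / 2) ^+ 2) by field.
  apply: contrapT => hno.
  have ok a' b' : a <= a' -> a' + l * (v / 2) <= a + l * v -> b <= b' ->
      b' + m * (v / 2) <= b + m * v ->
      `|rect_int h a' (a' + l * (v / 2)) b' (b' + m * (v / 2))| <= e * (v / 2) ^+ 2.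
    move=> h1 h2 h3 h4; rewrite leNgt; apply/negP => h5; apply: hno.
    exists a', b'; split=> //; rewrite /bad vS; split.
    - exact: le_trans xa h1.
    - exact: le_trans h2 ax.
    - exact: le_trans yb h3.
    - exact: le_trans h4 by_.
    - exact: h5.
  have := ok a b (lexx _) _ (lexx _) _; rewrite -/a1 -/b1 => /(_ a1a b1b) k1.
  have := ok a b1 (lexx _) _ bb1 _; rewrite -/a1 b1E => /(_ a1a (lexx _)) k2.
  have := ok a1 b aa1 _ (lexx _) _; rewrite -/b1 a1E => /(_ (lexx _) b1b) k3.
  have := ok a1 b1 aa1 _ bb1 _; rewrite a1E b1E => /(_ (lexx _) (lexx _)) k4.
  move: hbad; rewrite split4 eE ltNge => /negP; apply.
  rewrite (le_trans (ler_normD _ _))// lerD// (le_trans (ler_normD _ _))//; exact: lerD.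
have [A [B AB]] := bisection_nest l0 m0 bad0 step.
have AB0 : x1 <= A <= x2 /\ y1 <= B <= y2.
  have := AB 0%N; rewrite -/(w 0%N) => -[a [b [[? ? ? ? _] /andP[? ?] /andP[? ?]]]].
  split; apply/andP; split; lra.
have dh := hd A B AB0.1 AB0.2.
(* [S] times v bounds the distance from the limit point to any point of the rectangle of scale v,
   and it is positive even for a degenerate rectangle. The tolerance e / (2 S^2) turns the affine
   estimate into e v^2 (l + m) / S, which is at most e v^2. *)
pose S := l + m + 1.
have S0 : 0 < S by rewrite /S; lra.
have eS : 0 < e / (2 * S ^+ 2) by rewrite divr_gt0// mulr_gt0// exprn_gt0.
have [d d0 hdd] := differentiable_nr dh eS.
have [k hk] : exists k, S * w k < d.
  have [k hk] := @invS_small R (d / S) (divr_gt0 d0 S0).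
  exists k; rewrite mulrC -ltr_pdivlMr// (le_lt_trans _ (hk k (leqnn _)))//.
  rewrite /w exprVn lef_pV2 ?posrE ?exprn_gt0 ?ltr0n//.
  by rewrite -natrX ler_nat; exact: ltn_expl.
have [a [b [[xa ax yb by_ hbad] aA bB]]] := AB k.
rewrite -/(w k) in aA bB.
have wk0 := w0 k.
move: (w k) wk0 hk aA bB xa ax yb by_ hbad => v v0 hk /andP[aA Aa] /andP[bB Bb] xa ax yb by_.
apply/negP; rewrite -leNgt.
have lv : 0 <= l * v by rewrite mulr_ge0// ltW.
have mv : 0 <= m * v by rewrite mulr_ge0// ltW.
pose dl := 'd h (A +i* B)%C (1 : C).
have dE (z : C) : 'd h (A +i* B)%C z = dl * z.
  by rewrite -[in LHS](mulr1 z) -[LHS]/('d h (A +i* B)%C (z *: (1 : C))) linearZ mulrC.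
have := @rect_int_affine_approx h a (a + l * v) b (b + m * v) dl
  (h (A +i* B)%C - dl * (A +i* B)%C) (e / (2 * S ^+ 2) * (S * v)).
move=> /(_ _ _ _ _)/le_trans; apply.
- by rewrite lerDl.
- by rewrite lerDl.
- move=> x y /andP[ax' xa'] /andP[b_y yb']; apply: hcont.
    by rewrite (le_trans xa ax') (le_trans xa' ax).
  by rewrite (le_trans yb b_y) (le_trans yb' by_).
- move=> x y /andP[ax' xa'] /andP[b_y yb'].
  have dist : nr ((A +i* B)%C - (x +i* y)%C : C) <= S * v.
    rewrite (le_trans (nr_le_ReIm _))//=.
    have : `|A - x| <= l * v.
      by rewrite ler_distl lerBlDr (le_trans xa') ?lerD2r// (le_trans Aa)// lerD2r.
    have : `|B - y| <= m * v.
      by rewrite ler_distl lerBlDr (le_trans yb') ?lerD2r// (le_trans Bb)// lerD2r.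
    rewrite /S; nra.
  have := hdd (x +i* y)%C (le_lt_trans dist hk).
  rewrite dE mulrBr => H.
  rewrite (_ : h (x +i* y)%C - _ = h (x +i* y)%C - h (A +i* B)%C -
    (dl * (x +i* y)%C - dl * (A +i* B)%C)); last by ring.
  by rewrite (le_trans H)// ler_wpM2l ?(ltW eS)// nr_distC.
rewrite (_ : a + l * v - a + _ = (l + m) * v); last by ring.
have SE : S = l + m + 1 by [].
clear eS hdd hk dl dE; clearbody S.
rewrite (_ : 2 * _ * _ = e * v ^+ 2 * ((l + m) / S)); last first.
  by field; rewrite lt0r_neq0.
rewrite ler_piMr ?mulr_ge0 ?exprn_ge0 ?(ltW e0) ?(ltW v0)//.
by rewrite ler_pdivrMr// mul1r SE; lra.
Qed.

End Goursat.

(** * Cauchy's estimate at the centre of the disc *)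

Section CauchyEstimate.
Context {R : realType}.
Local Notation C := R[i].
Implicit Types (f g h : C -> C).

Lemma rect_int_norm_le h (r e : R) : 0 < r ->
  (forall x y, `|x| <= r -> `|y| <= r -> (`|x| = r) \/ (`|y| = r) ->
     {for (x +i* y)%C, continuous h} /\ nr (h (x +i* y)%C) <= e) ->
  `|rect_int h (- r) r (- r) r| <= 8 * r * e.
Proof.
move=> r0 hb.
have rr : `|r| = r by rewrite gtr0_norm.
have nrr : - r <= r by rewrite ge0_cp// ltW.
have bd x : - r <= x <= r -> `|x| <= r by rewrite ler_norml.
have H y : `|y| = r -> `|itv_int (- r) r (fun x => complex.Im (h (x +i* y)%C))| <= e * (r - - r).
  move=> yr; have yr' : `|y| <= r by rewrite yr.
  apply: itv_int_norm_le; [exact: nrr| |].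
    by apply: cont_hline_within => x /bd xr; have [] := hb x y xr yr' (or_intror yr).
  move=> x /bd xr; rewrite (le_trans (Im_le_nr _))//.
  by have [] := hb x y xr yr' (or_intror yr).
have V x : `|x| = r -> `|itv_int (- r) r (fun y => complex.Re (h (x +i* y)%C))| <= e * (r - - r).
  move=> xr; have xr' : `|x| <= r by rewrite xr.
  apply: itv_int_norm_le; [exact: nrr| |].
    by apply: cont_vline_within => y /bd yr; have [] := hb x y xr' yr (or_introl xr).
  move=> y /bd yr; rewrite (le_trans (Re_le_nr _))//.
  by have [] := hb x y xr' yr (or_introl xr).
have := H r rr; have := V r rr.
have := H (- r); rewrite normrN => /(_ rr).
have := V (- r); rewrite normrN => /(_ rr).
rewrite /rect_int !ler_norml => /andP[? ?] /andP[? ?] /andP[? ?] /andP[? ?].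
by apply/andP; split; lra.
Qed.

Lemma rect_intB g h (r : R) : 0 < r ->
  (forall x y, `|x| <= r -> `|y| <= r -> (`|x| = r) \/ (`|y| = r) ->
     {for (x +i* y)%C, continuous g} /\ {for (x +i* y)%C, continuous h}) ->
  rect_int (fun z => g z - h z) (- r) r (- r) r =
  rect_int g (- r) r (- r) r - rect_int h (- r) r (- r) r.
Proof.
move=> r0 hb.
have rr : `|r| = r by rewrite gtr0_norm.
have nrr : `|- r| = r by rewrite normrN.
have bd x : - r <= x <= r -> `|x| <= r by rewrite ler_norml.
have H y : `|y| = r -> itv_int (- r) r (fun x => complex.Im (g (x +i* y)%C - h (x +i* y)%C)) =
    itv_int (- r) r (fun x => complex.Im (g (x +i* y)%C)) -
    itv_int (- r) r (fun x => complex.Im (h (x +i* y)%C)).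
  move=> yr; have yr' : `|y| <= r by rewrite yr.
  have -> : (fun x => complex.Im (g (x +i* y)%C - h (x +i* y)%C)) =
      (fun x => complex.Im (g (x +i* y)%C) - complex.Im (h (x +i* y)%C)).
    by apply/funext => x; exact: ImB.
  apply: itv_intB.
    by apply: cont_hline_within => x /bd xr; exact: (hb x y xr yr' (or_intror yr)).1.
  by apply: cont_hline_within => x /bd xr; exact: (hb x y xr yr' (or_intror yr)).2.
have V x : `|x| = r -> itv_int (- r) r (fun y => complex.Re (g (x +i* y)%C - h (x +i* y)%C)) =
    itv_int (- r) r (fun y => complex.Re (g (x +i* y)%C)) -
    itv_int (- r) r (fun y => complex.Re (h (x +i* y)%C)).
  move=> xr; have xr' : `|x| <= r by rewrite xr.
  have -> : (fun y => complex.Re (g (x +i* y)%C - h (x +i* y)%C)) =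
      (fun y => complex.Re (g (x +i* y)%C) - complex.Re (h (x +i* y)%C)).
    by apply/funext => y; exact: ReB.
  apply: itv_intB.
    by apply: cont_vline_within => y /bd yr; exact: (hb x y xr' yr (or_introl xr)).1.
  by apply: cont_vline_within => y /bd yr; exact: (hb x y xr' yr (or_introl xr)).2.
by rewrite /rect_int !H// !V//; ring.
Qed.

(** The lines x = -d and x = d cut off two side strips, and y = -d and y = d cut the middle strip
    into three. All pieces but the central square avoid 0, and Goursat's theorem kills them. *)
Lemma rect_int_annulus h (d r : R) : 0 < d -> d <= r ->
  (forall x y, `|x| <= r -> `|y| <= r -> x != 0 \/ y != 0 ->
     differentiable h (x +i* y)%C) ->
  rect_int h (- r) r (- r) r = rect_int h (- d) d (- d) d.
Proof.
move=> d0 dr hd.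
have hd' x y : - r <= x <= r -> - r <= y <= r -> x != 0 \/ y != 0 ->
    differentiable h (x +i* y)%C.
  by rewrite -!ler_norml => xr yr; exact: hd.
have hc x y : - r <= x <= r -> - r <= y <= r -> x != 0 \/ y != 0 ->
    {for (x +i* y)%C, continuous h}.
  by move=> xr yr xy; apply: differentiable_continuous; exact: hd'.
have r0 : r != 0 by rewrite gt_eqF// (lt_le_trans d0).
have nrn0 : - r != 0 by rewrite oppr_eq0.
have d0' : d != 0 by rewrite gt_eqF.
have nd0 : - d != 0 by rewrite oppr_eq0.
have rr : - r <= - r <= r by rewrite lexx/=; lra.
have rr' : - r <= r <= r by rewrite lexx andbT; lra.
have dd : - r <= - d <= r by apply/andP; split; lra.
have dd' : - r <= d <= r by apply/andP; split; lra.
have sub a b x : - r <= a -> b <= r -> a <= x <= b -> - r <= x <= r.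
  by move=> ra br /andP[ax xb]; rewrite (le_trans ra)//= (le_trans xb).
have [rd dr'] := andP dd; have [rd' dr''] := andP dd'.
have hline y a b : - r <= y <= r -> y != 0 -> - r <= a -> b <= r -> cont_hline h a b y.
  by move=> yr y0 ra br x /(sub _ _ _ ra br) xr; apply: hc => //; right.
have vline x a b : - r <= x <= r -> x != 0 -> - r <= a -> b <= r -> cont_vline h a b x.
  by move=> xr x0 ra br y /(sub _ _ _ ra br) yr; apply: hc => //; left.
have gx a b c e : a <= b -> c <= e -> - r <= a -> b <= r -> - r <= c -> e <= r ->
    (b < 0 \/ 0 < a) -> rect_int h a b c e = 0.
  move=> ab ce ra br rc er h0; apply: goursat => // x y xx yy.
  apply: hd'; [exact: (sub a b)|exact: (sub c e)|left].
  move: xx => /andP[ax xb]; case: h0 => h0; first by rewrite lt_eqF// (le_lt_trans xb).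
  by rewrite gt_eqF// (lt_le_trans h0).
have gy a b c e : a <= b -> c <= e -> - r <= a -> b <= r -> - r <= c -> e <= r ->
    (e < 0 \/ 0 < c) -> rect_int h a b c e = 0.
  move=> ab ce ra br rc er h0; apply: goursat => // x y xx yy.
  apply: hd'; [exact: (sub a b)|exact: (sub c e)|right].
  move: yy => /andP[ax xb]; case: h0 => h0; first by rewrite lt_eqF// (le_lt_trans xb).
  by rewrite gt_eqF// (lt_le_trans h0).
have nd0r : - d < 0 by rewrite oppr_lt0.
have ndd : - d <= d by rewrite (le_trans (ltW nd0r))// ltW.
have nrr : - r <= r by rewrite (le_trans rd).
rewrite (@rect_int_cutx _ h _ _ _ _ (- d))//; [|exact: hline..].
rewrite (@rect_int_cutx _ h (- d) _ _ _ d)//; [|exact: hline..].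
rewrite (@rect_int_cuty _ h (- d) d _ _ (- d))//; [|exact: vline..].
rewrite (@rect_int_cuty _ h (- d) d (- d) _ d)//; [|exact: vline..].
rewrite (gx (- r) (- d))//; last by left.
rewrite (gx d r)//; last by right.
rewrite (gy (- d) d (- r) (- d))//; last by left.
rewrite (gy (- d) d d r)//; last by right.
by rewrite !add0r !addr0.
Qed.

Lemma differentiable_idC (z : C) : differentiable (fun x : C => x) z.
Proof. by have := @is_diff_id C C z => -[]. Qed.

Lemma differentiable_invC (z : C) : z != 0 -> differentiable (fun x : C => x^-1) z.
Proof. by move=> z0; apply: differentiableV => //; exact: differentiable_idC. Qed.

Lemma differentiable_mulC f g (z : C) : differentiable f z -> differentiable g z ->
  differentiable (fun x => f x * g x) z.
Proof. exact: differentiableM. Qed.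

Lemma differentiable_subC f g (z : C) : differentiable f z -> differentiable g z ->
  differentiable (fun x => f x - g x) z.
Proof. exact: differentiableB. Qed.

Lemma complex_neq0 (x y : R) : x != 0 \/ y != 0 -> (x +i* y)%C != 0 :> C.
Proof. by case=> h; rewrite eq_complex/= negb_and h ?orbT. Qed.

Lemma nr_square_ge (r x y : R) : (`|x| = r) \/ (`|y| = r) -> r <= nr ((x +i* y)%C : C).
Proof.
by case=> <-; [exact: (Re_le_nr (x +i* y)%C)|exact: (Im_le_nr (x +i* y)%C)].
Qed.

(** The exact value is 2 pi A. Each side contributes at least A, because r / (t^2 + r^2) is at least
    1 / (2 r) for |t| <= r and the side has length 2 r. *)
Lemma rect_int_inv_ge (A r : R) : 0 <= A -> 0 < r ->
  4 * A <= rect_int (fun z : C => A%:C%C / z) (- r) r (- r) r.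
Proof.
move=> A0 r0.
have hc x y : x != 0 \/ y != 0 -> {for (x +i* y)%C, continuous (fun z : C => A%:C%C / z)}.
  move=> /complex_neq0 xy; apply: differentiable_continuous; apply: differentiableM.
    exact: differentiable_cst.
  exact: differentiable_invC.
have rn0 : r != 0 by rewrite gt_eqF.
have nrn0 : - r != 0 by rewrite oppr_eq0.
have ReE x y : complex.Re (A%:C%C / (x +i* y)%C) = A * x / (x ^+ 2 + y ^+ 2).
  by rewrite /= mul0r subr0 mulrA.
have ImE x y : complex.Im (A%:C%C / (x +i* y)%C) = - (A * y / (x ^+ 2 + y ^+ 2)).
  by rewrite /= mul0r addr0 mulrN mulrA.
have key t s : `|t| <= r -> s = r -> A / (2 * r) <= A * s / (t ^+ 2 + s ^+ 2).
  move=> tr ->.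
  have tr2 : t ^+ 2 <= r ^+ 2 by rewrite -real_normK ?num_real// lerXn2r// ?nnegrE// ltW.
  have t2 : 0 <= t ^+ 2 by exact: sqr_ge0.
  have r2 : 0 < r ^+ 2 by rewrite exprn_gt0.
  rewrite ler_pdivlMr; last by lra.
  rewrite (_ : A / (2 * r) * _ = A * r * ((t ^+ 2 + r ^+ 2) / (2 * r ^+ 2))); last by field.
  rewrite ler_piMr ?mulr_ge0 ?(ltW r0)// ler_pdivrMr; lra.
have AE : A = A / (2 * r) * (r - - r) by field.
have bd x : - r <= x <= r -> `|x| <= r by rewrite ler_norml.
have c1 y : y != 0 -> {within `[- r, r], continuous (fun x => complex.Im (A%:C%C / (x +i* y)%C))}.
  move=> y0; apply: (@cont_hline_within _ (fun z => A%:C%C / z)) => x _.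
  by apply: hc; right.
have c2 x : x != 0 -> {within `[- r, r], continuous (fun y => complex.Re (A%:C%C / (x +i* y)%C))}.
  move=> x0; apply: (@cont_vline_within _ (fun z => A%:C%C / z)) => y _.
  by apply: hc; left.
have nrr : - r <= r by lra.
have I1 : A <= itv_int (- r) r (fun x => complex.Im (A%:C%C / (x +i* (- r))%C)).
  rewrite {1}AE; apply: itv_int_ge; [by []|exact: c1|] => x /bd xr.
  by rewrite ImE mulrN mulNr opprK sqrrN; exact: key.
have I2 : itv_int (- r) r (fun x => complex.Im (A%:C%C / (x +i* r)%C)) <= - A.
  rewrite {2}AE -mulNr; apply: itv_int_le_cst; [by []|exact: c1|] => x /bd xr.
  by rewrite ImE lerN2; exact: key.
have I3 : A <= itv_int (- r) r (fun y => complex.Re (A%:C%C / (r +i* y)%C)).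
  rewrite {1}AE; apply: itv_int_ge; [by []|exact: c2|] => y /bd yr.
  by rewrite ReE (addrC (r ^+ 2)); exact: key.
have I4 : itv_int (- r) r (fun y => complex.Re (A%:C%C / ((- r) +i* y)%C)) <= - A.
  rewrite {2}AE -mulNr; apply: itv_int_le_cst; [by []|exact: c2|] => y /bd yr.
  by rewrite ReE mulrN mulNr lerN2 sqrrN (addrC (r ^+ 2)); exact: key.
rewrite /rect_int; lra.
Qed.

Lemma diffC_mul f z w : differentiable f z -> 'd f z w = 'd f z (1 : C) * w.
Proof.
move=> df; rewrite -[in LHS](mulr1 w).
by rewrite -[LHS]/('d f z (w *: (1 : C))) linearZ mulrC.
Qed.

(* Goursat's theorem kills the integral of (f z - f 0) / z^2 - f'(0) / z around
   0, after a rotation making f'(0) a nonnegative real. The integral of 1 / z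
   over a square is only bounded below, whence 16 in place of 1. *)
Lemma cauchy_estimate f (M : R) :
  (forall z, nr z < 1 -> differentiable f z /\ nr (f z) <= M) ->
  nr ('d f 0 (1 : C)) <= 16 * M.
Proof.
move=> hf.
have M0 : 0 <= M.
  by apply: le_trans (nr_ge0 (f 0)) _; apply: (hf 0 _).2; rewrite nr0.
have df0 : differentiable f 0 by apply: (hf 0 _).1; rewrite nr0.
set p := 'd f 0 (1 : C); set A := nr p.
have [p0|p0] := eqVneq p 0; first by rewrite /A p0 nr0 mulr_ge0.
have A0 : 0 < A by rewrite nr_gt0.
have [c [nc cp]] : exists c : C, nr c = 1 /\ c * p = A%:C%C.
  exists (A%:C%C / p); rewrite divfK// nrM nr_real nrV gtr0_norm// divff//.
  by rewrite gt_eqF.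
pose q (z : C) := c * (f z - f 0) * z^-1 * z^-1.
pose s (z : C) := A%:C%C / z.
pose g z := q z - s z.
have gE z : z != 0 -> g z = c * (f z - f 0 - p * z) * z^-1 * z^-1.
  by move=> z0; rewrite /g /q /s -cp; field.
(* The square of half-side 1/4 lies in the unit disc by |z| <= |x| + |y|. The final comparison reads
   4 A <= 8 r (2 M / r^2) = 64 M, which gives 16 M. *)
pose r : R := 1 / 4.
have r0 : 0 < r by rewrite /r; lra.
have in_disk x y : `|x| <= r -> `|y| <= r -> nr ((x +i* y)%C : C) < 1.
  move=> xr yr; rewrite (le_lt_trans (nr_le_ReIm _))//=.
  by move: xr yr; rewrite /r; lra.
have dq z : nr z < 1 -> z != 0 -> differentiable q z.
  move=> z1 z0; have dfz := (hf z z1).1.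
  have di := differentiable_invC z0.
  apply: (@differentiable_mulC (fun x => c * (f x - f 0) * x^-1) (fun x => x^-1) z _ di).
  apply: (@differentiable_mulC (fun x => c * (f x - f 0)) (fun x => x^-1) z _ di).
  apply: (@differentiable_mulC (fun=> c) (fun x => f x - f 0) z (differentiable_cst _ _)).
  exact: (@differentiable_subC f (fun=> f 0) z dfz (differentiable_cst _ _)).
have ds z : z != 0 -> differentiable s z.
  move=> z0.
  exact: (@differentiable_mulC (fun=> A%:C%C) (fun x => x^-1) z
    (differentiable_cst _ _) (differentiable_invC z0)).
have dg z : nr z < 1 -> z != 0 -> differentiable g z.
  by move=> z1 z0; exact: (@differentiable_subC q s z (dq z z1 z0) (ds z z0)).
have bneq0 (x y d : R) : 0 < d -> (`|x| = d) \/ (`|y| = d) -> x != 0 \/ y != 0.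
  by move=> d0; case=> h; [left|right]; rewrite -normr_gt0 h.
(* The numerator in [gE] is o(|z|), so g is o(1 / |z|) at 0. Its integral over a square of half-side
   t, which does not depend on t, is therefore at most 8 t (e / 8 / t) = e. *)
have g0 : rect_int g (- r) r (- r) r = 0.
  apply/eqP; rewrite -normr_eq0 eq_le normr_ge0 andbT.
  apply/ler_addgt0Pr => e e0; rewrite add0r.
  have e8 : 0 < e / 8 by lra.
  have [d d0 hd] := differentiable_nr df0 e8.
  pose t := Num.min r (d / 3).
  have t0 : 0 < t by rewrite lt_min r0/=; lra.
  have tr : t <= r by rewrite ge_min lexx.
  have td : t <= d / 3 by rewrite ge_min lexx orbT.
  rewrite (rect_int_annulus t0 tr); last first.
    by move=> x y xr yr xy; apply: dg; [exact: in_disk|exact: complex_neq0].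
  rewrite (_ : e = 8 * t * (e / 8 / t)); last by field; rewrite gt_eqF.
  apply: (rect_int_norm_le t0) => x y xt yt xy.
  have z0 := complex_neq0 (bneq0 x y t t0 xy).
  have z1 : nr ((x +i* y)%C : C) < 1 by apply: in_disk; lra.
  split; first by apply: differentiable_continuous; exact: dg.
  have zt := nr_square_ge xy.
  set z := (x +i* y)%C in z0 z1 zt *.
  have zd : nr (0 - z : C) < d.
    rewrite sub0r nrN (le_lt_trans (nr_le_ReIm _))//= .
    by move: xt yt td; lra.
  have := hd z zd; rewrite subr0 diffC_mul// -/p => hz.
  have nz0 : 0 < nr z by rewrite nr_gt0.
  rewrite gE// !nrM nc mul1r !nrV.
  rewrite ler_pdivrMr// ler_pdivrMr//.
  rewrite (le_trans hz)// ler_wpM2r// ?(ltW nz0)//.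
  rewrite mulrAC ler_pdivlMr// ler_wpM2l// ltW//.
have sq : rect_int s (- r) r (- r) r = rect_int q (- r) r (- r) r.
  apply/eqP; rewrite eq_sym -subr_eq0 -rect_intB//; first by apply/eqP; exact: g0.
  move=> x y xr yr xy; have z0 := complex_neq0 (bneq0 x y r r0 xy).
  by split; apply: differentiable_continuous; [apply: dq => //; exact: in_disk|exact: ds].
have := rect_int_inv_ge (ltW A0) r0; rewrite -/s sq => hA.
have : `|rect_int q (- r) r (- r) r| <= 8 * r * (2 * M / r / r).
  apply: (rect_int_norm_le r0) => x y xr yr xy.
  have z0 := complex_neq0 (bneq0 x y r r0 xy).
  have z1 := in_disk x y xr yr.
  split; first by apply: differentiable_continuous; exact: dq.
  have zr := nr_square_ge xy.
  have nz0 : 0 < nr ((x +i* y)%C : C) by rewrite nr_gt0.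
  rewrite /q !nrM nc mul1r !nrV.
  have fb : nr (f (x +i* y)%C - f 0) <= 2 * M.
    rewrite (le_trans (nrB _ _))//.
    have := (hf _ z1).2; have := (hf 0 _).2; rewrite nr0 => /(_ ltr01); lra.
  have iz : (nr ((x +i* y)%C : C))^-1 <= r^-1 by rewrite lef_pV2.
  have iz0 : 0 <= (nr ((x +i* y)%C : C))^-1 by rewrite invr_ge0 ltW.
  rewrite ler_pM ?mulr_ge0 ?nr_ge0//.
  by rewrite ler_pM ?nr_ge0.
have -> : 8 * r * (2 * M / r / r) = 64 * M by rewrite /r; field.
rewrite ler_norml => /andP[_]; lra.
Qed.

End CauchyEstimate.

(** * The Kobayashi metric *)

Section KobayashiMetric.
Context {R : realType} {n : nat}.
Local Notation C := R[i].
Local Notation Cn := 'rV[C]_n.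
Implicit Types (Omega U : set Cn) (z v : Cn).

Lemma unit_diskE (z : C) : unit_disk R z = (nr z < 1) :> Prop.
Proof. by rewrite /unit_disk/= nrE -(ltcR (nr z) 1). Qed.

Lemma derive1_nrP (V : normedModType C) (f : C -> V) (x : C) (p : V) :
  (forall e : R, 0 < e -> exists2 d : R, 0 < d & forall y, nr (x - y) < d ->
     nr (f y - f x - (y - x) *: p) <= e * nr (y - x)) ->
  differentiable f x /\ derive1 f x = p.
Proof.
move=> h.
(* Derivability in direction 1 and [derive1] write the difference quotient differently, with
   [t *: 1] or [t]; the auxiliary function g covers both. *)
have key (g : C -> V) : (forall t : C, g t = t^-1 *: (f (t + x) - f x)) -> g @ 0^' --> p.
  move=> gE; apply/cvg_nrP => e e0; have e20 : 0 < e / 2 by rewrite divr_gt0.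
  have [d d0 hd] := h _ e20.
  have nb : nbhs (0 : C) [set t | nr (0 - t) < d] by apply/nbhs_nrP; exists d.
  apply: filterS nb => t /= td t0; rewrite gE.
  have nt : 0 < nr t by rewrite nr_gt0.
  rewrite nr_distC -[p](scale1r p) -(mulVf t0) -scalerA -scalerBr nrZ nrV.
  have := hd (t + x); rewrite opprD addrCA subrr addr0 addrK -sub0r => /(_ td) hh.
  rewrite mulrC ltr_pdivrMr// (le_lt_trans hh)// ltr_pM2r//.
  by rewrite ltr_pdivrMr// ltr_pMr// ltr1n.
have d1 : derivable f x 1.
  apply/cvg_ex; exists p; apply: key => t /=.
  by rewrite /shift/= -[t *: 1]/(t * 1) mulr1.
split; first exact/derivable1_diffP.
by apply: cvg_lim; [exact: norm_hausdorff|exact: key].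
Qed.

Lemma differentiable_derive1_nr (V : normedModType C) (f : C -> V) (x : C) :
  differentiable f x -> forall e : R, 0 < e -> exists2 d : R, 0 < d &
    forall y, nr (x - y) < d ->
     nr (f y - f x - (y - x) *: derive1 f x) <= e * nr (y - x).
Proof.
move=> df e e0; have [d d0 hd] := differentiable_nr df e0.
exists d => // y xy; rewrite derive1E'// -linearZ.
by rewrite -[(y - x) *: _]/((y - x) * 1) mulr1; exact: hd.
Qed.

Lemma is_derive_affine (z w : Cn) (x : C) :
  differentiable (fun t : C => z + t *: w) x /\
  derive1 (fun t : C => z + t *: w) x = w.
Proof.
apply: derive1_nrP => e e0; exists 1 => // y _.
rewrite scalerBl opprD addrACA subrr add0r subrr nr0.
by rewrite mulr_ge0 ?nr_ge0// ltW.
Qed.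

Lemma is_derive_scale (V : normedModType C) (f : C -> V) (r : R) (x : C) : 0 < r ->
  differentiable f (r%:C%C * x) ->
  differentiable (fun t : C => f (r%:C%C * t)) x /\
  derive1 (fun t : C => f (r%:C%C * t)) x = r%:C%C *: derive1 f (r%:C%C * x).
Proof.
move=> r0 df; apply: derive1_nrP => e e0.
have er0 : 0 < e / r by rewrite divr_gt0.
have [d d0 hd] := differentiable_derive1_nr df er0.
exists (d / r); first by rewrite divr_gt0.
move=> y xy; have := hd (r%:C%C * y).
rewrite -!mulrBr !nrM nr_real gtr0_norm// => H.
rewrite scalerA (mulrC (y - x)) (le_trans (H _))//.
  by rewrite mulrC -ltr_pdivlMr.
by rewrite mulrA divfK// gt_eqF.
Qed.

Lemma is_derive_add (V : normedModType C) (f g : C -> V) (x : C) :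
  differentiable f x -> differentiable g x ->
  differentiable (fun t => f t + g t) x /\
  derive1 (fun t => f t + g t) x = derive1 f x + derive1 g x.
Proof.
move=> df dg; apply: derive1_nrP => e e0.
have e20 : 0 < e / 2 by rewrite divr_gt0.
have [d1 d10 h1] := differentiable_derive1_nr df e20.
have [d2 d20 h2] := differentiable_derive1_nr dg e20.
exists (Num.min d1 d2); first by rewrite lt_min d10.
move=> y; rewrite lt_min => /andP[/h1 {}h1 /h2 {}h2].
rewrite (splitr e) mulrDl (le_trans _ (lerD h1 h2))// (le_trans _ (nrD _ _))//.
by rewrite scalerDr !opprD (addrACA (f y)) (addrACA (f y - f x)).
Qed.

Definition kdisc Omega z v (xi : C) := exists phi : C -> Cn,
  [/\ holomorphic_map (unit_disk R) Omega phi, phi 0 = z & xi *: derive1 phi 0 = v].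

Lemma kmetricE Omega z v :
  kobayashi_metric Omega z v = inf [set nr xi | xi in kdisc Omega z v].
Proof. by []. Qed.

Lemma kmetric_ge0 Omega z v : 0 <= kobayashi_metric Omega z v.
Proof.
rewrite kmetricE; set S := [set _ | _ in _].
have [->|/set0P S0] := eqVneq S set0; first by rewrite inf0.
by apply: lb_le_inf => // _ [xi _ <-]; exact: nr_ge0.
Qed.

Lemma kmetric_le Omega z v xi : kdisc Omega z v xi ->
  kobayashi_metric Omega z v <= nr xi.
Proof.
move=> h; rewrite kmetricE; apply: ge_inf; last by exists xi.
by exists 0 => _ [x _ <-]; exact: nr_ge0.
Qed.

(** Affine discs make the set under the infimum nonempty, so that the infimum is approached by
    genuine discs instead of being the default value 0 of [inf] on the empty set. The denominator
    [nr v + 1] allows v = 0. *)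
Lemma kdisc_affine Omega z v (e : R) : 0 < e ->
  (forall y, nr (z - y) < e -> Omega y) ->
  exists a : R, kdisc Omega z v a%:C%C.
Proof.
move=> e0 he; pose a := e / (nr v + 1).
have v1 : 0 < nr v + 1 by rewrite ltr_wpDl// nr_ge0.
have a0 : 0 < a by rewrite divr_gt0.
exists a^-1, (fun t : C => z + t *: (a%:C%C *: v)); split.
- move=> t; rewrite unit_diskE => t1; split; last by have [] := is_derive_affine z (a%:C%C *: v) t.
  apply: he; rewrite opprD addNKr nrN nrZ nrZr gtr0_norm//.
  rewrite (@le_lt_trans _ _ (1 * (a * nr v)))//.
    by rewrite ler_wpM2r ?(ltW t1)// mulr_ge0 ?nr_ge0// ltW.
  rewrite mul1r /a mulrAC ltr_pdivrMr// ltr_pM2l//.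
  by rewrite ltrDl.
- by rewrite scale0r addr0.
- have [_ ->] := is_derive_affine z (a%:C%C *: v) 0.
  by rewrite scalerA -rmorphM /= mulVf ?scale1r// gt_eqF.
Qed.

Lemma kmetric_lt Omega z v (c : R) : open Omega -> Omega z ->
  kobayashi_metric Omega z v < c -> exists2 xi, kdisc Omega z v xi & nr xi < c.
Proof.
move=> /open_nrP oO Oz; have [e e0 he] := oO z Oz.
have [a ka] := @kdisc_affine Omega z v e e0 he.
move=> h; have c0 : 0 < c - kobayashi_metric Omega z v by rewrite subr_gt0.
rewrite kmetricE in h c0 *.
have hi : has_inf [set nr xi | xi in kdisc Omega z v].
  split; first by exists (nr (a%:C%C : C)), a%:C%C.
  by exists 0 => _ [x _ <-]; exact: nr_ge0.
have [_ [xi kxi <-]] := inf_adherent c0 hi.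
by rewrite addrC subrK => hx; exists xi.
Qed.

Lemma kmetricZ_lt Omega z v (s : C) (c : R) : open Omega -> Omega z -> s != 0 ->
  kobayashi_metric Omega z v < c -> kobayashi_metric Omega z (s *: v) < nr s * c.
Proof.
move=> oO Oz s0 /(kmetric_lt oO Oz)[xi [phi [h1 h2 h3]] xc].
apply: (@le_lt_trans _ _ (nr (s * xi))); last by rewrite nrM ltr_pM2l// nr_gt0.
by apply: kmetric_le; exists phi; split=> //; rewrite -scalerA h3.
Qed.

Lemma kmetricN Omega z v : open Omega -> Omega z ->
  kobayashi_metric Omega z (- v) <= kobayashi_metric Omega z v.
Proof.
move=> oO Oz; apply/ler_addgt0Pr => e e0; apply: ltW.
rewrite -scaleN1r -[ltRHS]mul1r.
have <- : nr (-1 : C) = 1 by rewrite nrN /nr normr1.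
by apply: kmetricZ_lt; rewrite ?oppr_eq0 ?oner_eq0// ltrDl.
Qed.

Lemma holomorphic_map_derive (V : normedModType C) (W : normedModType C)
    (A : set V) (B : set W) (D : set C) (F : V -> W) (phi : C -> V) (x : C) :
  holomorphic_map A B F -> holomorphic_map D A phi -> D x ->
  differentiable (F \o phi) x /\ derive1 (F \o phi) x = 'd F (phi x) (derive1 phi x).
Proof.
move=> hF hphi Dx; have [Aphi dphi] := hphi x Dx.
have [_ dF] := hF _ Aphi.
have dc : differentiable (F \o phi) x by exact: differentiable_comp.
by split=> //; rewrite !derive1E'// diff_comp.
Qed.

Lemma kmetric_contract Omega F z v : open Omega -> holomorphic_map Omega Omega F ->
  Omega z -> kobayashi_metric Omega (F z) ('d F z v) <= kobayashi_metric Omega z v.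
Proof.
move=> oO hF Oz; apply/ler_addgt0Pr => e e0; apply: ltW.
have : kobayashi_metric Omega z v < kobayashi_metric Omega z v + e by rewrite ltrDl.
move=> /(kmetric_lt oO Oz)[xi [phi [h1 h2 h3]] xc].
apply: le_lt_trans xc; apply: kmetric_le; exists (F \o phi).
have D0 : unit_disk R 0 by rewrite unit_diskE nr0.
split.
- move=> x Dx; have [Ox dx] := h1 x Dx.
  by split; [exact: (hF _ Ox).1|have [] := holomorphic_map_derive hF h1 Dx].
- by rewrite /= h2.
- have [_ ->] := holomorphic_map_derive hF h1 D0.
  by rewrite h2 -linearZ h3.
Qed.

Lemma differentiable_coord (x : Cn) (j : 'I_n) :
  differentiable (fun y : Cn => y 0 j) x /\
  forall h, 'd (fun y : Cn => y 0 j) x h = h 0 j.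
Proof.
pose f : Cn -> C := fun y => y 0 j.
have fl : linear f by move=> a u w; rewrite /f !mxE.
pose fL : {linear Cn -> C} := HB.pack f (GRing.isLinear.Build _ _ _ _ f fl).
have fc : continuous fL.
  move=> y; apply: (proj2 (@cvg_nrP _ _ _ _ (@nbhs_filter _ y) fL (fL y))) => e e0.
  apply/nbhs_nrP; exists e => // w yw; rewrite (le_lt_trans _ yw)//.
  have -> : fL y - fL w = (y - w) 0 j by rewrite !mxE.
  exact: nr_coord.
split; first exact: (@linear_differentiable _ _ _ fL x fc).
by move=> h; rewrite -[LHS]/('d fL x h) diff_lin.
Qed.

Lemma nr_rV_le (x : Cn) (e : R) : 0 <= e -> (forall i, nr (x 0 i) <= e) -> nr x <= e.
Proof.
move=> e0 h; apply/ler_addgt0Pr => d d0; apply/ltW/nr_rV_lt; first by rewrite ltr_wpDl.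
by move=> i; rewrite (le_lt_trans (h i))// ltrDl.
Qed.

Lemma disc_derive_bound (M : R) (phi : C -> Cn) :
  (forall z : C, nr z < 1 -> differentiable phi z /\ nr (phi z) <= M) ->
  nr (derive1 phi 0) <= 16 * M.
Proof.
move=> h; have z1 : nr (0 : C) < 1 by rewrite nr0.
have M0 : 0 <= M by apply: le_trans (nr_ge0 (phi 0)) (h 0 z1).2.
apply: nr_rV_le => [|j]; first by rewrite mulr_ge0.
rewrite derive1E'; last by have [] := h 0 z1.
pose cj : Cn -> C := fun y => y 0 j.
have dcj y : differentiable cj y /\ forall h, 'd cj y h = h 0 j := differentiable_coord y j.
have -> : ('d phi 0 1) 0 j = 'd (cj \o phi) 0 (1 : C).
  rewrite (@diff_comp _ _ _ _ phi cj 0 (h 0 z1).1 (dcj (phi 0)).1).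
  by rewrite /= (dcj _).2.
apply: cauchy_estimate => z z1'; have [dz bz] := h z z1'; split.
  by apply: differentiable_comp => //; exact: (dcj _).1.
exact: le_trans (nr_coord _ _) bz.
Qed.

Lemma kmetric_lower Omega (M : R) z v : open Omega -> (forall x, Omega x -> nr x <= M) ->
  Omega z -> nr v <= 16 * M * kobayashi_metric Omega z v.
Proof.
move=> oO OM Oz.
have M0 : 0 <= M by apply: le_trans (nr_ge0 z) (OM z Oz).
have h c : kobayashi_metric Omega z v < c -> nr v <= 16 * M * c.
  move=> /(kmetric_lt oO Oz)[xi [phi [h1 h2 h3]] xc].
  rewrite -h3 nrZ mulrC ler_pM ?nr_ge0 ?(ltW xc)//.
  apply: disc_derive_bound => x; rewrite -unit_diskE => /h1[Ox dx].
  by split=> //; exact: OM.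
apply/ler_addgt0Pr => e e0.
have M1 : 0 < 16 * M + 1 by rewrite ltr_wpDl// mulr_ge0.
have := h (kobayashi_metric Omega z v + e / (16 * M + 1)).
rewrite ltrDl divr_gt0// => /(_ isT)/le_trans; apply.
rewrite mulrDr lerD2l mulrA ler_pdivrMr// mulrC ler_pM2l//.
by rewrite lerDl.
Qed.

(* The disc phi is first shrunk, so that its image is relatively compact in
   Omega, and then perturbed by an affine map. *)
Lemma kmetric_usc Omega z v (c : R) : open Omega -> Omega z ->
  kobayashi_metric Omega z v < c ->
  exists2 e : R, 0 < e & forall z' v', nr (z - z') < e -> nr (v - v') < e ->
    Omega z' /\ kobayashi_metric Omega z' v' < c.
Proof.
move=> oO Oz kc; have [xi [phi [h1 h2 h3]] xc] := kmetric_lt oO Oz kc.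
have c0 : 0 < c by exact: le_lt_trans (nr_ge0 _) xc.
have D0 : unit_disk R 0 by rewrite unit_diskE nr0.
have [psi [eta [xi' [eta0 psi0 psid xi'0 [xi'c hder]]]]] : exists psi : C -> Cn,
    exists eta : R, exists xi' : C,
    [/\ 0 < eta, psi 0 = z, forall t, nr t < 1 -> differentiable psi t /\
          forall y, nr (psi t - y) < eta -> Omega y,
        xi' != 0 & nr xi' < c /\ xi' *: derive1 psi 0 = v].
  (* If xi = 0 then v = 0. The constant disc is taken with multiplier c / 2, because the
     perturbation below divides by the multiplier. *)
  have [xi0|xi0] := eqVneq xi 0.
    have /open_nrP/(_ z Oz)[e e0 he] := oO.
    exists (fun=> z), e, (c / 2)%:C%C.
    have c20 : 0 < c / 2 by rewrite divr_gt0.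
    have c2n : nr ((c / 2)%:C%C : C) = c / 2 by rewrite nr_real gtr0_norm.
    split; [exact: e0|by []| |by rewrite -nr_gt0 c2n|].
      by move=> t _; split; [exact: differentiable_cst|exact: he].
    split; first by rewrite c2n ltr_pdivrMr// ltr_pMr// ltr1n.
    have -> : (fun=> z) = (fun t : C => z + t *: (0 : Cn)).
      by apply/funext => t; rewrite scaler0 addr0.
    by have [_ ->] := is_derive_affine z 0 0; rewrite scaler0 -h3 xi0 scale0r.
  have nx : 0 < nr xi by rewrite nr_gt0.
  (* Shrinking the disc by r replaces xi by xi / r, still of modulus less than c because r lies
     strictly between [nr xi / c] and 1. *)
  pose r := (nr xi / c + 1) / 2.
  have q1 : nr xi / c < 1 by rewrite ltr_pdivrMr// mul1r.
  have q0 : 0 < nr xi / c by rewrite divr_gt0.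
  have r0 : 0 < r by rewrite divr_gt0// addr_gt0.
  have r1 : r < 1 by rewrite /r ltr_pdivrMr// mul1r -[ltRHS]/(1 + 1) ltrD2r.
  have rq : nr xi / c < r.
    by rewrite /r ltr_pdivlMr// mulr_natr mulr2n ltrD2l.
  have rC0 : (r%:C%C : C) != 0 by rewrite -nr_gt0 nr_real gtr0_norm.
  have cK : compact (phi @` [set t | nr t <= r]).
    apply: continuous_compact; last exact: compact_disk.
    apply: continuous_in_subspaceT => t; rewrite inE/= => tr.
    have [|_ dt] := h1 t; first by rewrite unit_diskE (le_lt_trans tr).
    exact: differentiable_continuous.
  have KO : phi @` [set t | nr t <= r] `<=` Omega.
    by move=> _ [t /= tr <-]; apply: (h1 t _).1; rewrite unit_diskE (le_lt_trans tr).
  have [eta eta0 heta] := compact_open_margin cK oO KO.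
  have mD t : nr t < 1 -> nr (r%:C%C * t) <= r.
    by move=> t1; rewrite nrM nr_real gtr0_norm// ler_piMr// ltW.
  have uD t : nr t < 1 -> unit_disk R (r%:C%C * t).
    by move=> t1; rewrite unit_diskE (le_lt_trans (mD t t1)).
  have dD t (t1 : nr t < 1) := is_derive_scale r0 (h1 _ (uD t t1)).2.
  have z1 : nr (0 : C) < 1 by rewrite nr0.
  exists (fun t => phi (r%:C%C * t)), eta, (xi / r%:C%C); split.
  - exact: eta0.
  - by rewrite mulr0.
  - move=> t t1; split; first exact: (dD t t1).1.
    by move=> y hy; apply: (heta (phi (r%:C%C * t))) => //; exists (r%:C%C * t) => //; exact: mD.
  - by rewrite mulf_neq0// invr_eq0.
  - split; first by rewrite nrM nrV nr_real gtr0_norm// ltr_pdivrMr// mulrC -ltr_pdivrMr.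
    by rewrite (dD 0 z1).2 mulr0 scalerA divfK.
pose k := nr xi'.
have k0 : 0 < k by rewrite nr_gt0.
(* One half of the margin eta pays for the shift of the centre z' - z, the other for the linear term
   w = (v' - v) / xi' that corrects the derivative. *)
pose e := Num.min (eta / 2) (eta * k / 2).
have e0 : 0 < e by rewrite lt_min !divr_gt0// mulr_gt0.
exists e => // z' v' zz' vv'.
have zeta : nr (z - z') < eta / 2 by rewrite (lt_le_trans zz')// ge_min lexx.
have veta : nr (v - v') < eta * k / 2 by rewrite (lt_le_trans vv')// ge_min lexx orbT.
pose w := xi'^-1 *: (v' - v).
have wE : nr w < eta / 2.
  by rewrite nrZ nrV nr_distC mulrC ltr_pdivrMr// mulrAC.
split.
  have t1 : nr (0 : C) < 1 by rewrite nr0.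
  apply: (psid 0 t1).2; rewrite psi0 (lt_trans zeta)//.
  by rewrite ltr_pdivrMr// ltr_pMr// ltr1n.
apply: le_lt_trans xi'c; apply: kmetric_le.
exists (fun t => psi t + ((z' - z) + t *: w)).
have dpsi t : nr t < 1 -> differentiable psi t by move=> /psid[].
have daff t := is_derive_affine (z' - z) w t.
have dsum t (t1 : nr t < 1) := is_derive_add (dpsi t t1) (daff t).1.
have z1 : nr (0 : C) < 1 by rewrite nr0.
split.
- move=> t; rewrite unit_diskE => t1; have [dt ht] := psid t t1.
  split; last exact: (dsum t t1).1.
  apply: ht; rewrite opprD addNKr nrN.
  apply: (le_lt_trans (nrD _ _)); rewrite (splitr eta); apply: ltrD.
    by rewrite nr_distC.
  rewrite nrZ (le_lt_trans _ wE)// ler_piMl ?nr_ge0//; exact: ltW.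
- by rewrite psi0 scale0r addr0 addrC subrK.
- rewrite (dsum 0 z1).2 (daff 0).2 scalerDr hder /w scalerA divff// scale1r.
  by rewrite addrC subrK.
Qed.

End KobayashiMetric.

(** * Polygonal paths and the distance they define *)

Lemma zmod_quot_split (V : zmodType) (A B r s t : V) :
  A - B - (s - r) = (r - t - B) - (s - t - A).
Proof.
rewrite (opprD (s - t)) opprK addrACA (addrC (- B)) [RHS]addrC opprB; congr (_ + _).
by rewrite opprB addrA subrK.
Qed.

Lemma zmod_convex (V : zmodType) (t r A B D : V) :
  t - (r + (A - B)) = t - r - (D - B) + (D - A).
Proof.
by rewrite opprD opprB addrA [in RHS]opprB -[RHS]addrA (addrA (B - D)) subrK.
Qed.

Section Polygons.
Context {R : realType} {n : nat}.
Local Notation C := R[i].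
Local Notation Cn := 'rV[C]_n.
Variable Omega : set Cn.
Hypothesis oOmega : open Omega.
Implicit Types (U : set Cn) (x y z v : Cn) (l : seq (R * Cn)) (t s : R).

(* The pair (tau, v) stands for a segment run in time tau with velocity v. *)
Fixpoint poly_end x l : Cn :=
  if l is (tau, v) :: l' then poly_end (x + tau%:C%C *: v) l' else x.

Fixpoint poly_len l : R := if l is (tau, v) :: l' then tau + poly_len l' else 0.

Fixpoint poly_at x l t : Cn :=
  if l is (tau, v) :: l' then
    if t <= tau then x + t%:C%C *: v else poly_at (x + tau%:C%C *: v) l' (t - tau)
  else x.

(** [U] confines the trace only: velocities are always measured in [Omega]. The same length bound
    thus applies to polygons kept in a smaller set, such as the complement of a compact set. *)
Fixpoint poly_ok U x l : Prop :=
  if l is (tau, v) :: l' then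
    [/\ 0 < tau,
        forall t, 0 <= t <= tau -> U (x + t%:C%C *: v) /\
          kobayashi_metric Omega (x + t%:C%C *: v) v <= 1 &
        poly_ok U (x + tau%:C%C *: v) l']
  else U x.

Definition reach U (L : R) x y :=
  exists l, [/\ poly_ok U x l, poly_end x l = y & poly_len l = L].

Lemma poly_len_ge0 U x l : poly_ok U x l -> 0 <= poly_len l.
Proof.
by elim: l x => //= -[tau v] l ih x [t0 _ /ih h]; rewrite addr_ge0// ltW.
Qed.

Lemma reach_ge0 U L x y : reach U L x y -> 0 <= L.
Proof. by move=> [l [/poly_len_ge0 h _ <-]]. Qed.

Lemma poly_ok_start U x l : poly_ok U x l -> U x.
Proof.
case: l => //= -[tau v] l [t0 h _].
have [|+ _] := h 0; first by rewrite lexx ltW.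
by rewrite scale0r addr0.
Qed.

Lemma poly_ok_end U x l : poly_ok U x l -> U (poly_end x l).
Proof. by elim: l x => //= -[tau v] l ih x [_ _ /ih]. Qed.

Lemma poly_at0 x l U : poly_ok U x l -> poly_at x l 0 = x.
Proof. by case: l => //= -[tau v] l [t0 _ _]; rewrite (ltW t0) scale0r addr0. Qed.

Lemma poly_at_len x l U : poly_ok U x l -> poly_at x l (poly_len l) = poly_end x l.
Proof.
elim: l x => //= -[tau v] l ih x [t0 _ okl].
case: ifPn => [h|_]; last by rewrite addrAC subrr add0r; exact: ih.
have l0 : poly_len l = 0.
  by apply/eqP; rewrite eq_le (poly_len_ge0 okl) andbT -(gerDl tau).
rewrite l0 addr0; case: l okl l0 {ih h} => //= -[s w] l [s0 _ okl] l0.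
exfalso; have := poly_len_ge0 okl; move: l0 s0; lra.
Qed.

Lemma poly_end_cat x l1 l2 : poly_end x (l1 ++ l2) = poly_end (poly_end x l1) l2.
Proof. by elim: l1 x => //= -[tau v] l ih x; rewrite ih. Qed.

Lemma poly_len_cat l1 l2 : poly_len (l1 ++ l2) = poly_len l1 + poly_len l2.
Proof. by elim: l1 => [|[tau v] l ih] /=; rewrite ?add0r// ih addrA. Qed.

Lemma poly_ok_cat U x l1 l2 : poly_ok U x l1 -> poly_ok U (poly_end x l1) l2 ->
  poly_ok U x (l1 ++ l2).
Proof. by elim: l1 x => //= -[tau v] l ih x [t0 h /ih h1] /h1. Qed.

Lemma reach_trans U L1 L2 x y z : reach U L1 x y -> reach U L2 y z ->
  reach U (L1 + L2) x z.
Proof.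
move=> [l1 [k1 e1 <-]] [l2 [k2 <- <-]]; exists (l1 ++ l2).
rewrite poly_end_cat poly_len_cat e1; split=> //.
by apply: poly_ok_cat => //; rewrite e1.
Qed.

Lemma reach_refl U x : U x -> reach U 0 x x.
Proof. by move=> Ux; exists [::]. Qed.

Lemma reach_segment U x v (tau : R) : 0 < tau ->
  (forall t, 0 <= t <= tau -> U (x + t%:C%C *: v) /\
          kobayashi_metric Omega (x + t%:C%C *: v) v <= 1) ->
  reach U tau x (x + tau%:C%C *: v).
Proof.
move=> t0 h; exists [:: (tau, v)]; split=> //=; last by rewrite addr0.
by split=> //; have [|] := h tau; rewrite ?lexx ?andbT ?(ltW t0).
Qed.

Lemma reach_sym U L x y : U `<=` Omega -> reach U L x y -> reach U L y x.
Proof.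
move=> UO [l [ok <- <-]] {y L}; elim: l x ok => [x Ux|[tau v] l ih x /= [t0 h ok]].
  exact: reach_refl.
rewrite addrC; apply: reach_trans (ih _ ok) _.
suff : reach U tau (x + tau%:C%C *: v) (x + tau%:C%C *: v + tau%:C%C *: (- v)).
  by rewrite scalerN addrK.
apply: reach_segment => // t /andP[t1 t2].
have E : x + tau%:C%C *: v + t%:C%C *: - v = x + (tau - t)%:C%C *: v.
  by rewrite scalerN -addrA -scalerBl rmorphB.
have [|Ux kx] := h (tau - t).
  by rewrite subr_ge0 t2 lerBlDr lerDl.
rewrite E; split=> //.
by rewrite (le_trans _ kx)// kmetricN//; exact: UO.
Qed.

Lemma poly_ok_sub U U' x l : U `<=` U' -> poly_ok U x l -> poly_ok U' x l.
Proof.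
move=> UU; elim: l x => [x /UU//|[tau v] l ih x /= [t0 h /ih okl]].
by split=> // t /h[/UU].
Qed.

Lemma poly_take U x l t : poly_ok U x l -> 0 <= t <= poly_len l ->
  exists l1, [/\ poly_ok U x l1, poly_end x l1 = poly_at x l t & poly_len l1 = t].
Proof.
elim: l x t => [x t Ux /= /andP[t0 t1]|[tau v] l ih x t /= [tau0 h okl] /andP[t0 t1]].
  by exists [::]; split=> //=; apply/eqP; rewrite eq_le t0 t1.
case: ifPn => [tt|]; last first.
  rewrite -ltNge => tt; have [|l1 [k1 e1 le1]] := ih _ (t - tau) okl.
    by rewrite subr_ge0 (ltW tt) lerBlDl.
  exists ((tau, v) :: l1); split=> //=.
  by rewrite le1 addrC subrK.
move: t0; rewrite le_eqVlt => /predU1P[<-|t0].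
  exists [::]; split=> //=; last by rewrite scale0r addr0.
  by have [|+ _] := h 0; [rewrite lexx ltW|rewrite scale0r addr0].
have [|l1] := @reach_segment U x v t t0; last by exists l1.
by move=> s /andP[s0 st]; apply: h; rewrite s0 (le_trans st).
Qed.

Lemma poly_drop U x l s : poly_ok U x l -> 0 <= s <= poly_len l ->
  exists l2, [/\ poly_ok U (poly_at x l s) l2, poly_end (poly_at x l s) l2 = poly_end x l,
    poly_len l2 = poly_len l - s &
    forall t, 0 <= t -> poly_at (poly_at x l s) l2 t = poly_at x l (s + t)].
Proof.
elim: l x s => [x s Ux /= /andP[s0 s1]|[tau v] l ih x s /= [tau0 h okl] /andP[s0 s1]].
  have -> : s = 0 by apply/eqP; rewrite eq_le s0 s1.
  by exists [::]; rewrite /= subr0.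
case: ifPn => [tt|]; last first.
  rewrite -ltNge => tt; have [|l2 [k1 e1 le1 at1]] := ih _ (s - tau) okl.
    by rewrite subr_ge0 (ltW tt) lerBlDl.
  exists l2; split=> //; first by rewrite le1; lra.
  move=> t t0; rewrite at1// leNgt (lt_le_trans tt) ?lerDl//=.
  by congr poly_at; rewrite addrAC.
move: tt; rewrite le_eqVlt => /predU1P[->|st].
  exists l; split=> //; first by rewrite addrAC subrr add0r.
  move=> t; rewrite le_eqVlt => /predU1P[<-|t0].
    by rewrite addr0 lexx (poly_at0 okl).
  by rewrite leNgt ltrDl t0/= addrAC subrr add0r.
have E t : x + s%:C%C *: v + t%:C%C *: v = x + (s + t)%:C%C *: v.
  by rewrite -addrA -scalerDl rmorphD.
have st0 : 0 < tau - s by rewrite subr_gt0.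
have Et : s + (tau - s) = tau by rewrite addrC subrK.
exists ((tau - s, v) :: l); split=> /=.
- split=> //; last by rewrite E Et.
  move=> t /andP[t0 t1]; rewrite E; apply: h.
  by rewrite addr_ge0//= -lerBrDl.
- by rewrite E Et.
- by rewrite addrAC.
- move=> t t0; rewrite lerBrDl E; case: ifPn => // _.
  by rewrite E Et; congr poly_at; rewrite opprB addrA (addrC t).
Qed.

Lemma poly_at_in U x l t : poly_ok U x l -> 0 <= t <= poly_len l -> U (poly_at x l t).
Proof. by move=> ok tl; have [l1 [k1 <- _]] := poly_take ok tl; exact: poly_ok_end. Qed.

Lemma poly_at_reach U x l s t : poly_ok U x l -> 0 <= s -> s <= t -> t <= poly_len l ->
  reach U (t - s) (poly_at x l s) (poly_at x l t).
Proof.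
move=> ok s0 st tl.
have [|l2 [k2 _ len2 at2]] := poly_drop ok (s := s); first by rewrite s0 (le_trans st).
have ts : 0 <= t - s <= poly_len l2 by rewrite subr_ge0 st len2 lerD2r.
have [l1 [k1 e1 len1]] := poly_take k2 ts.
exists l1; split=> //; rewrite e1 at2 ?subr_ge0//.
by rewrite addrC subrK.
Qed.

Lemma reach_nr_le U (M L : R) x y : U `<=` Omega -> (forall z, Omega z -> nr z <= M) ->
  reach U L x y -> nr (x - y) <= 16 * M * L.
Proof.
move=> UO OM [l [ok <- <-]] {y L}; elim: l x ok => [x Ux|[tau v] l ih x /= [t0 h ok]].
  by rewrite subrr nr0 mulr0.
have [|/UO Ox kx] := h 0; first by rewrite lexx ltW.
have vb := kmetric_lower v oOmega OM Ox.
have M0 : 0 <= 16 * M by rewrite mulr_ge0// (le_trans (nr_ge0 _) (OM _ Ox)).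
rewrite mulrDr (le_trans (nr_distD _ (x + tau%:C%C *: v) _))// lerD//; last exact: ih.
rewrite opprD addNKr nrN nrZr gtr0_norm// mulrC ler_pM2r//.
by rewrite (le_trans vb)// ler_piMr.
Qed.

Lemma cousin (P : R -> R -> Prop) (a b : R) : a <= b ->
  P a a ->
  (forall r s t, a <= r -> r <= s -> s <= t -> t <= b -> P r s -> P s t -> P r t) ->
  (forall t, a <= t <= b -> exists2 d : R, 0 < d & forall r s, a <= r -> r <= t -> t <= s ->
     s <= b -> t - r < d -> s - t < d -> r < s -> P r s) ->
  P a b.
Proof.
move=> ab Paa tr loc.
pose E := [set t | a <= t <= b /\ P a t].
have Ea : E a by split=> //; rewrite lexx.
have Eub : ubound E b by move=> t [/andP[]].
have hs : has_sup E by split; [exists a|exists b].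
set T := sup E.
have aT : a <= T by apply: ub_le_sup => //; exists b.
have Tb : T <= b by apply: ge_sup => //; exists a.
have [|d d0 hd] := loc T; first by rewrite aT.
have [t [/andP[at_ tb] Pt] tT] := sup_adherent d0 hs.
have tleT : t <= T by apply: (ub_le_sup hs.2); split=> //; rewrite at_.
pose s := Num.min b (T + d / 2).
have d20 : 0 < d / 2 by rewrite divr_gt0.
have Ts : T <= s by rewrite le_min Tb lerDl ltW.
have sb : s <= b by rewrite ge_min lexx.
have as_ : a <= s by rewrite (le_trans aT).
have Es : E s.
  split; first by rewrite as_.
  have := tleT; rewrite le_eqVlt => /predU1P[tE|tlt].
    have := Ts; rewrite le_eqVlt => /predU1P[TE|Tlt]; first by rewrite -TE -tE.
    apply: (tr a t s) => //; first by rewrite tE.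
    apply: hd => //; rewrite ?tE ?subrr//.
    rewrite ltrBlDl (@le_lt_trans _ _ (T + d / 2))// ?ge_min ?lexx ?orbT// ltrD2l.
    by rewrite ltr_pdivrMr// ltr_pMr// ltr1n.
  apply: (tr a t s) => //; first exact: le_trans Ts.
  apply: hd => //.
  - by rewrite ltrBlDl -ltrBlDr.
  - rewrite ltrBlDl (@le_lt_trans _ _ (T + d / 2))// ?ge_min ?lexx ?orbT// ltrD2l.
    by rewrite ltr_pdivrMr// ltr_pMr// ltr1n.
  - exact: lt_le_trans Ts.
have sT : s <= T by exact: (ub_le_sup hs.2 Es).
have sE : s = b.
  apply/eqP; rewrite eq_le sb/=; have := sT; rewrite /s.
  by case: (leP b (T + d / 2)) => // _; rewrite gerDl leNgt d20.
by rewrite -sE; case: Es.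
Qed.

Definition reach_le U (L : R) x y := exists2 L', L' <= L & reach U L' x y.

Lemma reach_le_cousin U (g : R -> Cn) (h : R -> R) (a b : R) : a <= b -> U (g a) ->
  (forall t, a <= t <= b -> exists2 d : R, 0 < d & forall r s, a <= r -> r <= t -> t <= s ->
     s <= b -> t - r < d -> s - t < d -> r < s -> reach_le U (h s - h r) (g r) (g s)) ->
  reach_le U (h b - h a) (g a) (g b).
Proof.
move=> ab Uga loc; apply: (@cousin (fun r s => reach_le U (h s - h r) (g r) (g s)) a b ab) => //.
  by exists 0; rewrite ?subrr//; exact: reach_refl.
move=> r s t _ _ _ _ [L1 h1 r1] [L2 h2 r2]; exists (L1 + L2); last exact: reach_trans r1 r2.
by move: h1 h2; lra.
Qed.

Definition velocity_within (a b : R) (g : R -> Cn) (t : R) v :=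
  forall e : R, 0 < e -> exists2 d : R, 0 < d & forall s, a <= s <= b -> `|s - t| < d ->
    nr (g s - g t - (s - t)%:C%C *: v) <= e * `|s - t|.

(** Since r <= t <= s, the errors of the linear approximation at r and at s add up to a small
    multiple of s - r. The mean velocity of the chord is therefore close to v, although g is
    differentiable at t only. Upper semicontinuity bounds its Kobayashi length by c all along the
    chord, which is run at 1 / c times this velocity in time c (s - r). *)
Lemma reach_le_local U (g : R -> Cn) (a b t c : R) v :
  open U -> U `<=` Omega -> a <= t <= b -> U (g t) ->
  velocity_within a b g t v -> kobayashi_metric Omega (g t) v < c ->
  exists2 d : R, 0 < d & forall r s, a <= r -> r <= t -> t <= s ->
     s <= b -> t - r < d -> s - t < d -> r < s -> reach_le U (c * (s - r)) (g r) (g s).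
Proof.
move=> oU UO tab Ugt hv kc.
have c0 : 0 < c by exact: le_lt_trans (kmetric_ge0 _ _ _) kc.
have [e e0 he] := kmetric_usc oOmega (UO _ Ugt) kc.
have /open_nrP/(_ _ Ugt)[eU eU0 heU] := oU.
pose m := Num.min e eU.
have me : m <= e by rewrite ge_min lexx.
have m0 : 0 < m by rewrite lt_min e0.
have m20 : 0 < m / 2 by rewrite divr_gt0.
have [d d0 hd] := hv _ m20.
have v10 : 0 < nr v + m by rewrite ltr_wpDl// nr_ge0.
pose d' := Num.min d (m / 2 / (nr v + m)).
have d'0 : 0 < d' by rewrite lt_min d0 divr_gt0.
exists d' => // r s ar rt ts sb trd std rs.
have sr0 : 0 < s - r by rewrite subr_gt0.
have near u : a <= u <= b -> `|u - t| < d' -> nr (g u - g t) < m / 2.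
  move=> uab; rewrite lt_min => /andP[ud ud'].
  have := hd u uab ud => H.
  have : nr (g u - g t) <= m / 2 * `|u - t| + `|u - t| * nr v.
    rewrite -nrZr -[g u - g t](subrK ((u - t)%:C%C *: v)) (le_trans (nrD _ _))//.
    by rewrite lerD.
  move=> /le_lt_trans; apply; rewrite mulrC -mulrDr -ltr_pdivlMr; last first.
    by rewrite addrC ltr_wpDl// nr_ge0.
  rewrite (lt_le_trans ud')// ler_pM2l// lef_pV2 ?posrE//.
    by rewrite addrC lerD2l ler_pdivrMr// ler_pMr// ler1n.
  by rewrite addrC ltr_wpDl// nr_ge0.
have /andP[at_ tb] := tab.
have rab : a <= r <= b by rewrite ar (le_trans rt).
have sab : a <= s <= b by rewrite sb (le_trans at_).
have rabs : `|r - t| = t - r by rewrite distrC ger0_norm// subr_ge0.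
have sabs : `|s - t| = s - t by rewrite ger0_norm// subr_ge0.
have nr_r : nr (g r - g t) < m / 2 by apply: near => //; rewrite rabs.
have nr_s : nr (g s - g t) < m / 2 by apply: near => //; rewrite sabs.
pose w := ((s - r)^-1)%:C%C *: (g s - g r).
have srC : ((s - r)%:C%C : C) != 0 by rewrite -nr_gt0 nr_real gtr0_norm.
have wE : g s - g r = (s - r)%:C%C *: w.
  by rewrite /w scalerA -rmorphM divff ?gt_eqF// scale1r.
have vw : nr (v - w) < e.
  rewrite (@le_lt_trans _ _ (m / 2))//; last first.
    rewrite (@lt_le_trans _ _ m) ?ge_min ?lexx//.
    by rewrite ltr_pdivrMr// ltr_pMr// ltr1n.
  rewrite -(ler_pM2l sr0) -[X in X * nr _](gtr0_norm sr0) -nrZr scalerBr -wE.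
  have -> : (s - r)%:C%C *: v - (g s - g r) =
      (g r - g t - (r - t)%:C%C *: v) - (g s - g t - (s - t)%:C%C *: v).
    have -> : s - r = (s - t) - (r - t) by rewrite opprB addrA subrK.
    rewrite rmorphB /= scalerBl; move: (_ *: v) (_ *: v) => A B.
    exact: zmod_quot_split.
  have dd' : d' <= d by rewrite ge_min lexx.
  rewrite (le_trans (nrB _ _))//.
  have h1 := hd r rab; rewrite rabs in h1.
  have h2 := hd s sab; rewrite sabs in h2.
  have {}h1 := h1 (lt_le_trans trd dd').
  have {}h2 := h2 (lt_le_trans std dd').
  rewrite (le_trans (lerD h1 h2))// -mulrDr mulrC ler_pM2r//.
  by rewrite addrC addrA subrK.
have segm u : 0 <= u <= 1 -> nr (g t - (g r + u%:C%C *: (g s - g r))) < m.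
  move=> /andP[u0 u1].
  have -> : g t - (g r + u%:C%C *: (g s - g r)) =
      (1 - u)%:C%C *: (g t - g r) + u%:C%C *: (g t - g s).
    rewrite rmorphB rmorph1 scalerBl scale1r !scalerBr.
    exact: zmod_convex.
  rewrite (le_lt_trans (nrD _ _))// !nrZr !ger0_norm ?subr_ge0//.
  rewrite ![nr (g t - _)]nr_distC (@le_lt_trans _ _ ((1 - u) * (m / 2) + u * (m / 2)))//.
    by rewrite lerD// ler_wpM2l ?subr_ge0// ltW.
  by rewrite -mulrDl subrK mul1r ltr_pdivrMr// ltr_pMr// ltr1n.
pose tau := c * (s - r).
have tau0 : 0 < tau by rewrite mulr_gt0.
have c1 : nr ((c^-1)%:C%C : C) = c^-1 by rewrite nr_real gtr0_norm// invr_gt0.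
have gsE : g s = g r + tau%:C%C *: ((c^-1)%:C%C *: w).
  rewrite scalerA -rmorphM /tau mulrAC divff ?gt_eqF// mul1r -wE.
  by rewrite addrC subrK.
exists tau => //; rewrite [in X in reach _ _ _ X]gsE.
apply: reach_segment => // u /andP[u0 u1].
have uE : u%:C%C *: ((c^-1)%:C%C *: w) = (u / tau)%:C%C *: (g s - g r).
  rewrite wE !scalerA -!rmorphM; congr (_%:C%C *: _).
  by rewrite mulfK ?gt_eqF// /tau invfM mulrA.
rewrite uE.
have u01 : 0 <= u / tau <= 1 by rewrite divr_ge0 ?(ltW tau0)//= ler_pdivrMr// mul1r.
have hm := segm _ u01.
have Um : U (g r + (u / tau)%:C%C *: (g s - g r)).
  by apply: heU; rewrite (lt_le_trans hm)// ge_min lexx orbT.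
have [Oz kz] := he _ _ (lt_le_trans hm me) vw.
split=> //; apply: ltW.
have cn0 : ((c^-1)%:C%C : C) != 0 by rewrite -nr_gt0 c1 invr_gt0.
by have := kmetricZ_lt oOmega Oz cn0 kz; rewrite c1 mulVf// gt_eqF.
Qed.

End Polygons.

(** * The polygonal distance and its contraction by holomorphic maps *)

Section IntrinsicDistance.
Context {R : realType} {n : nat}.
Local Notation C := R[i].
Local Notation Cn := 'rV[C]_n.
Variable Omega : set Cn.
Hypothesis oOmega : open Omega.
Implicit Types (U : set Cn) (x y z v : Cn) (l : seq (R * Cn)) (t s : R).

Lemma velocity_comp_affine (F : Cn -> Cn) x v (a b t : R) :
  differentiable F (x + t%:C%C *: v) ->
  velocity_within a b (fun s => F (x + s%:C%C *: v)) t ('d F (x + t%:C%C *: v) v).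
Proof.
move=> dF e e0; have v1 : 0 < nr v + 1 by rewrite ltr_wpDl// nr_ge0.
have [d d0 hd] := differentiable_nr dF (divr_gt0 e0 v1).
exists (d / (nr v + 1)); first by rewrite divr_gt0.
move=> s _ st.
have E : (x + s%:C%C *: v) - (x + t%:C%C *: v) = (s - t)%:C%C *: v.
  by rewrite opprD addrACA subrr add0r rmorphB scalerBl.
have nE : nr ((x + s%:C%C *: v) - (x + t%:C%C *: v)) = `|s - t| * nr v by rewrite E nrZr.
have xy : nr ((x + t%:C%C *: v) - (x + s%:C%C *: v)) < d.
  rewrite nr_distC nE (@le_lt_trans _ _ (`|s - t| * (nr v + 1)))//.
    by rewrite ler_wpM2l// lerDl.
  by rewrite -ltr_pdivlMr.
have := hd _ xy; rewrite nE E linearZ => H; apply: le_trans H _.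
rewrite [leLHS](_ : _ = e * `|s - t| * (nr v / (nr v + 1))); last by ring.
rewrite ler_piMr ?mulr_ge0 ?(ltW e0)// ler_pdivrMr// mul1r.
by rewrite lerDl.
Qed.

(* Working with a factor c > 1 and with short pieces (see cousin), one needs only
   the pointwise derivative of F, not its continuity. *)
Lemma reach_le_image (F : Cn -> Cn) U (V : set Cn) x y (L c : R) :
  holomorphic_map Omega Omega F -> U `<=` Omega -> open V -> V `<=` Omega ->
  (forall z, U z -> V (F z)) -> 1 < c -> reach Omega U L x y ->
  reach_le Omega V (c * L) (F x) (F y).
Proof.
move=> hF UO oV VO FUV c1 [l [ok <- <-]] {y L}.
elim: l x ok => [x Ux|[tau v] l ih x /= [t0 h ok]].
  by rewrite mulr0; exists 0 => //; apply: reach_refl; exact: FUV.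
have [L2 L2c r2] := ih _ ok.
have [L1 L1c r1] : reach_le Omega V (c * tau - c * 0) (F (x + 0%:C%C *: v)) (F (x + tau%:C%C *: v)).
  apply: (@reach_le_cousin _ _ _ V (fun t => F (x + t%:C%C *: v)) (fun t => c * t) 0 tau).
  - exact: ltW.
  - by apply: FUV; apply: (h 0 _).1; rewrite lexx ltW.
  move=> t tt; have [Ut kt] := h t tt.
  have [d d0 hd] := @reach_le_local _ _ _ oOmega V (fun t => F (x + t%:C%C *: v)) 0 tau t c _
    oV VO tt (FUV _ Ut) (velocity_comp_affine 0 tau (hF _ (UO _ Ut)).2)
    (le_lt_trans (le_trans (kmetric_contract _ oOmega hF (UO _ Ut)) kt) c1).
  exists d => // r s ar rt ts sb td st rs.
  by rewrite -mulrBr; exact: hd.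
rewrite scale0r addr0 mulr0 subr0 in r1 L1c.
exists (L1 + L2); last exact: reach_trans r1 r2.
by rewrite mulrDr lerD.
Qed.

Lemma poly_ok_at U U' x l : poly_ok Omega U x l ->
  (forall t, 0 <= t <= poly_len l -> U' (poly_at x l t)) -> poly_ok Omega U' x l.
Proof.
elim: l x => [x _ /(_ 0)|[tau v] l ih x /= [t0 h ok] hU].
  by rewrite /= lexx; apply.
have l0 := poly_len_ge0 ok.
split=> //.
  move=> t tt; split; last by have [] := h t tt.
  have /andP[tt0 tt1] := tt.
  by have := hU t; rewrite tt1 tt0 (le_trans tt1) ?lerDl//; apply.
apply: ih => // t /andP[tt0 tt1]; have := hU (tau + t).
rewrite addr_ge0 ?(ltW t0)// lerD2l tt1 => /(_ isT).
move: tt0; rewrite le_eqVlt => /predU1P[<-|tt0].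
  by rewrite addr0 lexx (poly_at0 ok).
by rewrite leNgt ltrDl tt0/= addrAC subrr add0r.
Qed.

Lemma kmetric0 x : Omega x -> kobayashi_metric Omega x 0 = 0.
Proof.
move=> Ox; apply/eqP; rewrite eq_le kmetric_ge0 andbT -(@nr0 R C).
apply: kmetric_le; exists (fun=> x); split=> //; last by rewrite scale0r.
Qed.

(** The metric vanishes at the zero vector, so upper semicontinuity at (z, 0) bounds by 1 the length
    of all short enough vectors based near z. A segment run with a velocity of norm e then takes
    time e^-1 times its length in norm. *)
Lemma reach_local z : Omega z -> exists2 e : R, 0 < e & forall x y,
  nr (z - x) < e -> nr (z - y) < e -> Omega x /\ reach_le Omega Omega (e^-1 * nr (x - y)) x y.
Proof.
move=> Oz; have [|e e0 he] := @kmetric_usc _ _ Omega z 0 1 oOmega Oz.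
  by rewrite kmetric0.
pose r := e / 2; have r0 : 0 < r by rewrite divr_gt0.
have re : r < e by rewrite ltr_pdivrMr// ltr_pMr// ltr1n.
have inO x : nr (z - x) < e -> Omega x.
  by move=> xe; have [] := he x 0 xe; rewrite ?subrr ?nr0.
exists r => // x y xr yr; split; first by apply: inO; exact: lt_trans re.
have [<-|xy] := eqVneq x y.
  rewrite subrr nr0 mulr0; exists 0 => //; apply: reach_refl; apply: inO; exact: lt_trans re.
have nxy : 0 < nr (y - x) by rewrite nr_gt0 subr_eq0 eq_sym.
pose tau := r^-1 * nr (x - y).
have tau0 : 0 < tau by rewrite mulr_gt0 ?invr_gt0// nr_distC.
pose v := (tau^-1)%:C%C *: (y - x).
have nv : nr v = r.
  rewrite nrZr gtr0_norm ?invr_gt0// (nr_distC y x) /tau invfM invrK -mulrA mulVf ?mulr1//.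
  by rewrite gt_eqF// nr_distC.
have yE : x + tau%:C%C *: v = y.
  by rewrite /v scalerA -rmorphM divff ?gt_eqF// scale1r addrC subrK.
exists tau => //; rewrite -[X in reach _ _ _ _ X]yE; apply: reach_segment => // t /andP[t0 t1].
suff h : nr (z - (x + t%:C%C *: v)) < e.
  have [|Ox kx] := he _ v h; first by rewrite sub0r nrN nv.
  by split=> //; exact: ltW.
have -> : x + t%:C%C *: v = x + (t / tau)%:C%C *: (y - x).
  by rewrite /v scalerA -rmorphM.
have u0 : 0 <= t / tau by rewrite divr_ge0// ltW.
have u1 : t / tau <= 1 by rewrite ler_pdivrMr// mul1r.
have -> : z - (x + (t / tau)%:C%C *: (y - x)) =
    (1 - t / tau)%:C%C *: (z - x) + (t / tau)%:C%C *: (z - y).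
  move: (t / tau) => u; rewrite rmorphB rmorph1 scalerBl scale1r !scalerBr.
  exact: zmod_convex.
apply: lt_trans re; rewrite (le_lt_trans (nrD _ _))// !nrZr !ger0_norm ?subr_ge0//.
pose m := Num.max (nr (z - x)) (nr (z - y)).
have mr : m < r by rewrite gt_max xr.
apply: le_lt_trans mr.
rewrite (_ : m = (1 - t / tau) * m + t / tau * m); last by rewrite -mulrDl subrK mul1r.
by rewrite lerD// ler_wpM2l ?subr_ge0// le_max lexx ?orbT.
Qed.

Definition dist x y : R := inf [set L | reach Omega Omega L x y].

Hypothesis cOmega : connected Omega.

Lemma reach_connected x y : Omega x -> Omega y -> exists L, reach Omega Omega L x y.
Proof.
move=> Ox; apply: (@connected_local_transfer _ _ Omega
  (fun z => exists L, reach Omega Omega L x z)) => //.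
  by exists x => //; exists 0; exact: reach_refl.
move=> z /reach_local[e e0 he]; exists e => // y1 y2 h1 h2 [L rL].
by have [_ [L' _ r']] := he _ _ h1 h2; exists (L + L'); exact: reach_trans rL r'.
Qed.

Lemma dist_le L x y : reach Omega Omega L x y -> dist x y <= L.
Proof.
move=> r; apply: ge_inf => //.
by exists 0 => L' /reach_ge0.
Qed.

Lemma dist_lt x y (c : R) : Omega x -> Omega y -> dist x y < c ->
  exists2 L, L < c & reach Omega Omega L x y.
Proof.
move=> Ox Oy dc; have [L0 r0] := reach_connected Ox Oy.
have hi : has_inf [set L | reach Omega Omega L x y].
  by split; [exists L0|exists 0 => L' /reach_ge0].
have [|L rL] := inf_adherent (_ : 0 < c - dist x y) hi; first by rewrite subr_gt0.
by rewrite addrC subrK => Lc; exists L.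
Qed.

Lemma dist_ge0 x y : 0 <= dist x y.
Proof.
rewrite /dist; set S := [set _ | _].
have [->|/set0P S0] := eqVneq S set0; first by rewrite inf0.
by apply: lb_le_inf => // L; exact: reach_ge0.
Qed.

Lemma dist_xx x : Omega x -> dist x x = 0.
Proof.
by move=> Ox; apply/eqP; rewrite eq_le dist_ge0 andbT; apply: dist_le; exact: reach_refl.
Qed.

Lemma dist_tri x y z : Omega x -> Omega y -> Omega z ->
  dist x z <= dist x y + dist y z.
Proof.
move=> Ox Oy Oz; apply/ler_addgt0Pr => e e0; have e20 : 0 < e / 2 by rewrite divr_gt0.
have [|L1 h1 r1] := @dist_lt x y (dist x y + e / 2) Ox Oy; first by rewrite ltrDl.
have [|L2 h2 r2] := @dist_lt y z (dist y z + e / 2) Oy Oz; first by rewrite ltrDl.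
rewrite (le_trans (dist_le (reach_trans r1 r2)))//.
by rewrite (le_trans (ltW (ltrD h1 h2)))// addrACA -splitr.
Qed.

Lemma dist_sym x y : dist x y = dist y x.
Proof.
by congr inf; apply/seteqP; split=> L /=; exact: reach_sym.
Qed.

Lemma dist_contract F x y : holomorphic_map Omega Omega F -> Omega x -> Omega y ->
  dist (F x) (F y) <= dist x y.
Proof.
move=> hF Ox Oy.
have h c L : 1 < c -> reach Omega Omega L x y -> dist (F x) (F y) <= c * L.
  move=> c1 r.
  have [L' L'c r'] := reach_le_image hF (fun z Oz => Oz) oOmega (fun z Oz => Oz)
    (fun z Oz => (hF z Oz).1) c1 r.
  by rewrite (le_trans (dist_le r')).
apply/ler_addgt0Pr => e e0; have e20 : 0 < e / 2 by rewrite divr_gt0.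
have [|L Lc r] := @dist_lt x y (dist x y + e / 2) Ox Oy; first by rewrite ltrDl.
have L0 := reach_ge0 r.
have L1 : 0 < L + 1 by rewrite ltr_wpDl.
have := h (1 + e / 2 / (L + 1)) L _ r.
rewrite ltrDl divr_gt0// => /(_ isT)/le_trans; apply.
rewrite mulrDl mul1r [in leRHS](splitr e) addrA lerD// ?(ltW Lc)//.
by rewrite mulrAC ler_pdivrMr// ler_pM2l// lerDl.
Qed.

Lemma dist_local z : Omega z -> exists2 e : R, 0 < e & forall x y,
  nr (z - x) < e -> nr (z - y) < e -> dist x y <= e^-1 * nr (x - y).
Proof.
move=> /reach_local[e e0 he]; exists e => // x y h1 h2.
by have [_ [L Le /dist_le/le_trans]] := he x y h1 h2; apply.
Qed.

Lemma dist_lower (M : R) x y : (forall z, Omega z -> nr z <= M) -> Omega x -> Omega y ->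
  nr (x - y) <= 16 * M * dist x y.
Proof.
move=> OM Ox Oy.
have M0 : 0 <= 16 * M by rewrite mulr_ge0// (le_trans (nr_ge0 _) (OM _ Ox)).
have M1 : 0 < 16 * M + 1 by rewrite ltr_wpDl.
apply/ler_addgt0Pr => e e0.
have [|L Lc r] := @dist_lt x y (dist x y + e / (16 * M + 1)) Ox Oy.
  by rewrite ltrDl divr_gt0.
rewrite (le_trans (reach_nr_le oOmega (fun z Oz => Oz) OM r))//.
rewrite (le_trans (ler_wpM2l M0 (ltW Lc)))// mulrDr lerD2l mulrA ler_pdivrMr// mulrC.
by rewrite ler_wpM2l ?(ltW e0)// lerDl.
Qed.

End IntrinsicDistance.

Import HBNNSimple.

(** No measurability of f is involved: the integral of a nonnegative function is the supremum of the
    integrals of the simple functions below it, and each of these is compared with the constant off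
    the null set. *)
Lemma integral_le_cst_off d (T : measurableType d) (R : realType)
    (mu : {measure set T -> \bar R}) (D N : set T) (f : T -> \bar R) (M : R) :
  measurable D -> measurable N -> mu N = 0%E -> 0 <= M ->
  (forall t, 0 <= f t)%E ->
  (forall t, D t -> ~ N t -> (f t <= M%:E)%E) ->
  (\int[mu]_(t in D) f t <= M%:E * mu D)%E.
Proof.
move=> mD mN N0 M0 f0 fM.
rewrite ge0_integralE; last by move=> t _; exact: f0.
apply: ge_ereal_sup => _ [h hf <-].
have mh : measurable_fun [set: T] (EFin \o h).
  by apply/measurable_EFinP; exact: measurable_funPT.
have h0 (t : T) : (0 <= (h t)%:E)%E by rewrite lee_fin; exact: fun_ge0.
rewrite -integralT_nnsfun (ge0_negligible_integral mN)//.
have mc : measurable_fun [set: T] ((cst M%:E) \_ D).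
  by apply/(measurable_restrictT _ mD); exact: measurable_cst.
have c0 (t : T) : (0 <= ((cst M%:E) \_ D) t)%E.
  by rewrite patchE; case: ifP => // _; rewrite lee_fin.
have mTN : measurable ([set: T] `\` N) by exact: measurableD.
have le1 : (\int[mu]_(x in setT `\` N) (h x)%:E <=
    \int[mu]_(x in setT `\` N) ((cst M%:E) \_ D) x)%E.
  apply: ge0_le_integral; rewrite //.
  - exact: measurable_funTS.
  - exact: measurable_funTS.
  move=> t [_ /= tB]; have := hf t; rewrite !patchE.
  by case: ifP => // tD /le_trans; apply; apply: fM => //; rewrite inE in tD.
apply: (le_trans le1).
apply: (@le_trans _ _ (\int[mu]_(x in setT) ((cst M%:E) \_ D) x)%E).
  by apply: ge0_subset_integral.
by rewrite -integral_mkcond integral_cst.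
Qed.

(** * Comparison with the Kobayashi distance *)

Section LengthUpperBound.
Context {R : realType} {n : nat}.
Local Notation C := R[i].
Local Notation Cn := 'rV[C]_n.
Local Notation mu := (@lebesgue_measure R).
Variable Omega : set Cn.
Hypothesis oOmega : open Omega.
Implicit Types (U : set Cn) (x y z v : Cn) (l : seq (R * Cn)) (t s : R).

Lemma nr_diff_quot (g : R -> Cn) s t v : s != t ->
  nr (v - diff_quot g t s) * `|s - t| = nr (g s - g t - (s - t)%:C%C *: v).
Proof.
move=> st; have st0 : s - t != 0 by rewrite subr_eq0.
rewrite mulrC -nrZr scalerBr /diff_quot scalerA -rmorphM divff// scale1r.
by rewrite nr_distC.
Qed.

Lemma diff_quot_lt (g : R -> Cn) s t v (e : R) : 0 < e -> s != t ->
  nr (g s - g t - (s - t)%:C%C *: v) <= e / 2 * `|s - t| -> nr (v - diff_quot g t s) < e.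
Proof.
move=> e0 st h; have st0 : 0 < `|s - t| by rewrite normr_gt0 subr_eq0.
rewrite -(ltr_pM2r st0) nr_diff_quot// (le_lt_trans h)// ltr_pM2r//.
by rewrite ltr_pdivrMr// ltr_pMr// ltr1n.
Qed.

Lemma diff_quot_cvgP (A : set R) (g : R -> Cn) t v :
  (forall e : R, 0 < e -> exists2 d : R, 0 < d & forall s, A s -> `|s - t| < d ->
     nr (g s - g t - (s - t)%:C%C *: v) <= e * `|s - t|) <->
  diff_quot g t @ within A t^' --> v.
Proof.
split=> [h|/cvg_nrP h e e0].
  apply/cvg_nrP => e e0; have e20 : 0 < e / 2 by rewrite divr_gt0.
  have [d d0 hd] := h _ e20.
  apply/nbhs_realP; exists d => // s ts st As.
  by apply: diff_quot_lt => //; apply: hd => //; rewrite distrC.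
have /nbhs_realP [d d0 hd] := h e e0.
exists d => // s As st; have [->|st'] := eqVneq s t.
  by rewrite !subrr rmorph0 scale0r subr0 nr0 normr0 mulr0.
rewrite -nr_diff_quot// ler_wpM2r// ltW//; apply: hd => //.
by rewrite distrC.
Qed.

Lemma real_derive_velocity (g : R -> Cn) t v :
  (forall e : R, 0 < e -> exists2 d : R, 0 < d & forall s, `|s - t| < d ->
     nr (g s - g t - (s - t)%:C%C *: v) <= e * `|s - t|) ->
  real_derivable g t /\ real_derive g t = v.
Proof.
move=> h.
have hv : diff_quot g t @ t^' --> v.
  apply/cvg_nrP => e e0; have e20 : 0 < e / 2 by rewrite divr_gt0.
  have [d d0 hd] := h _ e20.
  apply/nbhs_realP; exists d => // s ts st.
  by apply: diff_quot_lt => //; apply: hd => //; rewrite distrC.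
split; first by apply/cvg_ex; exists v.
by apply: cvg_lim hv; exact: norm_hausdorff.
Qed.

Lemma real_derive_affine (g : R -> Cn) t v (e : R) : 0 < e ->
  (forall s, `|s - t| < e -> g s = g t + (s - t)%:C%C *: v) ->
  real_derivable g t /\ real_derive g t = v.
Proof.
move=> e0 h; apply: real_derive_velocity => d d0; exists e => // s /h ->.
by rewrite addrAC addrK subrr nr0 mulr_ge0// ltW.
Qed.

Lemma kmetricZr_le z v (c : R) : Omega z -> 0 < c -> kobayashi_metric Omega z v <= 1 ->
  kobayashi_metric Omega z (c%:C%C *: v) <= c.
Proof.
move=> Oz c0 k1; apply/ler_addgt0Pr => e e0; apply: ltW.
have cn0 : (c%:C%C : C) != 0 by rewrite -nr_gt0 nr_real gtr0_norm.
have k1e : kobayashi_metric Omega z v < 1 + e / c.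
  by rewrite (le_lt_trans k1)// ltrDl divr_gt0.
have := kmetricZ_lt oOmega Oz cn0 k1e.
by rewrite nr_real gtr0_norm// mulrDr mulr1 mulrC divfK// gt_eqF.
Qed.

Lemma poly_velocity U x l : poly_ok Omega U x l -> exists B : seq R,
  forall t, 0 < t < poly_len l -> t \notin B -> exists v, exists2 e : R, 0 < e &
    kobayashi_metric Omega (poly_at x l t) v <= 1 /\
    forall s, `|s - t| < e -> poly_at x l s = poly_at x l t + (s - t)%:C%C *: v.
Proof.
elim: l x => [x _|[tau v] l ih x /= [tau0 h /ih [B hB]]].
  exists [::] => t /= /andP[t0 t1].
  by have := lt_trans t0 t1; rewrite ltxx.
exists (tau :: [seq tau + b | b <- B]) => t /andP[t0 t1].
rewrite inE negb_or => /andP[ttau tB].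
have [tlt|tgt] := leP t tau.
  exists v, (tau - t); first by rewrite subr_gt0 lt_neqAle ttau.
  split; first by apply: (h t _).2; rewrite tlt ltW.
  move=> s; rewrite ltr_distl => /andP[_]; rewrite addrC subrK => /ltW ->.
  by rewrite -addrA -scalerDl -rmorphD [t + _]addrC subrK.
have [||w [e e0 [kw he]]] := hB (t - tau).
- by rewrite subr_gt0 tgt ltrBlDl.
- by apply: contra tB => hb; apply/mapP; exists (t - tau) => //; rewrite addrC subrK.
exists w, (Num.min e (t - tau)); first by rewrite lt_min e0 subr_gt0.
split=> // s; rewrite lt_min => /andP[se st].
have stau : tau < s.
  by move: st; rewrite ltr_distl => /andP[+ _]; rewrite opprB addrC subrK.
have sE : s - tau - (t - tau) = s - t by rewrite opprB addrA subrK.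
by rewrite leNgt stau/= he sE.
Qed.

Lemma C1_on_affine (a b : R) (g : R -> Cn) (p w : Cn) :
  (forall t, a <= t <= b -> g t = p + (t - a)%:C%C *: w) -> C1_on a b g.
Proof.
move=> hg; exists (fun=> w); first by apply: continuous_subspaceT => t; exact: cvg_cst.
move=> t /=; rewrite in_itv/= => tab; apply/diff_quot_cvgP => e e0; exists 1 => // s.
rewrite /= in_itv/= => sab _.
have -> : g s - g t - (s - t)%:C%C *: w = 0.
  rewrite (hg _ tab) (hg _ sab) opprD addrACA subrr add0r -scalerBl -rmorphB.
  by rewrite opprB addrA subrK subrr.
by rewrite nr0 mulr_ge0// ltW.
Qed.

(** [c] is the factor by which the polygon is sped up. It stays fixed in the induction while the
    starting time [a] moves to the next break point. *)
Lemma poly_partition U x l (c a d : R) (g : R -> Cn) : 0 < c -> poly_ok Omega U x l ->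
  (forall t, a <= t <= a + poly_len l / c -> g t = poly_at x l (c * (t - a))) ->
  exists2 s : seq R, itv_partition a (a + poly_len l / c) s &
    forall i, (i < size s)%N -> C1_on (nth d (a :: s) i) (nth d s i) g.
Proof.
move=> c0; elim: l x a => [x a _ _|[tau v] l ih x a /= [t0 h ok] hg].
  by exists [::]; rewrite /= ?mul0r ?addr0.
have l0 := poly_len_ge0 ok.
have tc0 : 0 < tau / c by rewrite divr_gt0.
have lc0 : 0 <= poly_len l / c by rewrite divr_ge0// ltW.
have E : a + (tau + poly_len l) / c = a + tau / c + poly_len l / c.
  by rewrite mulrDl addrA.
have [||s [s1 s2] s3] := ih (x + tau%:C%C *: v) (a + tau / c) => //.
  move=> t /andP[t1 t2].
  have at_ : a <= t by rewrite (le_trans _ t1)// lerDl ltW.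
  have cE : c * (t - a) - tau = c * (t - (a + tau / c)).
    by rewrite opprD addrA [RHS]mulrBr (mulrC c (tau / c)) divfK// gt_eqF.
  rewrite hg ?at_ ?E//; case: ifPn => [tle|_]; last by rewrite cE.
  have tE : t = a + tau / c.
    apply/eqP; rewrite eq_le t1 andbT -lerBlDl.
    by rewrite ler_pdivlMr// mulrC.
  rewrite tE addrAC subrr add0r (mulrC c) divfK ?gt_eqF// subrr mulr0.
  by rewrite (poly_at0 ok).
exists (a + tau / c :: s).
  by rewrite E; split=> //=; rewrite ltrDl tc0.
case=> [_|i]; last by move=> i1; exact: s3.
apply: (@C1_on_affine _ _ _ x (c%:C%C *: v)) => t /= /andP[t1 t2].
rewrite hg; last by rewrite t1 E (le_trans t2)// lerDl.
have -> : c * (t - a) <= tau by rewrite mulrC -ler_pdivlMr// lerBlDl.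
by rewrite scalerA -rmorphM mulrC.
Qed.

Lemma measurable_seq (B : seq R) : measurable [set` B].
Proof.
elim: B => [|b B ih]; first by rewrite set_nil; exact: measurable0.
have -> : [set` b :: B] = [set b] `|` [set` B].
  apply/seteqP; split=> t /=; rewrite inE.
    by move=> /predU1P[->|h]; [left|right].
  by move=> [->|->]; rewrite ?eqxx ?orbT.
exact: measurableU.
Qed.

Lemma integral_le_off_seq (f : R -> R) (B : seq R) (M : R) : 0 <= M ->
  (forall t, 0 <= f t) ->
  (forall t, 0 <= t <= 1 -> t \notin B -> f t <= M) ->
  (\int[mu]_(t in `[0%R, 1%R]) (f t)%:E <= M%:E)%E.
Proof.
move=> M0 f0 fM.
have B0 : mu [set` B] = 0%E.
  by apply: countable_lebesgue_measure0; apply: finite_set_countable; exact: finite_seq.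
have E : (M%:E * (@lebesgue_measure R) `[0%R, 1%R]%classic <= M%:E)%E.
  by rewrite lebesgue_measure_itv/= lte_fin ltr01 oppr0 adde0 mule1.
apply: (le_trans (@integral_le_cst_off _ _ _ mu `[0%R, 1%R] [set` B] (fun t => (f t)%:E) M
  (measurable_itv _) (measurable_seq B) B0 M0 _ _) E).
  by move=> t; rewrite lee_fin.
by move=> t; rewrite /= in_itv/= => t01 /negP tB; rewrite lee_fin; exact: fM.
Qed.

Lemma poly_at_lip U (M : R) x l : U `<=` Omega -> (forall z, Omega z -> nr z <= M) ->
  poly_ok Omega U x l -> forall s t, 0 <= s <= poly_len l -> 0 <= t <= poly_len l ->
  nr (poly_at x l s - poly_at x l t) <= 16 * M * `|s - t|.
Proof.
move=> UO OM ok.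
have H s t : 0 <= s <= poly_len l -> 0 <= t <= poly_len l -> s <= t ->
    nr (poly_at x l s - poly_at x l t) <= 16 * M * `|s - t|.
  move=> /andP[s0 s1] /andP[t0 t1] st.
  have := reach_nr_le oOmega UO OM (poly_at_reach ok s0 st t1).
  by rewrite distrC [`|t - s|]ger0_norm// subr_ge0.
move=> s t s1 t1; have [st|/ltW st] := leP s t; first exact: H.
by rewrite nr_distC distrC; exact: H.
Qed.

Lemma kobayashi_dist_le_poly (M : R) x l : (forall z, Omega z -> nr z <= M) ->
  poly_ok Omega Omega x l -> 0 < poly_len l ->
  (kobayashi_dist Omega x (poly_end x l) <= (poly_len l)%:E)%E.
Proof.
move=> OM ok l0; set L := poly_len l.
have Ox := poly_ok_start ok.
have M0 : 0 <= 16 * M by rewrite mulr_ge0// (le_trans (nr_ge0 _) (OM _ Ox)).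
pose g t := poly_at x l (L * t).
have L01 t : 0 <= t <= 1 -> 0 <= L * t <= L.
  by move=> /andP[t0 t1]; rewrite mulr_ge0 ?(ltW l0)//= ler_piMr ?(ltW l0).
apply: (@le_trans _ _ (\int[mu]_(t in `[0%R, 1%R])
            (kobayashi_metric Omega (g t) (real_derive g t))%:E)%E).
  apply: ereal_inf_lbound; exists g => //; split.
  - split.
      apply/subspace_continuousP => t t01; apply/cvg_nrP => e e0.
      have LM0 : 0 < 16 * M * L + 1 by rewrite ltr_wpDl// mulr_ge0// ltW.
      apply/nbhs_realP; exists (e / (16 * M * L + 1)); first by rewrite divr_gt0.
      move=> s ts s01 /=.
      move: t01 s01; rewrite /= !in_itv/= => t01 s01.
      rewrite (le_lt_trans (poly_at_lip (fun z Oz => Oz) OM ok (L01 _ t01) (L01 _ s01)))//.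
      rewrite -mulrBr normrM (gtr0_norm l0) mulrA.
      rewrite (@le_lt_trans _ _ ((16 * M * L + 1) * `|t - s|))//.
        by rewrite ler_wpM2r// lerDl.
      by rewrite mulrC -ltr_pdivlMr.
    have [|s s1 s2] := @poly_partition Omega x l L 0 1 g l0 ok.
      by move=> t _; rewrite subr0.
    exists s => //; move: s1; rewrite add0r divff// gt_eqF//.
  - by move=> t /=; rewrite in_itv/= => /L01 h; exact: (poly_at_in ok).
  - by rewrite /g mulr0 (poly_at0 ok).
  - by rewrite /g mulr1 (poly_at_len ok).
have [B hB] := poly_velocity ok.
(* Away from the end points and the rescaled break times, the derivative is L times a velocity of
   Kobayashi length at most 1. *)
apply: (@integral_le_off_seq _ (0 :: 1 :: [seq b / L | b <- B])).
- exact: ltW.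
- by move=> t; exact: kmetric_ge0.
move=> t t01; rewrite !inE !negb_or => /and3P[t0 t1 tB].
have [||v [e e0 [kv hv]]] := hB (L * t).
- move/andP : t01 => [t0' t1'].
  have t0p : 0 < t by rewrite lt_neqAle t0' eq_sym t0.
  by rewrite mulr_gt0//= -/L gtr_pMr// lt_neqAle t1.
- apply: contra tB => hb; apply/mapP; exists (L * t) => //.
  by rewrite mulrAC divff ?mul1r// gt_eqF.
have [||_ ->] := @real_derive_affine g t (L%:C%C *: v) (e / L).
- by rewrite divr_gt0.
- move=> s st; rewrite /g hv -?mulrBr.
    by rewrite scalerA -rmorphM (mulrC L (s - t)).
  by rewrite normrM (gtr0_norm l0) mulrC -ltr_pdivlMr.
by apply: kmetricZr_le => //; apply: (poly_at_in ok); exact: L01.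
Qed.

Lemma kobayashi_dist_le_reach (M : R) L x y : (forall z, Omega z -> nr z <= M) ->
  reach Omega Omega L x y -> (kobayashi_dist Omega x y <= L%:E)%E.
Proof.
move=> OM [l [ok <- <-]].
apply/lee_addgt0Pr => e e0.
(* A stationary piece of duration e makes the total time positive, so that a polygon of length 0 can
   also be rescaled to [0, 1]. *)
have ok' : poly_ok Omega Omega x ((e, 0) :: l).
  split=> //=; last by rewrite scaler0 addr0.
  move=> t _; rewrite scaler0 addr0.
  have Ox := poly_ok_start ok; split=> //.
  by rewrite kmetric0.
have := kobayashi_dist_le_poly OM ok'; rewrite /= scaler0 addr0 -EFinD addrC; apply.
by rewrite ltr_wpDl// (poly_len_ge0 ok).
Qed.

End LengthUpperBound.

(** * Upper semicontinuous functions: measurability and continuous majorants *)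

Section UpperSemicontinuous.
Context {R : realType}.
Local Notation mu := (@lebesgue_measure R).
Variables (a b : R) (f : R -> R).
Hypothesis ab : a <= b.
Hypothesis usc : forall t c, a <= t <= b -> f t < c ->
  exists2 d : R, 0 < d & forall s, a <= s <= b -> `|s - t| < d -> f s < c.
Hypothesis f0 : forall t, 0 <= f t.

Lemma usc_bounded : exists2 N : R, 0 <= N & forall t, a <= t <= b -> f t <= N.
Proof.
have [N hN] : exists N : R, forall t, a <= t <= b -> f t <= N.
  apply: (@cousin _ (fun r s => exists N : R, forall t, r <= t <= s -> f t <= N) a b ab).
  - by exists (f a) => t /andP[h1 h2]; have -> : t = a by apply/eqP; rewrite eq_le h1 h2.
  - move=> r s t _ _ _ _ [N1 h1] [N2 h2]; exists (Num.max N1 N2) => u /andP[ru ut].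
    have [us|/ltW su] := leP u s.
      by rewrite le_max h1// ru.
    by rewrite le_max h2 ?orbT// su.
  move=> t tab; have ft1 : f t < f t + 1 by rewrite ltrDl.
  have [d d0 hd] := usc tab ft1.
  exists d => // r s ar rt ts sb trd std rs; exists (f t + 1) => u /andP[ru us].
  apply: ltW; apply: hd; first by rewrite (le_trans ar ru) (le_trans us sb).
  rewrite ltr_distl; apply/andP; split.
    by rewrite ltrBlDl -ltrBlDr (le_lt_trans _ trd)// lerD2l lerN2.
  by rewrite -ltrBlDl (le_lt_trans _ std)// lerD2r.
by exists N => //; apply: le_trans (f0 a) (hN a _); rewrite lexx.
Qed.

(* Continuous (indeed k-Lipschitz) and decreasing to f on [a, b] as k grows. *)
Definition sup_conv (k : nat) (t : R) : R :=
  sup [set f s - k%:R * `|t - s| | s in [set s | a <= s <= b]].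

Let ab_in : a <= a <= b. Proof. by rewrite lexx. Qed.

Lemma sup_conv_has_sup k t :
  has_sup [set f s - k%:R * `|t - s| | s in [set s | a <= s <= b]].
Proof.
have [N N0 hN] := usc_bounded.
split; first by exists (f a - k%:R * `|t - a|), a.
by exists N => _ [s /hN fs <-]; rewrite lerBlDr (le_trans fs)// lerDl mulr_ge0.
Qed.

Lemma sup_conv_ge k t : a <= t <= b -> f t <= sup_conv k t.
Proof.
move=> tab; apply: (ub_le_sup (sup_conv_has_sup k t).2); exists t => //.
by rewrite subrr normr0 mulr0 subr0.
Qed.

Lemma sup_conv_le k t c : (forall s, a <= s <= b -> f s - k%:R * `|t - s| <= c) ->
  sup_conv k t <= c.
Proof.
move=> h; apply: ge_sup; first exact: (sup_conv_has_sup k t).1.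
by move=> _ [s sab <-]; exact: h.
Qed.

Lemma sup_conv_lip k t t' : sup_conv k t <= sup_conv k t' + k%:R * `|t - t'|.
Proof.
apply: sup_conv_le => s sab.
apply: (@le_trans _ _ (f s - k%:R * `|t' - s| + k%:R * `|t - t'|)); last first.
  by rewrite lerD2r; apply: (ub_le_sup (sup_conv_has_sup k t').2); exists s.
rewrite -addrA lerD2l lerNl opprD opprK lerBlDr -mulrDr ler_wpM2l//.
by rewrite [leRHS]addrC (distrC t t') ler_distD.
Qed.

Lemma sup_conv_continuous k : continuous (sup_conv k).
Proof.
move=> t; apply/cvg_real_nrP => e e0.
have k1 : 0 < k%:R + 1 :> R by rewrite ltr_wpDl.
apply/nbhs_realP; exists (e / (k%:R + 1)); first by rewrite divr_gt0.
move=> s ts.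
have h : k%:R * `|t - s| < e.
  rewrite (@le_lt_trans _ _ ((k%:R + 1) * `|t - s|))//.
    by rewrite ler_wpM2r// lerDl.
  by rewrite mulrC -ltr_pdivlMr.
apply: le_lt_trans h; rewrite ler_norml; apply/andP; split.
  by rewrite lerBrDr addrC lerBlDr distrC; exact: sup_conv_lip.
by rewrite lerBlDl; exact: sup_conv_lip.
Qed.

Lemma sup_conv_cvg t : a <= t <= b -> sup_conv ^~ t @ \oo --> f t.
Proof.
move=> tab; apply/cvg_real_nrP => e e0; have e20 : 0 < e / 2 by rewrite divr_gt0.
have [N N0 hN] := usc_bounded.
have [|d d0 hd] := @usc t (f t + e / 2) tab; first by rewrite ltrDl.
exists (Num.truncn (N / d)).+1 => // k /= kN.
have kd : N <= k%:R * d.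
  rewrite -ler_pdivrMr// (le_trans (ltW (truncnS_gt _)))// ler_nat.
  exact: kN.
have h1 := sup_conv_ge k tab.
have h2 : sup_conv k t <= f t + e / 2.
  apply: sup_conv_le => s sab; have [ts|ts] := ltP `|t - s| d.
    rewrite lerBlDr ltW// (lt_le_trans (hd s sab _)) 1?distrC// lerDl mulr_ge0//.
  rewrite lerBlDr (le_trans (hN s sab))// (le_trans kd)//.
  by rewrite (le_trans (ler_wpM2l _ ts))// lerDr addr_ge0// ltW.
rewrite distrC ger0_norm ?subr_ge0// ltrBlDl (le_lt_trans h2)// ltrD2l.
by rewrite ltr_pdivrMr// ltr_pMr// ltr1n.
Qed.

Lemma usc_measurable : measurable_fun `[a, b] f.
Proof.
apply: (@measurable_fun_cvg _ _ _ _ sup_conv).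
  move=> k; apply: measurable_funTS; apply: continuous_measurable_fun.
  exact: sup_conv_continuous.
by move=> t; rewrite /= in_itv/=; exact: sup_conv_cvg.
Qed.

(** On the interval, all [sup_conv k] lie between f and a common constant bound and converge to f.
    By dominated convergence one of them has an integral exceeding that of f by less than e. *)
Lemma usc_integral_approx (e : R) : 0 < e -> exists h : R -> R,
  [/\ continuous h, forall t, a <= t <= b -> f t <= h t &
    ((itv_int a b h)%:E <= \int[mu]_(t in `[a, b]) (f t)%:E + e%:E)%E].
Proof.
move=> e0; have [N N0 hN] := usc_bounded.
have mab : measurable `[a, b]%classic by exact: measurable_itv.
have cwithin k : {within `[a, b], continuous (sup_conv k)}.
  by apply: continuous_subspaceT; exact: sup_conv_continuous.
have iN : mu.-integrable `[a, b] (EFin \o (fun=> N)).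
  by apply: itv_integrable; exact: within_cst.
have mk k : measurable_fun `[a, b] (EFin \o sup_conv k).
  exact: measurable_int (itv_integrable (cwithin k)).
have mf : measurable_fun `[a, b] (EFin \o f) by apply/measurable_EFinP; exact: usc_measurable.
have cv : {ae mu, forall t, `[a, b]%classic t ->
    (fun k => (EFin \o sup_conv k) t) @ \oo --> (EFin \o f) t}.
  apply: aeW => t; rewrite /= in_itv/= => tab.
  by apply/cvg_EFin; [exact: nearW|exact: sup_conv_cvg].
have dom : {ae mu, forall t k, `[a, b]%classic t ->
    (`|(EFin \o sup_conv k) t| <= (EFin \o (fun=> N)) t)%E}.
  apply: aeW => t k; rewrite /= in_itv/= => tab; rewrite lee_fin ger0_norm.
    apply: sup_conv_le => s sab; rewrite lerBlDr (le_trans (hN s sab))//.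
    by rewrite lerDl mulr_ge0.
  exact: le_trans (f0 t) (sup_conv_ge k tab).
have [if_ _ cvgf] := @dominated_convergence _ _ _ mu _ mab _ _ _ mk mf cv iN dom.
have fin : (\int[mu]_(t in `[a, b]) (f t)%:E)%E \is a fin_num.
  exact: integrable_fin_num.
have : \forall k \near \oo,
    (itv_int a b (sup_conv k) < fine (\int[mu]_(t in `[a, b]) (f t)%:E) + e)%R.
  have /fine_cvgP[_ /cvg_real_nrP/(_ e e0)] :
    (fun k => (\int[mu]_(t in `[a, b]) (sup_conv k t)%:E)%E) @ \oo -->
    (fine (\int[mu]_(t in `[a, b]) (f t)%:E))%:E.
    by rewrite fineK.
  apply: filterS => k; rewrite /= distrC => /ltr_normlW.
  by rewrite ltrBlDl.
move=> [k _ /(_ k (leqnn k)) hk]; exists (sup_conv k); split.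
- exact: sup_conv_continuous.
- by move=> t; exact: sup_conv_ge.
- by rewrite -(fineK fin) -EFinD lee_fin ltW.
Qed.

End UpperSemicontinuous.

(** * The polygonal distance is at most the Kobayashi distance *)

Section LengthLowerBound.
Context {R : realType} {n : nat}.
Local Notation C := R[i].
Local Notation Cn := 'rV[C]_n.
Local Notation mu := (@lebesgue_measure R).
Variable Omega : set Cn.
Hypothesis oOmega : open Omega.
Implicit Types (x y z v : Cn) (t s : R).

Lemma velocity_cont (a b : R) (g : R -> Cn) t v (e : R) : velocity_within a b g t v ->
  0 < e -> exists2 d : R, 0 < d & forall s, a <= s <= b -> `|s - t| < d ->
    nr (g t - g s) < e.
Proof.
move=> hv e0; have [d d0 hd] := hv 1 ltr01.
have v1 : 0 < nr v + 1 by rewrite ltr_wpDl// nr_ge0.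
exists (Num.min d (e / (nr v + 1))); first by rewrite lt_min d0 divr_gt0.
move=> s sab; rewrite lt_min => /andP[sd se].
rewrite nr_distC -[g s - g t](subrK ((s - t)%:C%C *: v)).
rewrite (le_lt_trans (nrD _ _))//.
rewrite (@le_lt_trans _ _ (1 * `|s - t| + `|s - t| * nr v))//.
  by rewrite lerD// ?hd// nrZr.
by rewrite mul1r -{1}(mulr1 `|s - t|) -mulrDr (addrC 1) -ltr_pdivlMr.
Qed.

Lemma C1_on_velocity (a b : R) (g dg : R -> Cn) :
  (forall t, `[a, b]%classic t -> diff_quot g t @ within `[a, b]%classic t^' --> dg t) ->
  forall t, a <= t <= b -> velocity_within a b g t (dg t).
Proof.
move=> h t tab e e0.
have /diff_quot_cvgP/(_ e e0)[d d0 hd] : diff_quot g t @ within `[a, b]%classic t^' --> dg t.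
  by apply: h; rewrite /= in_itv.
by exists d => // s sab; apply: hd; rewrite /= in_itv.
Qed.

Lemma C1_piece_usc (a b : R) (g dg : R -> Cn) :
  {within `[a, b], continuous dg} ->
  (forall t, a <= t <= b -> velocity_within a b g t (dg t)) ->
  (forall t, a <= t <= b -> Omega (g t)) ->
  forall t c, a <= t <= b -> kobayashi_metric Omega (g t) (dg t) < c ->
  exists2 d : R, 0 < d & forall s, a <= s <= b -> `|s - t| < d ->
    kobayashi_metric Omega (g s) (dg s) < c.
Proof.
move=> cdg hv gO t c tab kc.
have [e e0 he] := kmetric_usc oOmega (gO t tab) kc.
have [d1 d10 h1] := velocity_cont (hv t tab) e0.
have /subspace_continuousP/(_ t) := cdg.
rewrite /= in_itv/= => /(_ tab)/cvg_nrP/(_ e e0)/nbhs_realP[d2 d20 h2].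
exists (Num.min d1 d2); first by rewrite lt_min d10.
move=> s sab; rewrite lt_min => /andP[sd1 sd2].
have [] // := he (g s) (dg s) (h1 s sab sd1).
by apply: h2; rewrite 1?distrC//= in_itv.
Qed.

(** The Kobayashi length density along g is only upper semicontinuous. It is replaced by a
    continuous majorant with nearly the same integral, and the time spent on short chords is
    compared with the integral of that majorant. *)
Lemma C1_piece_reach (a b : R) (g dg : R -> Cn) (e : R) : a <= b -> 0 < e ->
  {within `[a, b], continuous dg} ->
  (forall t, a <= t <= b -> velocity_within a b g t (dg t)) ->
  (forall t, a <= t <= b -> Omega (g t)) ->
  exists2 L, reach Omega Omega L (g a) (g b) &
    (L%:E <= \int[mu]_(t in `[a, b]) (kobayashi_metric Omega (g t) (dg t))%:E + e%:E)%E.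
Proof.
move=> ab e0 cdg hv gO.
have husc := C1_piece_usc cdg hv gO.
have k0 t := kmetric_ge0 Omega (g t) (dg t).
have e20 : 0 < e / 2 by rewrite divr_gt0.
have [h [hc hf hint]] := usc_integral_approx ab husc k0 e20.
(* Raising the majorant by d costs at most e / 2 in all. Half of d gives the strict inequality
   needed for chords near t, and the other half absorbs the oscillation of [h'] near t. *)
pose d := e / 2 / (b - a + 1).
have ba1 : 0 < b - a + 1 by rewrite ltr_wpDl// subr_ge0.
have d0 : 0 < d by rewrite divr_gt0.
pose h' t := h t + d.
have hc' : continuous h'.
  move=> t; apply: cvgD; [exact: hc|exact: cvg_cst].
have cw r s : {within `[r, s], continuous h'} by apply: continuous_subspaceT.
have ga : Omega (g a) by apply: gO; rewrite lexx.
have [L Lle rL] : reach_le Omega Omega (itv_int a b h' - itv_int a a h') (g a) (g b).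
  apply: (@reach_le_cousin _ _ _ Omega g (fun t => itv_int a t h') a b ab ga).
  move=> t tab; have d20 : 0 < d / 2 by rewrite divr_gt0.
  have kc : kobayashi_metric Omega (g t) (dg t) < kobayashi_metric Omega (g t) (dg t) + d / 2.
    by rewrite ltrDl.
  have [d1 d10 h1] := reach_le_local oOmega oOmega (fun z Oz => Oz) tab (gO t tab) (hv t tab) kc.
  have /cvg_real_nrP/(_ _ d20)/nbhs_realP[d2 d20' h2] := hc' t.
  exists (Num.min d1 d2); first by rewrite lt_min d10.
  move=> r s ar rt ts sb; rewrite !lt_min => /andP[tr1 tr2] /andP[st1 st2] rs.
  have [L Lle rL] := h1 r s ar rt ts sb tr1 st1 rs.
  exists L => //; rewrite (le_trans Lle)//.
  rewrite (itv_int_split ar (ltW rs) (cw a s)).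
  rewrite addrAC subrr add0r; apply: itv_int_ge; [exact: ltW|exact: cw|].
  move=> u /andP[ru us].
  have tu : `|t - u| < d2.
    rewrite distrC ltr_distl; apply/andP; split.
      by rewrite ltrBlDl -ltrBlDr (le_lt_trans _ tr2)// lerD2l lerN2.
    by rewrite -ltrBlDl (le_lt_trans _ st2)// lerD2r.
  have := h2 u tu; rewrite ltr_norml => /andP[_ H].
  have ft := hf t tab; rewrite /h' in H *.
  by rewrite -(lerD2r d) in ft; rewrite (splitr d) in ft H *; move: H ft; clear; lra.
have hE : itv_int a b h' <= itv_int a b h + e / 2.
  have -> : itv_int a b h = itv_int a b (fun t => h' t - d).
    by congr itv_int; apply/funext => t; rewrite /h' addrK.
  rewrite itv_intB; [|exact: cw|exact: within_cst].
  rewrite itv_int_cst// -addrA lerDl addrC subr_ge0 /d mulrAC ler_pdivrMr// ler_wpM2l ?(ltW e20)//.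
  by rewrite lerDl.
have aa : itv_int a a h' = 0 by rewrite /itv_int set_itv1 Rintegral_set1.
rewrite aa subr0 in Lle; exists L => //.
apply: (@le_trans _ _ ((itv_int a b h)%:E + (e / 2)%:E)%E).
  by rewrite -EFinD lee_fin (le_trans Lle).
by rewrite (le_trans (leeD2r _ hint))// -addeA -EFinD -splitr.
Qed.

Lemma integral_itv_cc_oo (a b : R) (f : R -> R) : measurable_fun `[a, b] f ->
  (\int[mu]_(t in `[a, b]) (f t)%:E = \int[mu]_(t in `]a, b[) (f t)%:E)%E.
Proof.
move=> mf; have moo : measurable_fun `]a, b[ (EFin \o f).
  apply/measurable_EFinP; apply: measurable_funS mf => //.
  exact: subset_itv_oo_cc.
have mco : measurable_fun `[a, b[ (EFin \o f).
  apply/measurable_EFinP; apply: measurable_funS mf => //.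
  exact: subset_itv_co_cc.
by rewrite -(integral_itv_bndo_bndc mco) -(integral_itv_obnd_cbnd moo).
Qed.

Hypothesis cOmega : connected Omega.

Lemma real_derive_C1 (a b : R) (g dg : R -> Cn) t : a < t < b ->
  velocity_within a b g t (dg t) -> real_derive g t = dg t.
Proof.
move=> /andP[at_ tb] hv; apply: (real_derive_velocity _).2 => e /hv[d d0 hd].
exists (Num.min d (Num.min (t - a) (b - t))); first by rewrite !lt_min d0 !subr_gt0 at_.
move=> s; rewrite !lt_min => /and3P[sd sa sb]; apply: hd => //.
apply/andP; split; apply: ltW.
  by move: sa; rewrite ltr_distl => /andP[+ _]; rewrite opprB addrC subrK.
by move: sb; rewrite ltr_distl => /andP[_]; rewrite addrC subrK.
Qed.

(** Measurability is carried through the induction because splitting the integral over the pieces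
    requires it. On each piece [real_derive g] agrees with the derivative [dg] only in the interior,
    which suffices since end points are negligible. *)
Lemma dist_le_length_pieces (g : R -> Cn) (d a b : R) (s : seq R) :
  itv_partition a b s ->
  (forall i, (i < size s)%N -> C1_on (nth d (a :: s) i) (nth d s i) g) ->
  (forall t, a <= t <= b -> Omega (g t)) ->
  measurable_fun `[a, b] (fun t => kobayashi_metric Omega (g t) (real_derive g t)) /\
  ((dist Omega (g a) (g b))%:E <=
   \int[mu]_(t in `[a, b]) (kobayashi_metric Omega (g t) (real_derive g t))%:E)%E.
Proof.
set F := fun t => kobayashi_metric Omega (g t) (real_derive g t).
have F0 t : (0 <= (F t)%:E)%E by rewrite lee_fin; exact: kmetric_ge0.
elim: s a => [|c s ih] a part hC gO.
  have ab := itv_partition_nil part; rewrite -ab in gO *.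
  split; first by rewrite set_itv1; exact: measurable_fun_set1.
  rewrite dist_xx; last by apply: gO; rewrite lexx.
  by rewrite set_itv1 integral_set1.
have ac : a < c by case: part => /= /andP[].
have cb : c <= b by apply: (itv_partition_le (itv_partition_cons part)).
have [dg cdg /C1_on_velocity hdg] : C1_on a c g := hC 0%N isT.
have gO1 t : a <= t <= c -> Omega (g t).
  by move=> /andP[h1 h2]; apply: gO; rewrite h1 (le_trans h2).
have gO2 t : c <= t <= b -> Omega (g t).
  by move=> /andP[h1 h2]; apply: gO; rewrite h2 (le_trans _ h1)// ltW.
have [m2 d2] := ih c (itv_partition_cons part) (fun i => hC i.+1) gO2.
have eqF t : a < t < c -> kobayashi_metric Omega (g t) (dg t) = F t.
  move=> tac; have /andP[/ltW t1 /ltW t2] := tac.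
  have tac' : a <= t <= c by rewrite t1.
  by rewrite /F (real_derive_C1 tac (hdg t tac')).
have m1' : measurable_fun `]a, c[ F.
  apply: (@eq_measurable_fun _ _ _ _ _ (fun t => kobayashi_metric Omega (g t) (dg t))).
    by move=> t; rewrite inE/= in_itv/=; exact: eqF.
  apply: (@measurable_funS _ _ _ _ `[a, c]) => //.
    by apply: subset_itv_oo_cc.
  apply: (usc_measurable (ltW ac)).
    by apply: C1_piece_usc.
  by move=> t; exact: kmetric_ge0.
have m1 : measurable_fun `[a, c] F by exact: measurable_fun_itv_cc m1'.
have abU : (`[a, b] = `[a, c] `|` `]c, b])%classic.
  by rewrite -itv_bndbnd_setU// bnd_simp// ltW.
have m3 : measurable_fun `]c, b] F.
  by apply: measurable_funS m2 => //; apply: subset_itvr; rewrite bnd_simp.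
have mU : measurable_fun (`[a, c] `|` `]c, b]) F by apply/measurable_funU.
split; first by rewrite abU.
have d1 : ((dist Omega (g a) (g c))%:E <= \int[mu]_(t in `[a, c]) (F t)%:E)%E.
  have -> : (\int[mu]_(t in `[a, c]) (F t)%:E =
      \int[mu]_(t in `[a, c]) (kobayashi_metric Omega (g t) (dg t))%:E)%E.
    rewrite !integral_itv_cc_oo//; last first.
      by apply: (usc_measurable (ltW ac)); [exact: C1_piece_usc|move=> t; exact: kmetric_ge0].
    by apply: eq_integral => t; rewrite inE/= in_itv/= => /eqF ->.
  apply/lee_addgt0Pr => e e0.
  have [L rL Le] := C1_piece_reach (ltW ac) e0 cdg (fun t tac => hdg t tac) gO1.
  by apply: le_trans Le; rewrite lee_fin; exact: dist_le.
rewrite abU ge0_integral_setU//.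
- rewrite integral_itv_obnd_cbnd; last exact/measurable_EFinP.
  apply: le_trans (leeD d1 d2); rewrite -EFinD lee_fin.
  apply: (dist_tri oOmega cOmega).
  - by apply: gO; rewrite lexx (le_trans (ltW ac)).
  - by apply: gO1; rewrite lexx ltW.
  - by apply: gO2; rewrite lexx cb.
- exact/measurable_EFinP.
- by move=> t _; exact: F0.
- rewrite disj_set2E; apply/eqP/seteqP; split=> t //= [].
  by rewrite !in_itv/= => /andP[_ h1] /andP[]; rewrite ltNge h1.
Qed.

Lemma dist_le_kobayashi_dist x y : ((dist Omega x y)%:E <= kobayashi_dist Omega x y)%E.
Proof.
apply: le_ereal_inf_tmp => _ [g [[cg [s part hC]] gO <- <-]] <-.
apply: (dist_le_length_pieces part hC _).2 => t t01.
by apply: gO; rewrite /= in_itv.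
Qed.

End LengthLowerBound.

(** * Consequences of visibility *)

Section Visibility.
Context {R : realType} {n : nat}.
Local Notation C := R[i].
Local Notation Cn := 'rV[C]_n.
Variables (Omega : set Cn) (M : R).
Hypothesis oOmega : open Omega.
Hypothesis cOmega : connected Omega.
Hypothesis bOmega : forall z, Omega z -> nr z <= M.
Implicit Types (x y z v xi eta : Cn) (t s : R) (l : seq (R * Cn)).

Local Notation dist := (dist Omega).

(** The time between two points of the polygon bounds their Kobayashi distance, so only the lower
    bound must be assumed, and it passes from d to the larger Kobayashi distance. Absolute
    continuity comes from the Lipschitz bound; the derivative can misbehave only at the end points
    and at the breaks. *)
Lemma poly_almost_geodesic x l (k : R) : 0 <= k -> poly_ok Omega Omega x l ->
  (forall s t, 0 <= s -> s <= t -> t <= poly_len l ->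
     t - s - k <= dist (poly_at x l s) (poly_at x l t)) ->
  almost_geodesic Omega 1 k `[0, poly_len l] (poly_at x l).
Proof.
move=> k0 ok hk; have Ox := poly_ok_start ok.
have M0 : 0 <= 16 * M by rewrite mulr_ge0// (le_trans (nr_ge0 _) (bOmega Ox)).
have M1 : 0 < 16 * M + 1 by rewrite ltr_wpDl.
split.
- by move=> t; rewrite in_itv/=; exact: (poly_at_in ok).
- have H s t : 0 <= s -> s <= t -> t <= poly_len l ->
      ((1^-1 * `|t - s| - k)%:E <= kobayashi_dist Omega (poly_at x l s) (poly_at x l t)
        <= (1 * `|t - s| + k)%:E)%E /\
      ((1^-1 * `|t - s| - k)%:E <= kobayashi_dist Omega (poly_at x l t) (poly_at x l s)
        <= (1 * `|t - s| + k)%:E)%E.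
    move=> s0 st tl; rewrite ger0_norm ?subr_ge0// invr1 !mul1r.
    have r1 := poly_at_reach ok s0 st tl.
    have r2 := reach_sym oOmega (fun z Oz => Oz) r1.
    have lek : ((t - s)%:E <= (t - s + k)%:E)%E by rewrite lee_fin lerDl.
    have hks : ((t - s - k)%:E <= (dist (poly_at x l s) (poly_at x l t))%:E)%E.
      by rewrite lee_fin; exact: hk.
    split; apply/andP; split.
    + exact: le_trans hks (dist_le_kobayashi_dist _ _ _ _).
    + exact: le_trans (kobayashi_dist_le_reach oOmega bOmega r1) lek.
    + by rewrite dist_sym// in hks; exact: le_trans hks (dist_le_kobayashi_dist _ _ _ _).
    + exact: le_trans (kobayashi_dist_le_reach oOmega bOmega r2) lek.
  move=> s t; rewrite !in_itv/= => /andP[s0 sl] /andP[t0 tl].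
  have [st|/ltW ts] := leP s t; first by have [] := H s t s0 st tl.
  by rewrite distrC; have [] := H t s t0 ts sl.
- move=> eps eps0; exists (eps / (16 * M + 1)); first by rewrite divr_gt0.
  move=> m a b hab _ hsum.
  apply: (@le_lt_trans _ _ (\sum_i (16 * M + 1) * (b i - a i))); last first.
    by rewrite -mulr_sumr mulrC -ltr_pdivlMr.
  apply: ler_sum => i _; have [abi sub] := hab i.
  have ai : 0 <= a i <= poly_len l.
    by have := sub (a i); rewrite /= !in_itv/=; apply; rewrite lexx.
  have bi : 0 <= b i <= poly_len l.
    by have := sub (b i); rewrite /= !in_itv/=; apply; rewrite lexx andbT.
  rewrite (le_trans (poly_at_lip oOmega (fun z Oz => Oz) bOmega ok bi ai))//.
  by rewrite ger0_norm ?subr_ge0// ler_wpM2r ?subr_ge0// lerDl.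
- have [B hB] := poly_velocity ok.
  exists [set` 0 :: poly_len l :: B]; split.
  + exact: measurable_seq.
  + by apply: countable_lebesgue_measure0; apply: finite_set_countable; exact: finite_seq.
  move=> t /= ht; apply: contrapT => /negP; rewrite !inE !negb_or => /and3P[t0 tl tB].
  apply: ht; rewrite in_itv/= => /andP[t0' tl'].
  have [||v [e e0 [kv hv]]] := hB t.
  + by rewrite !lt_neqAle t0' tl' eq_sym t0 tl.
  + by [].
  by have [? ->] := real_derive_affine e0 hv.
Qed.

Lemma bdry_closure xi : bdry Omega xi -> closure Omega xi.
Proof. by case. Qed.

Lemma bdry_notin xi : bdry Omega xi -> ~ Omega xi.
Proof.
move=> [_ h] Ox; apply: h; move: oOmega; rewrite openE; exact.
Qed.

Hypothesis visOmega : visibility_domain Omega.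

Lemma visibility_poly xi eta (k : R) : bdry Omega xi -> bdry Omega eta -> xi <> eta ->
  0 <= k -> exists2 r : R, 0 < r & exists2 K : set Cn, compact K /\ K `<=` Omega &
    forall x l, nr (xi - x) < r -> nr (eta - poly_end x l) < r ->
      poly_ok Omega Omega x l ->
      (forall s t, 0 <= s -> s <= t -> t <= poly_len l ->
        t - s - k <= dist (poly_at x l s) (poly_at x l t)) ->
      exists2 t, 0 <= t <= poly_len l & K (poly_at x l t).
Proof.
move=> bxi beta xieta k0.
have d0 : 0 < nr (xi - eta) by rewrite nr_gt0 subr_eq0; apply/eqP.
(* A point in both closures would be within 2 r of xi and of eta, against |xi - eta| = 4 r. *)
pose r := nr (xi - eta) / 4; have r0 : 0 < r by rewrite divr_gt0.
pose V := closure Omega `&` [set y | nr (xi - y) < r].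
pose W := closure Omega `&` [set y | nr (eta - y) < r].
have ob z : open [set y : Cn | nr (z - y) < r].
  apply/open_nrP => y /= zy; exists (r - nr (z - y)); first by rewrite subr_gt0.
  move=> w yw; rewrite (le_lt_trans (nr_distD _ y _))//.
  by rewrite addrC -ltrBrDr.
have nV : open_nbhs_in_closure Omega xi V.
  split; last by exists [set y | nr (xi - y) < r].
  by split; [exact: bdry_closure|rewrite /= subrr nr0].
have nW : open_nbhs_in_closure Omega eta W.
  split; last by exists [set y | nr (eta - y) < r].
  by split; [exact: bdry_closure|rewrite /= subrr nr0].
have VW : closure V `&` closure W = set0.
  apply/seteqP; split=> // y [/closure_nrP hV /closure_nrP hW].
  have [v [_ /= xv] yv] := hV r r0; have [w [_ /= ew] yw] := hW r r0.
  have := nr_distD xi y eta; have := nr_distD xi v y; have := nr_distD y w eta.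
  rewrite (nr_distC w eta) (nr_distC v y).
  have -> : nr (xi - eta) = 4 * r by rewrite mulrC divfK.
  move=> h1 h2 h3.
  have := le_lt_trans (le_trans h3 (lerD h2 h1)) (ltrD (ltrD xv yv) (ltrD yw ew)).
  rewrite (_ : r + r + (r + r) = 4 * r) ?ltxx//; clear; clearbody r; ring.
have [K [cK KO hK]] := visOmega.2 1 k (lexx 1) k0 xi eta bxi beta xieta V W nV nW VW.
exists r => //; exists K => // x l xr er ok hlow.
have l0 := poly_len_ge0 ok.
have Vx : V (poly_at x l 0).
  by rewrite (poly_at0 ok); split=> //; apply: subset_closure; exact: poly_ok_start ok.
have Wy : W (poly_at x l (poly_len l)).
  by rewrite (poly_at_len ok); split=> //; apply: subset_closure; exact: poly_ok_end ok.
have [_ [[t tl <-] Kt]] := hK _ _ l0 (poly_almost_geodesic k0 ok hlow) Vx Wy.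
by exists t => //; move: tl; rewrite /= in_itv.
Qed.

(** A polygon of length at most L is an almost-geodesic with additive constant L, because the lower
    bound t - s - L is then at most 0. *)
Lemma visibility_bounded xi eta (L : R) : bdry Omega xi -> bdry Omega eta -> xi <> eta ->
  0 <= L -> exists2 r : R, 0 < r & exists2 K : set Cn, compact K /\ K `<=` Omega &
    forall x l, nr (xi - x) < r -> nr (eta - poly_end x l) < r ->
      poly_ok Omega Omega x l -> poly_len l <= L ->
      exists2 t, 0 <= t <= poly_len l & K (poly_at x l t).
Proof.
move=> bxi beta xieta L0.
have [r r0 [K cK hK]] := visibility_poly bxi beta xieta L0.
exists r => //; exists K => // x l xr er ok lL; apply: hK => // s t s0 st tl.
apply: le_trans (dist_ge0 _ _ _).
rewrite subr_le0 lerBlDl (le_trans tl)// (le_trans lL)// lerDr//.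
Qed.

(** A polygon from x to y of length less than d(x, y) + k loses at most k between any two of its
    points, and splitting it at a point of K gives the inequality. Since k <= 1, the compact set
    belonging to the additive constant 1 serves for all k at once, so k can later be taken small
    without changing K. *)
Lemma visibility_gromov xi eta : bdry Omega xi -> bdry Omega eta -> xi <> eta ->
  exists2 r : R, 0 < r & exists2 K : set Cn, compact K /\ K `<=` Omega &
    forall (k : R) x y, 0 < k -> k <= 1 -> Omega x -> Omega y ->
      nr (xi - x) < r -> nr (eta - y) < r ->
      exists2 p, K p & dist x p + dist p y <= dist x y + k.
Proof.
move=> bxi beta xieta.
have [r r0 [K cK hK]] := visibility_poly bxi beta xieta ler01.
exists r => //; exists K => // k x y k0 k1 Ox Oy xr yr.
have [|L Lc [l [ok yE LE]]] := @dist_lt _ _ _ oOmega cOmega x y (dist x y + k) Ox Oy.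
  by rewrite ltrDl.
have l0 := poly_len_ge0 ok.
have d0 t : 0 <= t -> t <= poly_len l -> dist x (poly_at x l t) <= t.
  move=> t0 tl; apply: dist_le; rewrite -[X in reach _ _ X]subr0.
  by rewrite -[X in reach _ _ _ X _](poly_at0 ok); exact: poly_at_reach.
have d1 t : 0 <= t -> t <= poly_len l -> dist (poly_at x l t) y <= poly_len l - t.
  move=> t0 tl; apply: dist_le.
  by rewrite -yE -(poly_at_len ok); exact: poly_at_reach.
have [||t /andP[t0 tl] Kt] := hK x l xr _ ok.
- by rewrite yE.
- move=> s t s0 st tl.
  have s1 := le_trans st tl; have t0 := le_trans s0 st.
  have Os := poly_at_in ok (introT andP (conj s0 s1)).
  have Ot := poly_at_in ok (introT andP (conj t0 tl)).
  have := dist_tri oOmega cOmega Ox Os Oy; have := dist_tri oOmega cOmega Os Ot Oy.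
  have := d0 s s0 s1; have := d1 t t0 tl; rewrite -LE in Lc.
  move: k1 Lc; move: (dist _ _) (dist _ _) (dist _ _) (dist _ _) (dist _ _) => *; lra.
exists (poly_at x l t) => //.
have := d0 t t0 tl; have := d1 t t0 tl; rewrite -LE in Lc.
by move: Lc; move: (dist _ _) (dist _ _) (dist _ _) => *; lra.
Qed.

End Visibility.

(** * Dynamics of the iterates *)

Section Iteration.
Context {R : realType} {n : nat}.
Local Notation C := R[i].
Local Notation Cn := 'rV[C]_n.
Variables (Omega : set Cn) (M : R) (F : Cn -> Cn).
Hypothesis oOmega : open Omega.
Hypothesis cOmega : connected Omega.
Hypothesis bOmega : forall z, Omega z -> nr z <= M.
Hypothesis hF : holomorphic_map Omega Omega F.
Implicit Types (x y z p q v xi eta : Cn) (K H : set Cn).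

Local Notation dist := (dist Omega).

Lemma iter_holomorphic m : holomorphic_map Omega Omega (iter m F).
Proof.
elim: m => [z Oz|m ih z Oz]; first by split=> //; exact: (differentiable_id z).
have [Oz1 dz1] := ih z Oz; have [Oz2 dz2] := hF Oz1.
split; [exact: Oz2|exact: (@differentiable_comp _ _ _ _ (iter m F) F z dz1 dz2)].
Qed.

Lemma iter_in m z : Omega z -> Omega (iter m F z).
Proof. by move=> /(iter_holomorphic m)[]. Qed.

Lemma iter_contract m x y : Omega x -> Omega y ->
  dist (iter m F x) (iter m F y) <= dist x y.
Proof. exact: (dist_contract oOmega cOmega (iter_holomorphic m)). Qed.

(** The constant 16 M is enlarged to a positive one, by which later choices of radii divide. *)
Lemma nr_le_dist x y : Omega x -> Omega y -> nr (x - y) <= (16 * `|M| + 1) * dist x y.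
Proof.
move=> Ox Oy; rewrite (le_trans (dist_lower oOmega cOmega bOmega Ox Oy))//.
rewrite ler_wpM2r ?dist_ge0// (@le_trans _ _ (16 * `|M|))//.
  by rewrite ler_pM2l// ler_norm.
by rewrite lerDl.
Qed.

Lemma modulus_gt0 : 0 < 16 * `|M| + 1.
Proof. by rewrite ltr_wpDl// mulr_ge0. Qed.

Lemma dist_small z (e : R) : Omega z -> 0 < e -> exists2 d : R, 0 < d &
  forall x, nr (z - x) < d -> Omega x /\ dist z x < e.
Proof.
move=> Oz e0; have [a a0 ha] := dist_local oOmega Oz.
have /open_nrP/(_ z Oz)[b b0 hb] := oOmega.
exists (Num.min (Num.min a b) (a * e)); first by rewrite !lt_min a0 b0 mulr_gt0.
move=> x; rewrite !lt_min => /andP[/andP[xa xb] xe]; split; first exact: hb.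
rewrite (le_lt_trans (ha z x _ xa))//; first by rewrite subrr nr0.
by rewrite mulrC ltr_pdivrMr// mulrC.
Qed.

Lemma compact_dist_bounded z K : Omega z -> compact K -> K `<=` Omega ->
  exists D : R, forall p, K p -> dist z p <= D.
Proof.
move=> Oz cK KO; apply: contrapT => /forallNP h.
have {h} hx (k : nat) : exists x, K x /\ k%:R < dist z x.
  apply: contrapT => /forallNP h'; apply: (h k%:R) => x Kx.
  by rewrite leNgt; apply/negP => kx; exact: (h' x).
have [x xP] := choice hx.
have [p Kp clp] := @compact_seq_cluster _ K (fun=> True) x cK
  (fun N => ex_intro2 _ _ N (leqnn N) I) (fun n _ => (xP n).1).
have Op := KO _ Kp; have [d d0 hd] := dist_small Op (@ltr01 R).
have [N hN] : exists N : nat, dist z p + 1 < N%:R.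
  by exists (Num.truncn (dist z p + 1)).+1; exact: truncnS_gt.
have [m [Nm _ /= /hd[Ox xp]]] := clp _ (nbhs_nr_ball p d0) N.
have := lt_trans hN (le_lt_trans _ (xP m).2); rewrite ler_nat => /(_ Nm).
by rewrite ltNge (le_trans (dist_tri oOmega cOmega Oz Op Ox))// lerD2l ltW.
Qed.

Lemma poly_trace_compact x l : poly_ok Omega Omega x l ->
  compact [set poly_at x l t | t in `[0, poly_len l]] /\
  [set poly_at x l t | t in `[0, poly_len l]] `<=` Omega.
Proof.
move=> ok; split; last first.
  by move=> _ [t /= tl <-]; apply: (poly_at_in ok); move: tl; rewrite in_itv.
apply: continuous_compact; last exact: segment_compact.
apply/subspace_continuousP => t /= tl; apply/cvg_nrP => e e0.
apply/nbhs_realP; exists (e / (16 * `|M| + 1)); first by rewrite divr_gt0// modulus_gt0.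
move=> s ts sl; move: tl sl; rewrite /= !in_itv/= => tl sl.
have := poly_at_lip oOmega (fun z Oz => Oz) bOmega ok tl sl => /le_lt_trans; apply.
rewrite ltr_pdivlMr ?modulus_gt0// mulrC in ts.
apply: le_lt_trans ts; rewrite ler_wpM2r// (@le_trans _ _ (16 * `|M|))//.
  by rewrite ler_pM2l// ler_norm.
by rewrite lerDl.
Qed.

(** * Failure of compact divergence: recurrence and bounded orbits *)

Definition escaping := forall H K, compact H -> H `<=` Omega -> compact K -> K `<=` Omega ->
  exists N : nat, forall m, (N <= m)%N -> forall z, H z -> ~ K (iter m F z).

Definition bounded_orbit z := exists2 K, compact K /\ K `<=` Omega & forall m, K (iter m F z).

Definition infinitely_often (Q : nat -> Prop) := forall N : nat, exists2 m, (N <= m)%N & Q m.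

(** There are infinitely many m with points z m of H mapped by F^m into K. At a cluster point p of
    these points, contraction puts F^m p close to F^m (z m), hence in a compact thickening of K,
    where the orbit of p clusters. *)
Lemma not_escaping_cluster : ~ escaping ->
  exists p w, [/\ Omega p, Omega w & forall e : R, 0 < e ->
    infinitely_often (fun m => nr (w - iter m F p) < e)].
Proof.
move=> /existsNP[H /existsNP[K nE]].
have [[cH HO] [cK KO] h] : [/\ compact H /\ H `<=` Omega, compact K /\ K `<=` Omega &
    infinitely_often (fun m => exists2 z, H z & K (iter m F z))].
  move: nE => /not_implyP[cH /not_implyP[HO /not_implyP[cK /not_implyP[KO /forallNP h]]]].
  split=> // N; apply: contrapT => h'; apply: (h N) => m Nm z Hz Kz; apply: h'.
  by exists m => //; exists z.
have {}hz (m : nat) : exists z, (exists2 z, H z & K (iter m F z)) -> H z /\ K (iter m F z).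
  by have [[z Hz Kz]|nz] := pselect (exists2 z, H z & K (iter m F z)); [exists z|exists 0].
have [z zP] := choice hz.
have [p Hp clp] := compact_seq_cluster cH h (fun m Qm => (zP m Qm).1).
have Op := HO _ Hp.
have [d d0 [cT TO]] := compact_open_thicken cK oOmega KO.
have [e e0 he] := dist_small Op (divr_gt0 d0 modulus_gt0).
have inf2 : infinitely_often (fun m => thicken K d (iter m F p)).
  move=> N; have [m [Nm Qm /= /he[Oz pz]]] := clp _ (nbhs_nr_ball p e0) N.
  exists m => //; exists (iter m F (z m)); first exact: (zP m Qm).2.
  rewrite nr_distC (le_trans (nr_le_dist (iter_in m Op) (iter_in m Oz)))//.
  rewrite mulrC -ler_pdivlMr ?modulus_gt0//.
  exact: le_trans (iter_contract m Op Oz) (ltW pz).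
have [w Tw clw] := compact_seq_cluster cT inf2 (fun m Qm => Qm).
exists p, w; split=> //; first exact: TO.
by move=> e' e'0 N; have [m [Nm _ mw]] := clw _ (nbhs_nr_ball w e'0) N; exists m.
Qed.

(** If F^a p and F^b p are both close to w and b is much larger than a, then F^(b-a) w is close to
    F^(b-a) F^a p = F^b p, hence to w. *)
Lemma cluster_recurrent p w : Omega p -> Omega w ->
  (forall e : R, 0 < e -> infinitely_often (fun m => nr (w - iter m F p) < e)) ->
  forall e : R, 0 < e -> infinitely_often (fun m => dist w (iter m F w) < e).
Proof.
move=> Op Ow h e e0 N.
have e20 : 0 < e / 2 by rewrite divr_gt0.
have [d d0 hd] := dist_small Ow e20.
have [a _ /hd[Oa wa]] := h d d0 0%N.
have [b Nb /hd[Ob wb]] := h d d0 (a + N)%N.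
have ab : (a <= b)%N by rewrite (leq_trans _ Nb)// leq_addr.
exists (b - a)%N; first by rewrite leq_subRL.
have Om := iter_in (b - a) Ow.
have bE : iter b F p = iter (b - a) F (iter a F p) by rewrite -iterD subnK.
rewrite (le_lt_trans (dist_tri oOmega cOmega Ow Ob Om))// (splitr e) ltrD//.
rewrite bE (le_lt_trans (iter_contract _ Oa Ow))// dist_sym//.
Qed.

Lemma iter_continuous m K : K `<=` Omega -> {within K, continuous (iter m F)}.
Proof.
move=> KO; apply: continuous_in_subspaceT => x /set_mem Kx.
by apply: differentiable_continuous; have [] := iter_holomorphic m (KO _ Kx).
Qed.

Lemma compact_iter_union K S : compact K -> K `<=` Omega ->
  exists2 H, compact H /\ H `<=` Omega & forall s x, (s <= S)%N -> K x -> H (iter s F x).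
Proof.
move=> cK KO; elim: S => [|S [H [cH HO] hH]].
  by exists K => // s x; rewrite leqn0 => /eqP ->.
exists (H `|` iter S.+1 F @` K); first split.
- apply: compactU => //; apply: continuous_compact => //; exact: iter_continuous.
- by move=> x [/HO//|[y /KO Oy <-]]; exact: iter_in.
move=> s x; rewrite leq_eqVlt => /predU1P[->|sS] Kx; first by right; exists x.
by left; exact: hH.
Qed.

(* If the return times to a ball were unbounded, a limit of points of the ball
   whose orbits stay away from it ever longer would never come back near w,
   although w is recurrent. *)
Lemma recurrent_bounded_orbit w : Omega w ->
  (forall e : R, 0 < e -> infinitely_often (fun m => dist w (iter m F w) < e)) ->
  bounded_orbit w.
Proof.
move=> Ow rec.
have /open_nrP/(_ w Ow)[d d0 hd] := oOmega.
pose rho := d / 2; have rho0 : 0 < rho by rewrite divr_gt0.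
pose K0 := [set y | nr (w - y) <= rho].
have cK0 : compact K0 by exact: closed_nr_ball_compact.
have K0O : K0 `<=` Omega.
  by move=> y wy; apply: hd; rewrite (le_lt_trans wy)// ltr_pdivrMr// ltr_pMr// ltr1n.
have [r rE] : exists r, r = rho / (16 * `|M| + 1) by eexists.
have r0 : 0 < r by rewrite rE divr_gt0// modulus_gt0.
have BK0 y : Omega y -> dist w y < r -> K0 y.
  move=> Oy wy; rewrite /K0/= (le_trans (nr_le_dist Ow Oy))// mulrC -ler_pdivlMr ?modulus_gt0//.
  by rewrite -rE ltW.
have r30 : 0 < r / 3 by rewrite divr_gt0.
have r3E : r = r / 3 + (r / 3 + r / 3) by field.
have [S hS] : exists S : nat, forall k, dist w (iter k F w) < r ->
    exists s, [/\ (0 < s)%N, (s <= S)%N & dist w (iter (k + s) F w) < r].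
  apply: contrapT => /forallNP h.
  have {}hk (S : nat) : exists k, dist w (iter k F w) < r /\
      forall s, (0 < s)%N -> (s <= S)%N -> r <= dist w (iter (k + s) F w).
    have /existsNP[k /not_implyP[wk /forallNP hs]] := h S.
    exists k; split=> // s s0 sS; rewrite leNgt; apply/negP => ws.
    exact: (hs s).
  have [k kP] := choice hk.
  have Ok S : Omega (iter (k S) F w) by exact: iter_in.
  have [p K0p clp] := @compact_seq_cluster _ K0 (fun=> True) (fun S => iter (k S) F w) cK0
    (fun N => ex_intro2 _ _ N (leqnn N) I) (fun S _ => BK0 _ (Ok S) (kP S).1).
  have Op := K0O _ K0p.
  have [e e0 he] := dist_small Op r30.
  have [a [_ _ /= /he[_ pa]]] := clp _ (nbhs_nr_ball p e0) 0%N.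
  have [j aj wj] := rec _ r30 (k a).+1.
  (* F^(k a) w is near p and F^j w is near w, so F^s p is near w. As F^(k b) w is near p for some b
     >= s, the time k b + s is a return that the choice of k b forbids. *)
  pose s := (j - k a)%N.
  have s0 : (0 < s)%N by rewrite subn_gt0.
  have [b [sb _ /= /he[_ pb]]] := clp _ (nbhs_nr_ball p e0) s.
  have := (kP b).2 s s0 sb; rewrite leNgt => /negP; apply.
  have Os := iter_in s Op; have Oj := iter_in j Ow; have Ob := iter_in (k b + s) Ow.
  rewrite [ltRHS]r3E (le_lt_trans (dist_tri oOmega cOmega Ow Oj Ob))// ltrD//.
  rewrite (le_lt_trans (dist_tri oOmega cOmega Oj Os Ob))// ltrD//.
    rewrite (_ : j = s + k a)%N; last by rewrite subnK// ltnW.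
    rewrite iterD (le_lt_trans (iter_contract _ (Ok a) Op))// dist_sym//.
  by rewrite addnC iterD (le_lt_trans (iter_contract _ Op (Ok b))).
(* With gaps between return times at most S, every m is a return time j plus some s <= S, so F^m w
   lies in one of the compact sets F^s K0. *)
have [H [cH HO] hH] := compact_iter_union S cK0 K0O.
exists H => // m.
suff [s [j [sS wj ->]]] : exists s j, [/\ (s <= S)%N, dist w (iter j F w) < r & m = (s + j)%N].
  rewrite iterD; apply: hH => //; apply: BK0 => //; exact: iter_in.
elim: m => [|m [s [j [sS wj ->]]]].
  by exists 0%N, 0%N; split=> //; rewrite dist_xx.
move: sS; rewrite leq_eqVlt => /predU1P[->|sS]; last by exists s.+1, j.
have [s' [s'0 s'S ws']] := hS j wj.
exists (S.+1 - s')%N, (j + s')%N; split=> //.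
  by rewrite leq_subLR -addn1 addnC leq_add2r.
by rewrite addnCA subnK ?leqW// addnS addnC.
Qed.

(** If some 1 / (k + 1) separated the orbit from the complement of [Omega], the closure of the orbit
    would be a compact subset of [Omega]. The pair consists of a time and a nearby point outside. *)
Lemma unbounded_orbit y : Omega y -> ~ bounded_orbit y ->
  forall k : nat, exists mb : nat * Cn, nr (iter mb.1 F y - mb.2) < k.+1%:R^-1 /\ ~ Omega mb.2.
Proof.
move=> Oy nb k; apply: contrapT => /forallNP h; apply: nb.
pose K := closure [set iter m F y | m in setT].
exists K; last by move=> m; apply: subset_closure; exists m.
split.
  apply: (@closed_bounded_rV_compact _ _ _ (M + 1)); first exact: closed_closure.
  move=> x /closure_nrP/(_ 1 ltr01)[_ [m _ <-] xm].
  have := nr_distD x (iter m F y) 0; rewrite !subr0 => /le_trans; apply.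
  by rewrite addrC lerD ?(ltW xm)//; apply: bOmega; exact: iter_in.
move=> x /closure_nrP/(_ _ (invS_gt0 k))[_ [m _ <-] xm].
apply: contrapT => nOx; apply: (h (m, x)); split=> //=.
by rewrite nr_distC.
Qed.

(* Tautness is applied to the iterates of F on an affine disc through x and y. *)
Lemma taut_bounded_orbit w : taut Omega -> Omega w -> bounded_orbit w ->
  forall z, Omega z -> bounded_orbit z.
Proof.
move=> tO Ow bw.
apply: (connected_local_transfer cOmega oOmega); first by exists w.
move=> z Oz; have /open_nrP/(_ z Oz)[d d0 hd] := oOmega.
(* The disc below has centre x, within d / 5 of z, and velocity of norm at most 4 d / 5, so it stays
   within d of z. *)
exists (d / 5); first by rewrite divr_gt0.
move=> x y zx zy [K [cK KO] hK]; apply: contrapT => ny.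
have d5 : d / 5 < d by rewrite ltr_pdivrMr// ltr_pMr// ltr1n.
have Oy : Omega y by apply: hd; exact: lt_trans zy d5.
have [mb mbP] := choice (unbounded_orbit Oy ny).
(* The factor 2 places y at parameter 1/2, inside the unit disc, while x is at parameter 0. *)
pose v := (2%:R)%:C%C *: (y - x).
pose phi (t : C) := x + t *: v.
have nv : nr v <= 4 * (d / 5).
  rewrite /v nrZr normr_nat (_ : 4 = 2%:R * 2%:R); last by rewrite -natrM.
  rewrite -mulrA ler_pM2l// mulr_natl mulr2n.
  rewrite (le_trans (nr_distD y z x))// (nr_distC y z) lerD// ltW//.
have hphi : holomorphic_map (unit_disk R) Omega phi.
  move=> t; rewrite unit_diskE => t1; split; last by have [] := is_derive_affine x v t.
  apply: hd; rewrite opprD addrA (le_lt_trans (nrB _ _))// nrZ.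
  rewrite (_ : d = d / 5 + 1 * (4 * (d / 5))); last by field.
  rewrite ltr_leD// ler_pM ?nr_ge0// ltW//.
have hk k : holomorphic_map (unit_disk R) Omega (iter (mb k).1 F \o phi).
  move=> t Dt; have [Ot dt] := hphi t Dt; split; first exact: iter_in.
  exact: (holomorphic_map_derive (iter_holomorphic (mb k).1) hphi Dt).1.
have [j jmono] := tO _ hk.
have jge k : (k <= j k)%N by elim: k => // k ih; exact: leq_ltn_trans ih (jmono _ _ (ltnSn k)).
(* In the convergent case the chosen iterates of y tend to a point of [Omega], although they come
   arbitrarily close to its complement. In the divergent case those of x leave the compact set
   containing its orbit. *)
case=> [[psi hpsi cpsi]|dpsi].
- have D2 : unit_disk R (2^-1)%:C%C.
    by rewrite unit_diskE nr_real gtr0_norm ?invr_gt0// invf_lt1 ?ltr1n.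
  have phi2 : phi (2^-1)%:C%C = y.
    by rewrite /phi /v scalerA -rmorphM mulVf ?pnatr_eq0// scale1r addrC subrK.
  have [Opsi _] := hpsi _ D2.
  have /open_nrP/(_ _ Opsi)[e e0 he] := oOmega.
  have := cpsi [set (2^-1)%:C%C] (@compact_set1 _ _).
  move=> /(_ (fun t (E : t = _) => eq_ind_r (unit_disk R) D2 E)).
  rewrite uniform_set1 => /cvg_nrP/(_ (e / 2)).
  have e20 : 0 < e / 2 by rewrite divr_gt0.
  move=> /(_ e20)[N1 _ h1]; have [N2 h2] := invS_small e20.
  have [nm Ob] := mbP (j (maxn N1 N2)); apply: Ob; apply: he.
  have /= := h1 (maxn N1 N2) (leq_maxl _ _); rewrite phi2 => h3.
  rewrite (le_lt_trans (nr_distD _ (iter (mb (j (maxn N1 N2))).1 F y) _))// (splitr e) ltrD//.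
  apply: lt_trans nm _; exact: h2 _ (leq_trans (leq_maxr N1 N2) (jge _)).
- have D0 : unit_disk R 0 by rewrite unit_diskE nr0.
  have [N _ hN] := dpsi [set 0] K (@compact_set1 _ _)
    (fun t (E : t = _) => eq_ind_r (unit_disk R) D0 E) cK KO.
  have := hN N (leqnn N); rewrite /= => E.
  suff : set0 (iter (mb (j N)).1 F x) by [].
  by rewrite -E; split=> //; exists 0 => //=; rewrite /phi scale0r addr0.
Qed.

Lemma bounded_orbit_relatively_compact z : bounded_orbit z ->
  relatively_compact_in [set iter nu F z | nu in [set nu | (0 < nu)%N]] Omega.
Proof.
move=> [K [cK KO] hK].
have clK : closed K.
  apply: compact_closed => //; exact: norm_hausdorff.
have sub : closure [set iter nu F z | nu in [set nu | (0 < nu)%N]] `<=` K.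
  by rewrite closureE => x; apply; split=> // _ [m _ <-].
split; last exact: subset_trans sub KO.
by apply: subclosed_compact sub => //; exact: closed_closure.
Qed.

(** * Compactly divergent iterates in a visibility domain *)

Hypothesis esc : escaping.

Lemma closure_compact : compact (closure Omega).
Proof.
apply: (@closed_bounded_rV_compact _ _ _ (M + 1)); first exact: closed_closure.
move=> x /closure_nrP/(_ 1 ltr01)[y Oy xy].
have := nr_distD x y 0; rewrite !subr0 => /le_trans; apply.
by rewrite addrC lerD ?(ltW xy)// bOmega.
Qed.

Lemma escaping_limit q xi : Omega q -> closure Omega xi ->
  (forall e : R, 0 < e -> infinitely_often (fun m => nr (xi - iter m F q) < e)) ->
  bdry Omega xi.
Proof.
move=> Oq cxi h; split=> // ixi.
have /interior_subset Oxi := ixi.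
have /open_nrP/(_ _ Oxi)[d d0 hd] := oOmega.
have d20 : 0 < d / 2 by rewrite divr_gt0.
have [||N hN] := esc (@compact_set1 _ q) _ (@closed_nr_ball_compact _ _ xi (d / 2)).
- by move=> _ ->.
- by move=> y /= xy; apply: hd; rewrite (le_lt_trans xy)// ltr_pdivrMr// ltr_pMr// ltr1n.
have [m Nm xm] := h _ d20 N.
by apply: (hN m Nm q) => //; exact: ltW.
Qed.

Lemma escaping_cluster q (Q : nat -> Prop) : Omega q -> infinitely_often Q ->
  exists2 xi, bdry Omega xi & forall e : R, 0 < e ->
    infinitely_often (fun m => Q m /\ nr (xi - iter m F q) < e).
Proof.
move=> Oq iQ.
have [xi cxi clxi] := compact_seq_cluster closure_compact iQ
  (fun m _ => subset_closure (iter_in m Oq)).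
have h (e : R) : 0 < e -> infinitely_often (fun m => Q m /\ nr (xi - iter m F q) < e).
  by move=> e0 N; have [m [Nm Qm xm]] := clxi _ (nbhs_nr_ball xi e0) N; exists m.
exists xi => //; apply: (escaping_limit Oq cxi) => e e0 N.
by have [m Nm [_ xm]] := h e e0 N; exists m.
Qed.

Hypothesis visOmega : visibility_domain Omega.

(* The image under F^m of a path from x to y has bounded length, and it avoids
   any given compact set for m large. *)
Lemma escaping_asymptotic x y : Omega x -> Omega y ->
  forall e : R, 0 < e -> exists N : nat, forall m, (N <= m)%N ->
    nr (iter m F x - iter m F y) < e.
Proof.
move=> Ox Oy e e0; apply: contrapT => /forallNP h.
have iQ : infinitely_often (fun m => e <= nr (iter m F x - iter m F y)).
  move=> N; have /existsNP[m /not_implyP[Nm /negP]] := h N.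
  by rewrite -leNgt => em; exists m.
have [[xi eta] [/= cxi ceta] cl] := compact_seq_cluster
  (compact_setX closure_compact closure_compact) iQ
  (x := fun m => (iter m F x, iter m F y))
  (fun m _ => conj (subset_closure (iter_in m Ox)) (subset_closure (iter_in m Oy))).
have {}cl (d : R) : 0 < d -> infinitely_often (fun m =>
    [/\ e <= nr (iter m F x - iter m F y), nr (xi - iter m F x) < d &
        nr (eta - iter m F y) < d]).
  move=> d0 N.
  have [|m [Nm em [xm ym]]] := cl ([set u | nr (xi - u) < d] `*` [set u | nr (eta - u) < d]) _ N.
    exists ([set u | nr (xi - u) < d], [set u | nr (eta - u) < d]) => //.
    by split; exact: nbhs_nr_ball.
  by exists m.
have bxi : bdry Omega xi.
  by apply: (escaping_limit Ox cxi) => d d0 N; have [m Nm [_ ? _]] := cl d d0 N; exists m.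
have beta : bdry Omega eta.
  by apply: (escaping_limit Oy ceta) => d d0 N; have [m Nm [_ _ ?]] := cl d d0 N; exists m.
have xieta : xi <> eta.
  move=> E; have e20 : 0 < e / 2 by rewrite divr_gt0.
  have [m _ [em xm ym]] := cl _ e20 0%N; move: em; apply/negP; rewrite -ltNge.
  rewrite (le_lt_trans (nr_distD _ xi _))// (splitr e) ltrD//; first by rewrite nr_distC.
  by rewrite E.
have [L [l [ok yE LE]]] := reach_connected oOmega cOmega Ox Oy.
have [cH HO] := poly_trace_compact ok; set H := [set _ | _ in _] in cH HO.
(* The factor 2 stands for the c > 1 lost when a polygon is mapped by an iterate. *)
have L0 : 0 <= 2 * L by rewrite mulr_ge0// -LE (poly_len_ge0 ok).
have [r r0 [K [cK KO] hK]] := visibility_bounded oOmega cOmega bOmega visOmega bxi beta xieta L0.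
have [N hN] := esc cH HO cK KO.
have [m Nm [_ xm ym]] := cl r r0 N.
have oV : open (Omega `&` ~` K).
  apply: openI => //; apply: closed_openC; apply: compact_closed => //; exact: norm_hausdorff.
have rH : reach Omega H L x y.
  exists l; split=> //; apply: (poly_ok_at ok) => t tl; by exists t; rewrite //= in_itv.
have FH z : H z -> (Omega `&` ~` K) (iter m F z).
  by move=> Hz; split; [apply: iter_in; exact: HO|exact: hN].
have [L' L'L [l' [ok' yE' LE']]] :
    reach_le Omega (Omega `&` ~` K) (2 * L) (iter m F x) (iter m F y).
  apply: (reach_le_image oOmega (iter_holomorphic m) HO oV (@subIsetl _ _ _) FH _ rH).
  by rewrite ltr1n.
have [|||t tl] := hK (iter m F x) l' xm.
- by rewrite yE'.
- by apply: poly_ok_sub ok' => z [].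
- by rewrite LE'.
by have [] := poly_at_in ok' tl.
Qed.

Lemma nr_ball_sub xi x y (e : R) : nr (xi - x) < e / 2 -> nr (x - y) < e / 2 -> nr (xi - y) < e.
Proof.
by move=> h1 h2; rewrite (le_lt_trans (nr_distD _ x _))// (splitr e) ltrD.
Qed.

Lemma escaping_cluster_transfer x y xi : Omega x -> Omega y ->
  (forall e : R, 0 < e -> infinitely_often (fun m => nr (xi - iter m F x) < e)) ->
  forall e : R, 0 < e -> infinitely_often (fun m => nr (xi - iter m F y) < e).
Proof.
move=> Ox Oy h e e0 N; have e20 : 0 < e / 2 by rewrite divr_gt0.
have [N1 h1] := escaping_asymptotic Ox Oy e20.
have [m + xm] := h _ e20 (maxn N N1); rewrite geq_max => /andP[Nm N1m].
by exists m => //; exact: nr_ball_sub xm (h1 m N1m).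
Qed.

(* Karlsson's argument: at a record time m of k |-> d(o, F^k o), one has
   d(F^k o, F^m o) <= d(o, F^(m-k) o) <= d(o, F^m o) for all k < m. If F^k o and
   F^m o were near distinct boundary points, visibility would bound d(o, F^k o). *)
Lemma cluster_unique_escaping_dist o xi eta : Omega o ->
  (forall A : R, exists N : nat, forall m, (N <= m)%N -> A < dist o (iter m F o)) ->
  bdry Omega xi -> bdry Omega eta ->
  (forall e : R, 0 < e -> infinitely_often (fun m => nr (xi - iter m F o) < e)) ->
  (forall e : R, 0 < e -> infinitely_often (fun m => nr (eta - iter m F o) < e)) ->
  xi = eta.
Proof.
move=> Oo dinf bxi beta clxi cleta.
pose a m := dist o (iter m F o).
have rec : infinitely_often (fun m => forall k, (k < m)%N -> a k <= a m).
  move=> N.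
  (* The least m >= N at which a exceeds its maximum A over the indices below N is a record time. *)
  pose A := \big[Num.max/0]_(i < N) a i.
  have [N1 hN1] := dinf A.
  have ex : exists m, (N <= m)%N && (A < a m).
    by exists (maxn N N1); rewrite leq_maxl hN1// leq_maxr.
  case: (ex_minnP ex) => m /andP[Nm Am] min.
  exists m => // k km; have [kN|Nk] := ltnP k N.
    by apply: le_trans (ltW Am); exact: (le_bigmax _ (fun i : 'I_N => a i) (Ordinal kN)).
  rewrite leNgt; apply/negP => mk.
  by have := min k; rewrite Nk (lt_trans Am mk) leqNgt km => /(_ isT).
have [zeta bzeta clz] := escaping_cluster Oo rec.
(* Only one of the two compared times can be taken to be a record, so xi and eta are each compared
   with the limit zeta along record times. *)
suff key eta' : bdry Omega eta' ->
    (forall e : R, 0 < e -> infinitely_often (fun m => nr (eta' - iter m F o) < e)) ->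
    eta' = zeta by rewrite (key xi)// (key eta).
move=> beta' cl'; apply: contrapT => ez.
have [r r0 [K [cK KO] hK]] := visibility_gromov oOmega cOmega bOmega visOmega beta' bzeta ez.
have [D hD] := compact_dist_bounded Oo cK KO.
(* Visibility with error 1 gives d(F^k o, p) <= D + 1, hence d(o, F^k o) <= 2 D + 1. *)
have [N1 hN1] := dinf (2 * D + 1).
have [k N1k xk] := cl' r r0 N1.
have [m km [mrec xm]] := clz r r0 k.+1.
have Ok := iter_in k Oo; have Om := iter_in m Oo.
have [p Kp hp] := hK 1 _ _ ltr01 (lexx 1) Ok Om xk xm.
have Op := KO _ Kp.
have h1 : dist (iter k F o) (iter m F o) <= a m.
  have -> : iter m F o = iter k F (iter (m - k) F o) by rewrite -iterD subnKC// ltnW.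
  have := iter_contract k Oo (iter_in (m - k) Oo) => /le_trans; apply.
  case: (posnP k) => [->|k_gt0]; first by rewrite subn0.
  by apply: mrec; rewrite ltn_subrL k_gt0 (leq_ltn_trans _ km).
have h2 : a m <= D + dist p (iter m F o).
  by rewrite (le_trans (dist_tri oOmega cOmega Oo Op Om))// lerD2r; exact: hD.
have h3 : a k <= D + dist (iter k F o) p.
  rewrite (le_trans (dist_tri oOmega cOmega Oo Op Ok))// lerD//; first exact: hD.
  by rewrite dist_sym.
have := hN1 k N1k; rewrite -/(a k); apply/negP; rewrite -leNgt.
by move: h1 h2 h3 hp; move: (a k) (a m) (dist _ _) (dist _ _) (dist _ _) => *; lra.
Qed.

Lemma compact_bdry_gap K eta : compact K -> K `<=` Omega -> bdry Omega eta ->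
  exists2 d : R, 0 < d & forall p, K p -> d <= nr (eta - p).
Proof.
move=> cK KO beta; have [d d0 hd] := compact_open_margin cK oOmega KO.
exists d => // p Kp; rewrite leNgt; apply/negP => pd.
by apply: (bdry_notin oOmega beta); apply: (hd p) => //; rewrite nr_distC.
Qed.

(** The base points p and q are quantified inside, so that p may be replaced each time the bound a
    is lowered. *)
Definition horo_bound zeta (a : R) := exists p q, [/\ Omega p, Omega q & forall r : R, 0 < r ->
  infinitely_often (fun m => nr (zeta - iter m F q) < r /\ dist p (iter m F q) <= a)].

(* Apply an iterate F^j with F^j p near eta. Visibility then forces the almost
   geodesics from F^j p to F^(m+j) q, which is near zeta, to meet a compact K.
   Taking a limit of meeting points as the new base point saves the distance
   from K to eta. *)
Lemma horo_bound_decrease zeta eta : bdry Omega zeta -> bdry Omega eta -> eta <> zeta ->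
  (forall q, Omega q -> forall e : R, 0 < e ->
    infinitely_often (fun m => nr (eta - iter m F q) < e)) ->
  exists2 c : R, 0 < c & forall a, horo_bound zeta a -> horo_bound zeta (a - c).
Proof.
move=> bzeta beta ez cleta.
have [r r0 [K [cK KO] hK]] := visibility_gromov oOmega cOmega bOmega visOmega beta bzeta ez.
have [d d0 hd] := compact_bdry_gap cK KO beta.
(* F^j p is within d / 2 of eta and K is at least d away from eta. Dividing the remaining d / 2 by
   the Lipschitz constant bounds from below the distance d from F^j p to K. *)
have [c cE] : exists c, c = d / 2 / (16 * `|M| + 1) by eexists.
have c0 : 0 < c by rewrite cE !divr_gt0// modulus_gt0.
(* The error k is spent twice, on near-minimality and on replacing a meeting point by the limit
   point of the meeting points. Since 2 k <= c / 2, a gain of c / 2 remains. *)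
have [k kE] : exists k, k = Num.min 1 (c / 4) by eexists.
have k0 : 0 < k by rewrite kE lt_min ltr01 divr_gt0.
have k1 : k <= 1 by rewrite kE ge_min lexx.
have kc : k <= c / 4 by rewrite kE ge_min lexx orbT.
exists (c / 2); first by rewrite divr_gt0.
move=> a [p [q [Op Oq h]]].
have rd0 : 0 < Num.min r (d / 2) by rewrite lt_min r0 divr_gt0.
have [j _ pj] := cleta p Op _ rd0 0%N.
move: pj; rewrite lt_min => /andP[pj1 pj2]; have Oj := iter_in j Op.
have hs (i : nat) : exists mp : nat * Cn, [/\ (i <= mp.1)%N,
    nr (zeta - iter mp.1 F q) < i.+1%:R^-1, K mp.2 &
    dist mp.2 (iter mp.1 F q) <= a + k - c].
  pose s := Num.min r i.+1%:R^-1; have s0 : 0 < s by rewrite lt_min r0 invS_gt0.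
  have s20 : 0 < s / 2 by rewrite divr_gt0.
  (* The orbits of q and F^j q are asymptotic, so F^(m+j) q is near zeta whenever F^m q is, for m
     large. *)
  have [N1 hN1] := escaping_asymptotic Oq (iter_in j Oq) s20.
  have [m + [mz mp]] := h _ s20 (maxn i N1); rewrite geq_max => /andP[im N1m].
  have := nr_ball_sub mz (hN1 m N1m); rewrite -iterD lt_min => /andP[sr si].
  have Om := iter_in (m + j) Oq.
  have [p' Kp' hp'] := hK k _ _ k0 k1 Oj Om pj1 sr.
  exists ((m + j)%N, p'); split=> //=; first by rewrite (leq_trans im)// leq_addr.
  have h1 : dist (iter j F p) (iter (m + j) F q) <= a.
    by rewrite addnC iterD (le_trans (iter_contract j Op (iter_in m Oq))).
  have h2 : c <= dist (iter j F p) p'.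
    rewrite cE ler_pdivrMr ?modulus_gt0// [leRHS]mulrC.
    apply: le_trans (nr_le_dist Oj (KO _ Kp')).
    have := le_trans (hd p' Kp') (nr_distD eta (iter j F p) p').
    move: pj2; clear; move: (nr _) (nr _) => *; lra.
  by move: h1 h2 hp'; clear; move: (dist _ _) (dist _ _) (dist _ _) => *; lra.
have [mp mpP] := choice hs.
have [p' Kp' clp] := @compact_seq_cluster _ K (fun=> True) (fun i => (mp i).2) cK
  (fun N => ex_intro2 _ _ N (leqnn N) I) (fun i _ => let: And4 _ _ b _ := mpP i in b).
have Op' := KO _ Kp'; have [b b0 hb] := dist_small Op' k0.
exists p', q; split=> // e e0 N.
have [N1 hN1] := invS_small e0.
have [i [+ _ /= /hb[Oi pi]]] := clp _ (nbhs_nr_ball p' b0) (maxn N N1).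
rewrite geq_max => /andP[Ni N1i].
have [im zi _ di] := mpP i; have Om := iter_in (mp i).1 Oq.
exists (mp i).1; first exact: leq_trans im.
split; first exact: lt_trans zi (hN1 i N1i).
rewrite (le_trans (dist_tri oOmega cOmega Op' Oi Om))//.
by move: pi di kc; clear; move: (dist _ _) (dist _ _) => *; lra.
Qed.

Lemma horo_bound_ge0 zeta a : horo_bound zeta a -> 0 <= a.
Proof.
move=> [p [q [_ _ h]]]; have [m _ [_ pm]] := h 1 ltr01 0%N.
exact: le_trans (dist_ge0 _ _ _) pm.
Qed.

Lemma horo_bound_false zeta (a c : R) : 0 < c -> horo_bound zeta a ->
  ~ (forall a, horo_bound zeta a -> horo_bound zeta (a - c)).
Proof.
move=> c0 ha h.
have hm (m : nat) : horo_bound zeta (a - c *+ m).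
  by elim: m => [|m ih]; rewrite ?mulr0n ?subr0// mulrSr opprD addrA; exact: h.
have := horo_bound_ge0 (hm (Num.truncn (a / c)).+1).
rewrite subr_ge0 -mulr_natr leNgt => /negP; apply.
by rewrite mulrC -ltr_pdivrMr// truncnS_gt.
Qed.

(** If d(o, F^m o) does not tend to infinity, it stays below some A infinitely often. A limit point
    zeta along those times has [horo_bound zeta A], and any other limit point, being shared by all
    orbits, would let this bound be lowered below 0. *)
Lemma cluster_unique o xi eta : Omega o -> bdry Omega xi -> bdry Omega eta ->
  (forall e : R, 0 < e -> infinitely_often (fun m => nr (xi - iter m F o) < e)) ->
  (forall e : R, 0 < e -> infinitely_often (fun m => nr (eta - iter m F o) < e)) ->
  xi = eta.
Proof.
move=> Oo bxi beta clxi cleta.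
have [|/existsNP[A /forallNP hA]] := pselect (forall A : R,
    exists N : nat, forall m, (N <= m)%N -> A < dist o (iter m F o)).
  by move=> dinf; exact: (cluster_unique_escaping_dist Oo dinf).
have iQ : infinitely_often (fun m => dist o (iter m F o) <= A).
  by move=> N; have /existsNP[m /not_implyP[Nm /negP]] := hA N; rewrite -leNgt; exists m.
have [zeta bzeta clz] := escaping_cluster Oo iQ.
have hz : horo_bound zeta A.
  by exists o, o; split=> // r r0 N; have [m Nm [mA mz]] := clz r r0 N; exists m.
suff key eta' : bdry Omega eta' ->
    (forall e : R, 0 < e -> infinitely_often (fun m => nr (eta' - iter m F o) < e)) ->
    eta' = zeta by rewrite (key xi)// (key eta).
move=> beta' cl'; apply: contrapT => ez.
have [c c0 hc] := horo_bound_decrease bzeta beta' ez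
  (fun q Oq => escaping_cluster_transfer Oo Oq cl').
exact: (horo_bound_false c0 hz hc).
Qed.

Lemma escaping_cvg : Omega !=set0 -> exists2 xi, bdry Omega xi &
  forall K, compact K -> K `<=` Omega -> forall e : R, 0 < e -> exists N : nat,
    forall m z, (N <= m)%N -> K z -> nr (xi - iter m F z) < e.
Proof.
case=> o Oo.
have [xi bxi clxi] := @escaping_cluster o (fun=> True) Oo (fun N => ex_intro2 _ _ N (leqnn N) I).
have {}clxi (e : R) : 0 < e -> infinitely_often (fun m => nr (xi - iter m F o) < e).
  by move=> e0 N; have [m Nm [_ xm]] := clxi e e0 N; exists m.
have cvg z (e : R) : Omega z -> 0 < e ->
    exists N : nat, forall m, (N <= m)%N -> nr (xi - iter m F z) < e.
  move=> Oz e0; apply: contrapT => /forallNP h.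
  have iQ : infinitely_often (fun m => e <= nr (xi - iter m F z)).
    by move=> N; have /existsNP[m /not_implyP[Nm /negP]] := h N; rewrite -leNgt; exists m.
  have [eta beta cleta] := escaping_cluster Oz iQ.
  have E : xi = eta.
    apply: (cluster_unique Oz bxi beta (escaping_cluster_transfer Oo Oz clxi)) => d d0 N.
    by have [m Nm [_ xm]] := cleta d d0 N; exists m.
  have [m _ [em]] := cleta e e0 0%N; apply/negP; rewrite -leNgt -E; exact: em.
(* Uniformity on K follows from contraction: bad points z m at infinitely many times cluster at some
   p in K, and F^m (z m) stays close to F^m p, which tends to xi. *)
exists xi => // K cK KO e e0; apply: contrapT => /forallNP h.
have hz (m : nat) : exists z, (exists2 z, K z & e <= nr (xi - iter m F z)) ->
    K z /\ e <= nr (xi - iter m F z).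
  have [[z Kz ez]|nz] := pselect (exists2 z, K z & e <= nr (xi - iter m F z)).
    by exists z.
  by exists o.
have [z zP] := choice hz.
have iQ : infinitely_often (fun m => exists2 z, K z & e <= nr (xi - iter m F z)).
  move=> N; have /existsNP[m /existsNP[y /not_implyP[Nm /not_implyP[Ky /negP]]]] := h N.
  by rewrite -leNgt => ey; exists m => //; exists y.
have [p Kp clp] := compact_seq_cluster cK iQ (fun m Qm => (zP m Qm).1).
have Op := KO _ Kp; have e20 : 0 < e / 2 by rewrite divr_gt0.
have [d d0 hd] := dist_small Op (divr_gt0 e20 modulus_gt0).
have [N hN] := cvg p _ Op e20.
have [m [Nm Qm /= /hd[Om pm]]] := clp _ (nbhs_nr_ball p d0) N.
have [_] := zP m Qm; apply/negP; rewrite -ltNge.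
apply: nr_ball_sub (hN m Nm) _.
rewrite (le_lt_trans (nr_le_dist (iter_in m Op) (iter_in m Om)))//.
by rewrite mulrC -ltr_pdivlMr ?modulus_gt0// (le_lt_trans (iter_contract m Op Om)).
Qed.

End Iteration.

Theorem theorem1p8 (R : realType) (n : nat) (Omega : set 'rV[R[i]]_n)
    (F : 'rV[R[i]]_n -> 'rV[R[i]]_n)
    (Omega_vis : visibility_domain Omega) (Omega_taut : taut Omega)
    (F_hol : holomorphic_map Omega Omega F) :
  let orbits_relatively_compact :=
    forall z, Omega z ->
      relatively_compact_in [set iter nu F z | nu in [set nu | (0 < nu)%N]]
        Omega in
  let iterates_cvg_to_boundary_point :=
    exists xi, [/\ bdry Omega xi,
      (forall z, Omega z -> (fun nu => iter nu F z) @ \oo --> xi) &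
      compactly_cvg Omega (fun nu => iter nu F) (fun=> xi)] in
  (orbits_relatively_compact \/ iterates_cvg_to_boundary_point) /\
  ~ (orbits_relatively_compact /\ iterates_cvg_to_boundary_point).
Proof.
move=> orc icb.
have [neq0 oOmega cOmega /bounded_set_nr[M _ bOmega]] := Omega_vis.1.
split; last first.
  move=> [horc [xi [bxi hcvg _]]]; have [z Oz] := neq0.
  have [_ sub] := horc z Oz; apply: (bdry_notin oOmega bxi); apply: sub.
  apply/closure_nrP => e e0.
  have /cvg_nrP/(_ e e0)[N _ hN] := hcvg z Oz.
  (* The orbit contains positive iterates only, so the index N, which may be 0, is shifted by
     one. *)
  exists (iter N.+1 F z); first by exists N.+1.
  by apply: hN => /=.
have [esc|nesc] := pselect (escaping Omega F).
  right; have [xi bxi hxi] := escaping_cvg oOmega cOmega bOmega F_hol esc Omega_vis neq0.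
  exists xi; split=> //.
    move=> z Oz; apply/cvg_nrP => e e0.
    have [||N hN] := hxi [set z] _ _ e e0; [exact: compact_set1|by move=> _ ->|].
    by exists N => // m Nm; exact: hN.
  move=> K cK KO P /uniform_nbhs[E [entE sub]].
  have /nbhs_nrP[e e0 he] := nbhs_entourage xi entE.
  have [N hN] := hxi K cK KO e e0.
  exists N => // m /= Nm; apply: sub => y Ky /=; apply/xsectionP/he; exact: hN.
left => z Oz; apply: bounded_orbit_relatively_compact.
have [p [w [Op Ow clw]]] := not_escaping_cluster oOmega cOmega bOmega F_hol nesc.
have rec := cluster_recurrent oOmega cOmega F_hol Op Ow clw.
have bw := recurrent_bounded_orbit oOmega cOmega bOmega F_hol Ow rec.
exact: (taut_bounded_orbit oOmega cOmega bOmega F_hol Omega_taut Ow bw).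
Qed.
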